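(* $\mathrm{MC}^*(\cap,\cup,\overline{\phantom{c}},+,-)\in\mathrm{PSPACE}$.
   Context: For $k\ge1$ let $\mathbb N_\infty^k=\mathbb N^k\cup\{\infty\}$ (natural numbers include $0$). Addition on $\mathbb N^k$ is componentwise, and $\infty+m=m+\infty=\infty+\infty=\infty$ for $m\in\mathbb N^k$. Subtraction is partial: for $a,b\in\mathbb N^k$, $a-b$ is defined (componentwise) iff $a_i-b_i\in\mathbb N$ for all $i$; $\infty-m=\infty$ for $m\in\mathbb N^k$; $m-\infty$ and $\infty-\infty$ are undefined. For $A,B\subseteq\mathbb N_\infty^k$: $A\cap B$, $A\cup B$ usual, $A+B=\{a+b:a\in A,b\in B\}$, $A-B=\{a-b: a\in A,b\in B, a-b \text{ defined}\}$, $\overline A=\mathbb N_\infty^k\setminus A$. For $\emptyset\ne\mathcal O\subseteq\{\cup,\cap,\overline{\phantom{c}},+,-\}$, an $\mathcal O$-circuit over $\mathbb N_\infty^k$ is a finite acyclic directed multigraph $C=(V,E,g_C,\alpha)$ with gates of indegree $0,1,2$, a designated output gate $g_C$, input gates labeled by elements of $\mathbb N_\infty^k$, indegree-$1$ gates labeled $\overline{\phantom{c}}$ (only if $\overline{\phantom{c}}\in\mathcal O$), indegree-$2$ gates labeled by operations in $\mathcal O\setminus\{\overline{\phantom{c}}\}$; result sets $I(g)$ are defined inductively ($\{\alpha(g)\}$ for inputs, complement of the predecessor's set, or $I(g_1)\sigma I(g_2)$ with predecessors $g_1\le g_2$), and $I(C)=I(g_C)$. Circuits are encoded as bit strings listing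 gates in reverse topological order with labels and predecessor lists, numbers in binary. $\mathrm{MC}^*(\mathcal O)$ is the set of all $(C,b)$ such that for some $k\ge1$, $C$ is an $\mathcal O$-circuit over $\mathbb N_\infty^k$, $b\in\mathbb N_\infty^k$, and $b\in I(C)$. *)

(* Defs.v *)
From Stdlib Require Import List Arith BinNat BinPos.
Import ListNotations.

(* An element of N_oo^k: [None] is infinity, [Some v] with length v = k
   is a vector of N^k. *)
Definition elt := option (list nat).

Definition valid (k : nat) (x : elt) : Prop :=
  match x with None => True | Some v => length v = k end.

Definition nset := elt -> Prop.

Definition add_elt (a b : elt) : elt :=
  match a, b with
  | Some u, Some v => Some (map (fun p => fst p + snd p) (combine u v))
  | _, _ => None
  end.

(* partial subtraction: [None] = undefined, [Some r] = defined with value r *)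
Definition sub_elt (a b : elt) : option elt :=
  match a, b with
  | Some u, Some v =>
      if forallb (fun p => Nat.leb (snd p) (fst p)) (combine u v)
      then Some (Some (map (fun p => fst p - snd p) (combine u v)))
      else None
  | None, Some _ => Some None
  | _, None => None
  end.

Definition set_single (a : elt) : nset := fun x => x = a.
Definition set_compl (k : nat) (A : nset) : nset := fun x => valid k x /\ ~ A x.
Definition set_union (A B : nset) : nset := fun x => A x \/ B x.
Definition set_inter (A B : nset) : nset := fun x => A x /\ B x.
Definition set_plus (A B : nset) : nset :=
  fun x => exists a b, A a /\ B b /\ x = add_elt a b.
Definition set_minus (A B : nset) : nset :=
  fun x => exists a b, A a /\ B b /\ sub_elt a b = Some x.

Inductive binop := OUnion | OInter | OPlus | OMinus.

(* A gate; predecessors are referred to by their index in the gate list. *)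
Inductive gate :=
| GInput (a : elt)
| GCompl (j : nat)
| GBin (o : binop) (j1 j2 : nat).

(* A circuit over N_oo^k: the list of gates in reverse topological order
   (every predecessor of gate i has an index > i) and an output gate. *)
Record circuit := mkCircuit { c_gates : list gate ; c_out : nat }.

Definition wf_gate (k n i : nat) (g : gate) : Prop :=
  match g with
  | GInput a => valid k a
  | GCompl j => i < j < n
  | GBin _ j1 j2 => i < j1 < n /\ i < j2 < n
  end.

Definition wf_circuit (k : nat) (C : circuit) : Prop :=
  1 <= k /\ c_out C < length (c_gates C) /\
  forall i, i < length (c_gates C) ->
    wf_gate k (length (c_gates C)) i (nth i (c_gates C) (GInput None)).

Definition sem_binop (o : binop) : nset -> nset -> nset :=
  match o with
  | OUnion => set_union | OInter => set_inter
  | OPlus => set_plus | OMinus => set_minus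
  end.

(* Result set of gate i, computed with fuel (fuel = number of gates is
   enough for well-formed circuits since predecessor indices increase). *)
Fixpoint gate_sem (k : nat) (gs : list gate) (fuel i : nat) : nset :=
  match fuel with
  | 0 => fun _ => False
  | S f =>
      match nth i gs (GInput None) with
      | GInput a => set_single a
      | GCompl j => set_compl k (gate_sem k gs f j)
      | GBin o j1 j2 => sem_binop o (gate_sem k gs f j1) (gate_sem k gs f j2)
      end
  end.

Definition circ_sem (k : nat) (C : circuit) : nset :=
  gate_sem k (c_gates C) (length (c_gates C)) (c_out C).

(* binary digits, most significant first, no leading zeros (0 -> []) *)
Fixpoint pos_bits (p : positive) : list bool :=
  match p with
  | xH => [true]
  | xO q => pos_bits q ++ [false]
  | xI q => pos_bits q ++ [true]
  end.

Definition nat_bits (n : nat) : list bool :=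
  match N.of_nat n with N0 => [] | Npos p => pos_bits p end.

(* self-delimiting encoding of a number: each binary digit d as "0d",
   terminated by "11" *)
Definition enc_nat (n : nat) : list bool :=
  flat_map (fun d => [false; d]) (nat_bits n) ++ [true; true].

Definition enc_nats (l : list nat) : list bool := flat_map enc_nat l.

Definition elt_code (a : elt) : list nat :=
  match a with None => [0] | Some v => 1 :: v end.

Definition binop_code (o : binop) : nat :=
  match o with OUnion => 2 | OInter => 3 | OPlus => 4 | OMinus => 5 end.

Definition gate_code (g : gate) : list nat :=
  match g with
  | GInput a => 0 :: elt_code a
  | GCompl j => [1; j]
  | GBin o j1 j2 => [binop_code o; j1; j2]
  end.

Definition instance_code (k : nat) (C : circuit) (b : elt) : list nat :=
  [k; length (c_gates C); c_out C] ++ flat_map gate_code (c_gates C)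
  ++ elt_code b.

Definition enc_instance (k : nat) (C : circuit) (b : elt) : list bool :=
  enc_nats (instance_code k C b).

Definition MC_star (x : list bool) : Prop :=
  exists k C b, wf_circuit k C /\ valid k b /\
    x = enc_instance k C b /\ circ_sem k C b.

Inductive move := MLeft | MRight | MStay.

(* States are 0 .. tm_states-1, tape symbols 0 .. tm_syms-1, where
   0 is the blank, 1 encodes the input bit false and 2 the input bit true. *)
Record TM := mkTM {
  tm_states : nat ;
  tm_syms : nat ;
  tm_delta : nat -> nat -> nat * nat * move ;
  tm_start : nat ;
  tm_accept : nat ;
  tm_reject : nat }.

Definition wf_TM (M : TM) : Prop :=
  3 <= tm_syms M /\ tm_start M < tm_states M /\ tm_accept M < tm_states M /\
  tm_reject M < tm_states M /\ tm_accept M <> tm_reject M /\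
  forall q s, q < tm_states M -> s < tm_syms M ->
    match tm_delta M q s with
    | (q', s', _) => q' < tm_states M /\ s' < tm_syms M
    end.

Record config := mkConfig { cf_state : nat ; cf_head : nat ; cf_tape : nat -> nat }.

Definition halted (M : TM) (c : config) : Prop :=
  cf_state c = tm_accept M \/ cf_state c = tm_reject M.

Definition move_head (h : nat) (m : move) : nat :=
  match m with MLeft => pred h | MRight => S h | MStay => h end.

Definition step (M : TM) (c : config) : config :=
  if (Nat.eqb (cf_state c) (tm_accept M) || Nat.eqb (cf_state c) (tm_reject M))%bool
  then c
  else
    match tm_delta M (cf_state c) (cf_tape c (cf_head c)) with
    | (q', s', m) =>
        mkConfig q' (move_head (cf_head c) m)
          (fun i => if Nat.eqb i (cf_head c) then s' else cf_tape c i)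
    end.

Definition init_config (M : TM) (x : list bool) : config :=
  mkConfig (tm_start M) 0
    (fun i => if Nat.ltb i (length x) then (if nth i x false then 2 else 1) else 0).

Definition run (M : TM) (x : list bool) (t : nat) : config :=
  Nat.iter t (step M) (init_config M x).

Definition decides_in_space (M : TM) (L : list bool -> Prop) (bound : nat -> nat) : Prop :=
  forall x,
    (exists t, halted M (run M x t) /\
               (cf_state (run M x t) = tm_accept M <-> L x)) /\
    (forall t, cf_head (run M x t) < bound (length x)).

Definition PSPACE (L : list bool -> Prop) : Prop :=
  exists M c, wf_TM M /\ decides_in_space M L (fun n => c * n ^ c + c).

(* Main.v *)
(* Result sets do not distinguish large numbers: if all input entries are below
   t, a gate of depth d sees a coordinate x only through min (x, t 2^d). Only
   addition doubles the threshold, because a large coordinate of a sum has a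
   large summand, which absorbs any change. So membership can be decided in the
   box [0, T]^k with T = 4^|x|, reading a - b = x as a = min (T, x + b). It is a
   game of polynomial depth whose positions have polynomially many bits: the
   prover proposes the operands of a gate, the opponent challenges one of them,
   and complement exchanges the players. Depth-first search of this game keeps
   one frame per level. As time is irrelevant, it can be a while program on
   finitely many numbers below 2^poly, hence a counter machine whose registers
   are written in binary on the tracks of a single tape. *)
From Stdlib Require Import List Arith Bool Lia FunctionalExtensionality BinNat BinPos Pnat.
Require Import Defs.
Import ListNotations.

(** * Counter machines on a Turing machine tape *)

(** Saturation is a two-sided statement: points with equal truncations are members together or not
    at all. This is what tames complement, since a non-member, like a member, may be replaced by its
    representative in the box, and both players of the game query boxed points only.

    The threshold [4 ^ n] has two factors [2 ^ n]: one exceeds every number that fits into an input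
    of length [n], the other pays for one doubling per gate, of which there are at most [n]. The
    same base [T + 1] packs tokens, coordinates and hence point codes, so that extracting a point
    from the input is a division.

    Space is not measured separately. The execution relations of both languages carry a bound that
    every intermediate value has to respect, so exhibiting one execution gives termination,
    correctness and the space bound at once. Each compilation step preserves this bound, and the
    tape layer finally turns values below [2 ^ H] into about [H] cells. The price is that overflow
    conditions accompany every arithmetic operation of the program. *)

Definition state := nat -> nat.

Definition upd (s : state) (r v : nat) : state :=
  fun i => if i =? r then v else s i.

Lemma upd_same s r v : upd s r v r = v.
Proof. unfold upd. now rewrite Nat.eqb_refl. Qed.

Lemma upd_other s r v i : i <> r -> upd s r v i = s i.
Proof. unfold upd. intros H. now apply Nat.eqb_neq in H as ->. Qed.

Inductive instr :=
| IInc (r next : nat)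
| IDec (r next : nat)
| ITest (r zero nonzero : nat)
| IHalt (b : bool).

(** The side condition of [FS_inc] is what bounds the tape. [FS_dec] excludes 0, where the borrow
    would move right forever without meeting a one. *)
Inductive flat_step (H : nat) (P : list instr) : nat * state -> nat * state -> Prop :=
| FS_inc pc s r n : nth_error P pc = Some (IInc r n) -> S (s r) < 2 ^ H ->
    flat_step H P (pc, s) (n, upd s r (S (s r)))
| FS_dec pc s r n : nth_error P pc = Some (IDec r n) -> s r <> 0 ->
    flat_step H P (pc, s) (n, upd s r (pred (s r)))
| FS_test pc s r z nz : nth_error P pc = Some (ITest r z nz) ->
    flat_step H P (pc, s) (if s r =? 0 then z else nz, s).

Inductive flat_reach (H : nat) (P : list instr) : nat * state -> nat * state -> Prop :=
| FR_refl c : flat_reach H P c c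
| FR_step c1 c2 c3 : flat_step H P c1 c2 -> flat_reach H P c2 c3 -> flat_reach H P c1 c3.

Lemma flat_reach_trans H P c1 c2 c3 :
  flat_reach H P c1 c2 -> flat_reach H P c2 c3 -> flat_reach H P c1 c3.
Proof. induction 1; eauto using flat_reach. Qed.

Lemma flat_reach_one H P c1 c2 : flat_step H P c1 c2 -> flat_reach H P c1 c2.
Proof. eauto using flat_reach. Qed.

Definition instr_reg (i : instr) : nat :=
  match i with IInc r _ | IDec r _ | ITest r _ _ => r | IHalt _ => 0 end.

Definition instr_label (i : instr) : nat :=
  match i with
  | IInc _ n | IDec _ n => n
  | ITest _ z nz => max z nz
  | IHalt _ => 0
  end.

(** The offset 2 reserves tracks 0 and 1 for the raw input symbols 1 and 2, so that the mark track
    is clear on every initial tape. *)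
Definition num_regs (P : list instr) : nat := 2 + list_max (map instr_reg P).
Definition num_labels (P : list instr) : nat := 1 + list_max (map instr_label P).

(* Control states: 0 accepts, 1 rejects, 2 marks cell 0, [exec_st pc] executes
   the instruction at [pc], [ret_st pc] walks back to cell 0 and continues at [pc]. *)
Definition exec_st pc := 3 + 2 * pc.
Definition ret_st pc := 4 + 2 * pc.

(* A tape symbol is a bit field: track [r < num_regs P] carries the bits of
   register [r], track [num_regs P] marks cell 0 and the next track records that
   the cell has been written, so that a written cell is never the blank 0. *)
Definition touch (R s : nat) : nat := Nat.setbit s (S R).

(** Bits are stored with the least significant one in cell 0, so a carry or borrow is a single sweep
    to the right. A zero test may stop at a blank, as only blanks follow it, and leaves it blank. *)
Definition exec_delta (R q : nat) (i : instr) (s : nat) : nat * nat * move :=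
  match i with
  | IInc r n =>
      if Nat.testbit s r then (q, touch R (Nat.clearbit s r), MRight)
      else (ret_st n, touch R (Nat.setbit s r), MStay)
  | IDec r n =>
      if Nat.testbit s r then (ret_st n, touch R (Nat.clearbit s r), MStay)
      else (q, touch R (Nat.setbit s r), MRight)
  | ITest r z nz =>
      if s =? 0 then (ret_st z, s, MStay)
      else if Nat.testbit s r then (ret_st nz, s, MStay)
      else (q, s, MRight)
  | IHalt b => (if b then 0 else 1, s, MStay)
  end.

Definition cm_delta (P : list instr) (q s : nat) : nat * nat * move :=
  let R := num_regs P in
  if q <=? 1 then (q, s, MStay)
  else if q =? 2 then (exec_st 0, touch R (Nat.setbit s R), MStay)
  else
    (* Rounding down recovers [pc] from both [3 + 2 * pc] and [4 + 2 * pc]. *)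
    let pc := (q - 3) / 2 in
    if Nat.odd q then exec_delta R q (nth pc P (IHalt false)) s
    else if Nat.testbit s R then (exec_st pc, s, MStay) else (q, s, MLeft).

Definition cm_TM (P : list instr) : TM :=
  mkTM (exec_st (num_labels P) + 2) (2 ^ (num_regs P + 2)) (cm_delta P) 2 0 1.

Lemma testbit_bound a m : (forall i, m <= i -> Nat.testbit a i = false) -> a < 2 ^ m.
Proof.
  intros H. rewrite <- (Nat.mod_small_iff a (2 ^ m)) by (apply Nat.pow_nonzero; lia).
  apply Nat.bits_inj. intros i. destruct (le_lt_dec m i).
  - rewrite Nat.mod_pow2_bits_high by lia. now rewrite H.
  - now rewrite Nat.mod_pow2_bits_low.
Qed.

Lemma bound_testbit a m i : a < 2 ^ m -> m <= i -> Nat.testbit a i = false.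
Proof.
  intros H Hi. rewrite <- (Nat.mod_small a (2 ^ m)) by easy.
  now apply Nat.mod_pow2_bits_high.
Qed.

Lemma setbit_bound a r m : a < 2 ^ m -> r < m -> Nat.setbit a r < 2 ^ m.
Proof.
  intros H Hr. apply testbit_bound. intros i Hi.
  rewrite Nat.setbit_neq by lia. now apply (bound_testbit a m).
Qed.

Lemma clearbit_bound a r m : a < 2 ^ m -> Nat.clearbit a r < 2 ^ m.
Proof.
  intros H. apply testbit_bound. intros i Hi.
  rewrite Nat.clearbit_eqb, (bound_testbit a m) by easy. reflexivity.
Qed.

Lemma touch_bound R s : s < 2 ^ (R + 2) -> touch R s < 2 ^ (R + 2).
Proof. intros. apply setbit_bound; lia. Qed.

Lemma testbit_touch R s r : r < S R -> Nat.testbit (touch R s) r = Nat.testbit s r.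
Proof. intros. unfold touch. apply Nat.setbit_neq. lia. Qed.

Lemma touch_nonzero R s : touch R s <> 0.
Proof.
  intros H. assert (E : Nat.testbit (touch R s) (S R) = true) by apply Nat.setbit_eq.
  rewrite H, Nat.bits_0 in E. discriminate.
Qed.

Lemma list_max_In l x : In x l -> x <= list_max l.
Proof.
  intros H. pose proof (proj1 (list_max_le l (list_max l)) (le_n _)) as HF.
  rewrite Forall_forall in HF. auto.
Qed.

Lemma instr_reg_lt P i : In i P -> instr_reg i < num_regs P.
Proof.
  intros H. unfold num_regs. enough (instr_reg i <= list_max (map instr_reg P)) by lia.
  apply list_max_In. now apply in_map.
Qed.

Lemma instr_label_lt P i : In i P -> instr_label i < num_labels P.
Proof.
  intros H. unfold num_labels.
  enough (instr_label i <= list_max (map instr_label P)) by lia.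
  apply list_max_In. now apply in_map.
Qed.

Lemma exec_pc pc : (exec_st pc - 3) / 2 = pc.
Proof.
  unfold exec_st. replace (3 + 2 * pc - 3) with (pc * 2) by lia.
  now rewrite Nat.div_mul.
Qed.

Lemma ret_pc pc : (ret_st pc - 3) / 2 = pc.
Proof.
  unfold ret_st. replace (4 + 2 * pc - 3) with (1 + pc * 2) by lia.
  now rewrite Nat.div_add.
Qed.

Lemma odd_exec pc : Nat.odd (exec_st pc) = true.
Proof.
  unfold exec_st. rewrite Nat.odd_spec. exists (S pc). lia.
Qed.

Lemma odd_ret pc : Nat.odd (ret_st pc) = false.
Proof.
  unfold ret_st. rewrite <- Nat.negb_even, negb_false_iff, Nat.even_spec.
  exists (2 + pc). lia.
Qed.

Lemma exec_delta_bound P q i s :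
  In i P -> q < exec_st (num_labels P) + 2 -> s < 2 ^ (num_regs P + 2) ->
  match exec_delta (num_regs P) q i s with
  | (q', s', _) => q' < exec_st (num_labels P) + 2 /\ s' < 2 ^ (num_regs P + 2)
  end.
Proof.
  intros Hi Hq Hs.
  pose proof (instr_reg_lt P i Hi) as Hr. pose proof (instr_label_lt P i Hi) as Hl.
  destruct i as [r n | r n | r z nz | b]; cbn [exec_delta instr_reg instr_label] in *;
    unfold exec_st, ret_st in *.
  - destruct (Nat.testbit s r); split; try lia; apply touch_bound;
      [apply clearbit_bound | apply setbit_bound]; lia.
  - destruct (Nat.testbit s r); split; try lia; apply touch_bound;
      [apply clearbit_bound | apply setbit_bound]; lia.
  - destruct (s =? 0); [|destruct (Nat.testbit s r)]; split; lia.
  - destruct b; split; lia.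
Qed.

Lemma cm_TM_wf P : wf_TM (cm_TM P).
Proof.
  unfold wf_TM, cm_TM; cbn [tm_syms tm_states tm_delta tm_start tm_accept tm_reject].
  assert (Hpow : 2 ^ 2 <= 2 ^ (num_regs P + 2)) by (apply Nat.pow_le_mono_r; lia).
  change (2 ^ 2) with 4 in Hpow.
  repeat split; try (unfold exec_st; lia).
  intros q s Hq Hs. unfold cm_delta.
  destruct (Nat.leb_spec q 1); [lia|]. destruct (Nat.eqb_spec q 2).
  - split; [unfold exec_st; lia|]. apply touch_bound, setbit_bound; lia.
  - destruct (Nat.odd q) eqn:Ho.
    + destruct (nth_in_or_default ((q - 3) / 2) P (IHalt false)) as [Hin | ->].
      * now apply exec_delta_bound.
      * cbn [exec_delta]. unfold exec_st. lia.
    + destruct (Nat.testbit s (num_regs P)); [|lia].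
      split; [|lia].
      assert (Hd : q = exec_st ((q - 3) / 2) + 1).
      { assert (He : Nat.even q = true) by (now rewrite <- Nat.negb_odd, Ho).
        apply Nat.even_spec in He. destruct He as [m ->].
        replace (2 * m - 3) with (1 + (m - 2) * 2) by lia.
        rewrite Nat.div_add by lia. change (1 / 2) with 0. unfold exec_st. lia. }
      lia.
Qed.

(** Space is a condition on all times, so the bound covers every intermediate configuration. It is
    [S H] because a zero test may have to read the first blank cell, which can be cell [H + 1]. *)
Definition reach (H : nat) (M : TM) (c c' : config) : Prop :=
  exists t, Nat.iter t (step M) c = c' /\
    forall t', t' <= t -> cf_head (Nat.iter t' (step M) c) <= S H.

Lemma iter_add {A} (f : A -> A) a b (x : A) :
  Nat.iter (a + b) f x = Nat.iter a f (Nat.iter b f x).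
Proof. apply Nat.iter_add. Qed.

Lemma reach_refl H M c : cf_head c <= S H -> reach H M c c.
Proof.
  intros Hh. exists 0. split; [easy|]. intros t' Ht.
  now replace t' with 0 by lia.
Qed.

Lemma reach_trans H M c1 c2 c3 : reach H M c1 c2 -> reach H M c2 c3 -> reach H M c1 c3.
Proof.
  intros (t1 & E1 & H1) (t2 & E2 & H2). exists (t2 + t1). split.
  - now rewrite iter_add, E1.
  - intros t' Ht. destruct (le_lt_dec t' t1); [auto|].
    replace t' with ((t' - t1) + t1) by lia. rewrite iter_add, E1. apply H2. lia.
Qed.

Lemma reach_step H M c c' :
  cf_head c <= S H -> reach H M (step M c) c' -> reach H M c c'.
Proof.
  intros Hh (t & E & Ht). exists (t + 1). split.
  - now rewrite iter_add.
  - intros t' Ht'. destruct t' as [|t']; [easy|].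
    replace (S t') with (t' + 1) by lia. rewrite iter_add. apply Ht. lia.
Qed.

Definition wr (tp : nat -> nat) (h s : nat) : nat -> nat :=
  fun i => if i =? h then s else tp i.

Lemma wr_id tp h : wr tp h (tp h) = tp.
Proof.
  apply functional_extensionality. intros i. unfold wr.
  now destruct (Nat.eqb_spec i h) as [-> |].
Qed.

Lemma cm_step P q h tp :
  2 <= q -> step (cm_TM P) (mkConfig q h tp) =
  match cm_delta P q (tp h) with
  | (q', s', m) => mkConfig q' (move_head h m) (wr tp h s')
  end.
Proof.
  intros Hq. unfold step, cm_TM, cf_state, tm_accept, tm_reject, tm_delta, cf_head, cf_tape.
  destruct (Nat.eqb_spec q 0); [lia|]. destruct (Nat.eqb_spec q 1); [lia|]. reflexivity.
Qed.

Lemma cm_delta_exec P pc i s :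
  nth_error P pc = Some i ->
  cm_delta P (exec_st pc) s = exec_delta (num_regs P) (exec_st pc) i s.
Proof.
  intros Hi. unfold cm_delta. rewrite odd_exec, exec_pc.
  rewrite (nth_error_nth P pc (IHalt false) Hi).
  destruct (Nat.leb_spec (exec_st pc) 1); [unfold exec_st in *; lia|].
  destruct (Nat.eqb_spec (exec_st pc) 2); [unfold exec_st in *; lia|]. reflexivity.
Qed.

Lemma cm_delta_ret P pc s :
  cm_delta P (ret_st pc) s =
  if Nat.testbit s (num_regs P) then (exec_st pc, s, MStay) else (ret_st pc, s, MLeft).
Proof.
  unfold cm_delta. rewrite odd_ret, ret_pc.
  destruct (Nat.leb_spec (ret_st pc) 1); [unfold ret_st in *; lia|].
  destruct (Nat.eqb_spec (ret_st pc) 2); [unfold ret_st in *; lia|]. reflexivity.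
Qed.

(* [tape_ok] allows cell [H] to be nonblank because cell 0 is marked even when [H = 0]. *)
Record tape_ok (R H : nat) (bits : nat -> nat -> bool) (tp : nat -> nat) : Prop := {
  tape_bits : forall r i, r < R -> Nat.testbit (tp i) r = bits r i;
  tape_mark : forall i, Nat.testbit (tp i) R = (i =? 0);
  tape_prefix : forall i j, tp i = 0 -> i <= j -> tp j = 0;
  tape_blank : forall i, H < i -> tp i = 0 }.

Definition upd_bit (bits : nat -> nat -> bool) (r h : nat) (b : bool) : nat -> nat -> bool :=
  fun r' i => if (r' =? r) && (i =? h) then b else bits r' i.

(** Writing may turn a blank cell nonblank; the written cells remain a prefix because everything to
    the left of [h] is already nonblank. *)
Lemma tape_write R H bits tp r h b s :
  tape_ok R H bits tp -> r < R -> h <= H -> (forall i, i < h -> tp i <> 0) ->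
  s = (if b : bool then Nat.setbit (tp h) r else Nat.clearbit (tp h) r) ->
  tape_ok R H (upd_bit bits r h b) (wr tp h (touch R s)).
Proof.
  intros [Hb Hm Hp Hl] Hr Hh Hnz ->. split.
  - intros r' i Hr'. unfold upd_bit, wr. destruct (Nat.eqb_spec i h) as [-> |].
    + rewrite testbit_touch by lia. rewrite andb_true_r.
      destruct (Nat.eqb_spec r' r) as [-> |].
      * destruct b; [apply Nat.setbit_eq | apply Nat.clearbit_eq].
      * rewrite <- Hb by easy. destruct b; [apply Nat.setbit_neq | apply Nat.clearbit_neq]; lia.
    + rewrite andb_false_r. auto.
  - intros i. unfold wr. destruct (Nat.eqb_spec i h) as [-> |]; [|auto].
    rewrite testbit_touch by lia. rewrite <- Hm.
    destruct b; [apply Nat.setbit_neq | apply Nat.clearbit_neq]; lia.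
  - intros i j. unfold wr. destruct (Nat.eqb_spec i h) as [-> |].
    + intros E. now apply touch_nonzero in E.
    + intros E Hij. destruct (Nat.eqb_spec j h) as [-> |]; [|eauto].
      exfalso. apply (Hnz i); [lia | easy].
  - intros i Hi. unfold wr. destruct (Nat.eqb_spec i h); [lia | auto].
Qed.

(** A left move at cell 0 has no effect, so only the mark track reveals that the head has
    arrived. *)
Lemma reach_return P H bits tp q h :
  tape_ok (num_regs P) H bits tp -> h <= S H ->
  reach H (cm_TM P) (mkConfig (ret_st q) h tp) (mkConfig (exec_st q) 0 tp).
Proof.
  intros Ht. induction h as [|h IH]; intros Hh; apply reach_step; try easy;
    rewrite cm_step by (unfold ret_st; lia); rewrite cm_delta_ret, (tape_mark _ _ _ _ Ht);
    cbn [Nat.eqb move_head pred]; rewrite wr_id.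
  - apply reach_refl. cbn. lia.
  - apply IH. lia.
Qed.

Lemma nonblank_of_bit R H bits tp r i :
  tape_ok R H bits tp -> r < R -> bits r i = true -> tp i <> 0.
Proof.
  intros Ht Hr Hb E. rewrite <- (tape_bits _ _ _ _ Ht) in Hb by easy.
  rewrite E, Nat.bits_0 in Hb. discriminate.
Qed.

(* [flip c] is the common pattern of increment ([c = true]: carry through ones)
   and decrement ([c = false]: borrow through zeros). *)
Definition flip_upto (c : bool) (bits : nat -> nat -> bool) (r p e : nat)
  : nat -> nat -> bool :=
  fun r' i => if (r' =? r) && (p <=? i) && (i <=? e) then (if i =? e then c else negb c)
              else bits r' i.

Definition flip_instr (c : bool) (r n : nat) := if c then IInc r n else IDec r n.

Lemma tape_ok_ext R H b1 b2 tp :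
  (forall r i, b1 r i = b2 r i) -> tape_ok R H b1 tp -> tape_ok R H b2 tp.
Proof. intros E [Hb Hm Hp Hl]. split; auto. intros. rewrite <- E. auto. Qed.

(** Induction on the distance from the head [p] to the cell [e] where the sweep stops. A borrow ends
    at a one, hence on a written cell; a carry may end on the first blank, but then passes only over
    ones, so all cells before [e] are written. The disjunction on [tp e] separates these cases. *)
Lemma reach_flip P H c pc r n e :
  nth_error P pc = Some (flip_instr c r n) -> e <= H ->
  forall d p bits tp, e = p + d ->
  tape_ok (num_regs P) H bits tp -> tp e <> 0 \/ (c = true /\ (forall i, i < e -> tp i <> 0)) ->
  (forall i, p <= i -> i < e -> bits r i = c) -> bits r e = negb c ->
  exists tp', tape_ok (num_regs P) H (flip_upto c bits r p e) tp' /\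
    reach H (cm_TM P) (mkConfig (exec_st pc) p tp) (mkConfig (ret_st n) e tp').
Proof.
  intros Hi He. pose proof (instr_reg_lt P _ (nth_error_In _ _ Hi)) as Hr.
  assert (Hr' : r < num_regs P) by (now destruct c).
  induction d as [|d IH]; intros p bits tp Hd Ht Hnb Hlow Hbe.
  - assert (e = p) as -> by lia.
    assert (Hnz : forall i, i < p -> tp i <> 0).
    { intros i Hip E. destruct Hnb as [Hnb | [_ Hnb]]; [|now apply (Hnb i)].
      apply Hnb. apply (tape_prefix _ _ _ _ Ht i); [easy | lia]. }
    exists (wr tp p (touch (num_regs P)
              (if c then Nat.setbit (tp p) r else Nat.clearbit (tp p) r))). split.
    + apply (tape_ok_ext _ _ (upd_bit bits r p c)); [|apply (tape_write _ _ bits tp); auto].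
      intros r' i. unfold upd_bit, flip_upto.
      destruct (Nat.eqb_spec r' r), (Nat.eqb_spec i p), (Nat.leb_spec p i), (Nat.leb_spec i p);
        cbn; try lia; reflexivity.
    + apply reach_step; [cbn; lia|]. rewrite cm_step by (unfold exec_st; lia).
      rewrite (cm_delta_exec _ _ _ _ Hi).
      pose proof (tape_bits _ _ _ _ Ht r p Hr') as Eb. rewrite Hbe in Eb.
      destruct c; cbn [flip_instr exec_delta negb] in *; rewrite Eb; apply reach_refl; cbn; lia.
  - assert (Hnz : forall i, i < e -> tp i <> 0).
    { intros i Hip E. destruct Hnb as [Hnb | [_ Hnb]]; [|now apply (Hnb i)].
      apply Hnb. apply (tape_prefix _ _ _ _ Ht i); [easy | lia]. }
    set (tp1 := wr tp p (touch (num_regs P)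
              (if negb c then Nat.setbit (tp p) r else Nat.clearbit (tp p) r))).
    assert (Ht1 : tape_ok (num_regs P) H (upd_bit bits r p (negb c)) tp1).
    { eapply tape_write; eauto; [lia|]. intros; apply Hnz; lia. }
    destruct (IH (S p) (upd_bit bits r p (negb c)) tp1) as (tp' & Ht' & Hreach); auto.
    + lia.
    + assert (forall i, i < e -> tp1 i <> 0).
      { intros i Hi'. unfold tp1, wr. destruct (i =? p); [apply touch_nonzero | auto]. }
      destruct Hnb as [Hnb | [? _]]; [left | right; auto].
      unfold tp1, wr. destruct (e =? p); [apply touch_nonzero | easy].
    + intros i Hi1 Hi2. unfold upd_bit. destruct (Nat.eqb_spec i p); [lia|].
      rewrite andb_false_r. apply Hlow; lia.
    + unfold upd_bit. destruct (Nat.eqb_spec e p); [lia|]. now rewrite andb_false_r.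
    + exists tp'. split.
      * refine (tape_ok_ext _ _ _ _ _ _ Ht').
        intros r' i. unfold upd_bit, flip_upto.
        destruct (Nat.eqb_spec r' r), (Nat.eqb_spec i p), (Nat.leb_spec p i),
          (Nat.leb_spec (S p) i), (Nat.leb_spec i e), (Nat.eqb_spec i e);
          cbn; try lia; reflexivity.
      * apply reach_step; [cbn; lia|]. rewrite cm_step by (unfold exec_st; lia).
        rewrite (cm_delta_exec _ _ _ _ Hi).
        pose proof (tape_bits _ _ _ _ Ht r p Hr') as Eb.
        rewrite (Hlow p) in Eb by lia.
        destruct c; cbn [flip_instr exec_delta negb] in *; rewrite Eb; exact Hreach.
Qed.

Lemma testbit_first_zero x : exists e, Nat.testbit x e = false /\
  forall i, i < e -> Nat.testbit x i = true.
Proof.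
  induction x as [x IH] using lt_wf_ind.
  destruct (Nat.Even_or_Odd x) as [[y ->] | [y ->]].
  - exists 0. split; [apply Nat.testbit_even_0 | lia].
  - destruct (IH y) as (e & He & Hl); [lia|]. exists (S e). split.
    + now rewrite Nat.testbit_odd_succ by lia.
    + intros [|i] Hi; [apply Nat.testbit_odd_0|].
      rewrite Nat.testbit_odd_succ by lia. apply Hl. lia.
Qed.

Lemma testbit_succ_carry e : forall x i,
  Nat.testbit x e = false -> (forall i, i < e -> Nat.testbit x i = true) ->
  Nat.testbit (S x) i = if i <=? e then i =? e else Nat.testbit x i.
Proof.
  induction e as [|e IH]; intros x i He Hl; destruct (Nat.Even_or_Odd x) as [[y ->] | [y ->]].
  - replace (S (2 * y)) with (2 * y + 1) by lia. destruct i.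
    + apply Nat.testbit_odd_0.
    + rewrite Nat.testbit_odd_succ, Nat.testbit_even_succ by lia. reflexivity.
  - rewrite Nat.testbit_odd_0 in He. discriminate.
  - specialize (Hl 0 ltac:(lia)). rewrite Nat.testbit_even_0 in Hl. discriminate.
  - replace (S (2 * y + 1)) with (2 * (S y)) by lia. destruct i.
    + rewrite Nat.testbit_even_0. reflexivity.
    + rewrite Nat.testbit_odd_succ, Nat.testbit_even_succ by lia.
      rewrite Nat.testbit_odd_succ in He by lia.
      rewrite IH; [reflexivity | easy |]. intros j Hj.
      specialize (Hl (S j) ltac:(lia)). rewrite Nat.testbit_odd_succ in Hl by lia. easy.
Qed.

Definition bits_of (s : state) : nat -> nat -> bool := fun r i => Nat.testbit (s r) i.

Lemma flip_inc s r e :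
  Nat.testbit (s r) e = false -> (forall i, i < e -> Nat.testbit (s r) i = true) ->
  forall r' i, flip_upto true (bits_of s) r 0 e r' i = bits_of (upd s r (S (s r))) r' i.
Proof.
  intros He Hl r' i. unfold flip_upto, bits_of, upd. cbn [Nat.leb]. rewrite andb_true_r.
  destruct (Nat.eqb_spec r' r) as [-> |]; cbn; [|reflexivity].
  rewrite (testbit_succ_carry e) by easy. destruct (i <=? e), (i =? e); reflexivity.
Qed.

(** The lowest one of [S x] is the lowest zero of [x], so a borrow is a carry read backwards and one
    description of binary increment serves both. *)
Lemma flip_dec s r x e :
  s r = S x ->
  Nat.testbit x e = false -> (forall i, i < e -> Nat.testbit x i = true) ->
  forall r' i, flip_upto false (bits_of s) r 0 e r' i = bits_of (upd s r x) r' i.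
Proof.
  intros Hs He Hl r' i. unfold flip_upto, bits_of, upd. cbn [Nat.leb]. rewrite andb_true_r.
  destruct (Nat.eqb_spec r' r) as [-> |]; cbn; [|reflexivity].
  rewrite Hs, (testbit_succ_carry e) by easy.
  destruct (Nat.leb_spec i e); [|reflexivity].
  destruct (Nat.eqb_spec i e) as [-> |]; [now rewrite He | rewrite Hl by lia; reflexivity].
Qed.

Lemma zero_of_bits x : (forall i, Nat.testbit x i = false) -> x = 0.
Proof. intros E. apply Nat.bits_inj. intros i. now rewrite E, Nat.bits_0. Qed.

(** The scan maintains that all bits of [r] to the left of the head are zero. A blank settles the
    test, since every later cell is blank too. *)
Lemma reach_test P H pc s r z nz tp :
  nth_error P pc = Some (ITest r z nz) -> tape_ok (num_regs P) H (bits_of s) tp ->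
  forall d p, p + d = S H -> (forall i, i < p -> Nat.testbit (s r) i = false) ->
  exists h, h <= S H /\ reach H (cm_TM P) (mkConfig (exec_st pc) p tp)
    (mkConfig (ret_st (if s r =? 0 then z else nz)) h tp).
Proof.
  intros Hi Ht. pose proof (instr_reg_lt P _ (nth_error_In _ _ Hi)) as Hr. cbn in Hr.
  assert (Hzero : forall p, tp p = 0 -> (forall i, i < p -> Nat.testbit (s r) i = false) ->
                  s r = 0).
  { intros p Hp Hl. apply zero_of_bits. intros i.
    destruct (le_lt_dec p i); [|auto].
    rewrite <- (tape_bits _ _ _ _ Ht r i Hr : _ = Nat.testbit (s r) i).
    rewrite (tape_prefix _ _ _ _ Ht p i) by easy. apply Nat.bits_0. }
  induction d as [|d IH]; intros p Hd Hl.
  - assert (Hp : tp p = 0) by (apply (tape_blank _ _ _ _ Ht); lia).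
    exists p. split; [lia|]. apply reach_step; [cbn; lia|].
    rewrite cm_step by (unfold exec_st; lia). rewrite (cm_delta_exec _ _ _ _ Hi).
    cbn [exec_delta]. rewrite (Hzero p Hp Hl), Hp. cbn [Nat.eqb move_head].
    rewrite <- Hp at 1. rewrite wr_id. apply reach_refl. cbn. lia.
  - destruct (Nat.eq_dec (tp p) 0) as [Hp | Hp].
    + exists p. split; [lia|]. apply reach_step; [cbn; lia|].
      rewrite cm_step by (unfold exec_st; lia). rewrite (cm_delta_exec _ _ _ _ Hi).
      cbn [exec_delta]. rewrite (Hzero p Hp Hl), Hp. cbn [Nat.eqb move_head].
      rewrite <- Hp at 1. rewrite wr_id. apply reach_refl. cbn. lia.
    + destruct (Nat.testbit (s r) p) eqn:Eb.
      * exists p. split; [lia|]. apply reach_step; [cbn; lia|].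
        rewrite cm_step by (unfold exec_st; lia). rewrite (cm_delta_exec _ _ _ _ Hi).
        cbn [exec_delta]. apply Nat.eqb_neq in Hp as ->.
        rewrite (tape_bits _ _ _ _ Ht r p Hr : _ = Nat.testbit (s r) p), Eb.
        destruct (Nat.eqb_spec (s r) 0) as [E0 |].
        { rewrite E0, Nat.bits_0 in Eb. discriminate. }
        cbn [move_head]. rewrite wr_id. apply reach_refl. cbn. lia.
      * destruct (IH (S p)) as (h & Hh & Hreach); [lia | |].
        { intros i Hip. destruct (Nat.eq_dec i p) as [-> |]; [easy | apply Hl; lia]. }
        exists h. split; [easy|]. apply reach_step; [cbn; lia|].
        rewrite cm_step by (unfold exec_st; lia). rewrite (cm_delta_exec _ _ _ _ Hi).
        cbn [exec_delta]. apply Nat.eqb_neq in Hp as ->.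
        rewrite (tape_bits _ _ _ _ Ht r p Hr : _ = Nat.testbit (s r) p), Eb.
        cbn [move_head]. rewrite wr_id. exact Hreach.
Qed.

Lemma reach_flat_step P H pc s pc' s' tp :
  flat_step H P (pc, s) (pc', s') -> tape_ok (num_regs P) H (bits_of s) tp ->
  exists tp', tape_ok (num_regs P) H (bits_of s') tp' /\
    reach H (cm_TM P) (mkConfig (exec_st pc) 0 tp) (mkConfig (exec_st pc') 0 tp').
Proof.
  intros Hstep Ht. inversion Hstep as [? ? r n Hi Hb | ? ? r n Hi Hb | ? ? r z nz Hi]; subst;
  pose proof (instr_reg_lt P _ (nth_error_In _ _ Hi)) as Hr; cbn in Hr.
  - destruct (testbit_first_zero (s r)) as (e & He & Hl).
    (* Bit [e] is set in the incremented value, which is below [2 ^ H]. *)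
    assert (HeH : e < H).
    { apply Nat.nle_gt. intros C. pose proof (bound_testbit _ _ e Hb C) as E.
      rewrite (testbit_succ_carry e), Nat.leb_refl, Nat.eqb_refl in E by easy. discriminate. }
    destruct (reach_flip P H true pc r pc' e Hi ltac:(lia) e 0 (bits_of s) tp)
      as (tp' & Ht' & Hr'); auto.
    { right. split; [easy|]. intros i Hie.
      apply (nonblank_of_bit _ _ _ _ r i Ht); [easy | now apply Hl]. }
    { intros. now apply Hl. }
    assert (Ht2 : tape_ok (num_regs P) H (bits_of (upd s r (S (s r)))) tp')
      by (eapply tape_ok_ext; [apply (flip_inc s r e He Hl) | easy]).
    exists tp'. split; [easy|]. eapply reach_trans; [exact Hr'|].
    eapply reach_return; [exact Ht2 | lia].
  - destruct (s r) as [|x] eqn:Es; [easy|]. cbn [pred] in *.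
    destruct (testbit_first_zero x) as (e & He & Hl).
    assert (Hse : Nat.testbit (s r) e = true)
      by (rewrite Es, (testbit_succ_carry e), Nat.leb_refl, Nat.eqb_refl by easy; easy).
    assert (Hnz : tp e <> 0) by (apply (nonblank_of_bit _ _ _ _ r e Ht); easy).
    assert (HeH : e <= H).
    { apply Nat.nlt_ge. intros C. apply Hnz. now apply (tape_blank _ _ _ _ Ht). }
    destruct (reach_flip P H false pc r pc' e Hi HeH e 0 (bits_of s) tp)
      as (tp' & Ht' & Hr'); auto.
    { intros i _ Hie. unfold bits_of. rewrite Es, (testbit_succ_carry e) by easy.
      destruct (Nat.leb_spec i e), (Nat.eqb_spec i e); easy || lia. }
    assert (Ht2 : tape_ok (num_regs P) H (bits_of (upd s r x)) tp')
      by (eapply tape_ok_ext; [apply (flip_dec s r x e Es He Hl) | easy]).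
    exists tp'. split; [easy|]. eapply reach_trans; [exact Hr'|].
    eapply reach_return; [exact Ht2 | lia].
  - destruct (reach_test P H pc s' r z nz tp Hi Ht (S H) 0 ltac:(lia) ltac:(lia))
      as (h & Hh & Hr').
    exists tp. split; [easy|]. eapply reach_trans; [exact Hr'|].
    eapply reach_return; [exact Ht | lia].
Qed.

Lemma reach_flat_reach P H c c' :
  flat_reach H P c c' -> forall tp, tape_ok (num_regs P) H (bits_of (snd c)) tp ->
  exists tp', tape_ok (num_regs P) H (bits_of (snd c')) tp' /\
    reach H (cm_TM P) (mkConfig (exec_st (fst c)) 0 tp) (mkConfig (exec_st (fst c')) 0 tp').
Proof.
  induction 1 as [c | [pc1 s1] [pc2 s2] c3 Hs Hr IH]; intros tp Ht.
  - exists tp. split; [easy|]. apply reach_refl. cbn. lia.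
  - destruct (reach_flat_step _ _ _ _ _ _ _ Hs Ht) as (tp2 & Ht2 & R2).
    destruct (IH tp2 Ht2) as (tp3 & Ht3 & R3).
    exists tp3. split; [easy|]. eapply reach_trans; [exact R2 | exact R3].
Qed.

(* Input bit [false] is the symbol 1 and [true] the symbol 2, so the input
   appears on the tracks of registers 0 and 1. *)
Fixpoint bits_val (b : bool) (x : list bool) : nat :=
  match x with
  | [] => 0
  | d :: x' => Nat.b2n (Bool.eqb d b) + 2 * bits_val b x'
  end.

Definition init_state (x : list bool) : state :=
  fun r => if r =? 0 then bits_val false x else if r =? 1 then bits_val true x else 0.

Lemma testbit_bits_val b x i :
  Nat.testbit (bits_val b x) i = (i <? length x) && Bool.eqb (nth i x false) b.
Proof.
  revert i. induction x as [|d x IH]; intros i.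
  - cbn [bits_val length]. rewrite Nat.bits_0. now destruct i.
  - cbn [bits_val length]. rewrite Nat.add_comm.
    destruct i as [|i].
    + rewrite Nat.testbit_0_r. cbn. now destruct (Bool.eqb d b).
    + rewrite Nat.testbit_succ_r, IH. reflexivity.
Qed.

(** The input symbols are already bit fields of registers 0 and 1, so loading needs no copying; the
    only step marks cell 0, which also makes it nonblank when the input is empty. *)
Lemma init_tape P H x :
  length x <= H ->
  exists tp, tape_ok (num_regs P) H (bits_of (init_state x)) tp /\
    reach H (cm_TM P) (init_config (cm_TM P) x) (mkConfig (exec_st 0) 0 tp).
Proof.
  intros HH.
  set (tp0 := cf_tape (init_config (cm_TM P) x)). set (R := num_regs P).
  assert (HR : 2 <= R) by (unfold R, num_regs; lia).
  assert (T0 : forall i, tp0 i = if i <? length x then if nth i x false then 2 else 1 else 0)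
    by reflexivity.
  assert (B0 : forall r i, r < R -> Nat.testbit (tp0 i) r = bits_of (init_state x) r i).
  { intros r i Hr. rewrite T0. unfold bits_of, init_state.
    destruct r as [|[|r]]; cbn [Nat.eqb];
      rewrite ?testbit_bits_val; destruct (i <? length x);
      try (now destruct (nth i x false)); cbn [andb]; rewrite ?Nat.bits_0; auto.
    destruct (nth i x false); [apply (bound_testbit 2 2) | apply (bound_testbit 1 1)];
      cbn; lia. }
  assert (M0 : forall i, Nat.testbit (tp0 i) R = false).
  { intros i. rewrite T0. destruct (i <? length x); [|apply Nat.bits_0].
    destruct (nth i x false); apply (bound_testbit _ 2); cbn; lia. }
  assert (N0 : forall i, i < length x -> tp0 i <> 0).
  { intros i Hi. rewrite T0. apply Nat.ltb_lt in Hi as ->. now destruct (nth i x false). }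
  assert (Z0 : forall i, length x <= i -> tp0 i = 0).
  { intros i Hi. rewrite T0. apply Nat.ltb_ge in Hi as ->. reflexivity. }
  exists (wr tp0 0 (touch R (Nat.setbit (tp0 0) R))). split.
  - split.
    + intros r i Hr. unfold wr. destruct (Nat.eqb_spec i 0) as [-> |]; [|auto].
      rewrite testbit_touch, Nat.setbit_neq by lia. auto.
    + intros i. unfold wr. destruct (Nat.eqb_spec i 0) as [-> |]; [|auto].
      rewrite testbit_touch by lia. apply Nat.setbit_eq.
    + intros i j. unfold wr. destruct (Nat.eqb_spec i 0) as [-> | Hi].
      * intros E. now apply touch_nonzero in E.
      * intros E Hij. destruct (Nat.eqb_spec j 0); [lia|].
        destruct (le_lt_dec (length x) i); [apply Z0; lia | now apply N0 in E].
    + intros i Hi. unfold wr. destruct (Nat.eqb_spec i 0); [lia | apply Z0; lia].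
  - apply reach_step; [cbn; lia|].
    change (init_config (cm_TM P) x) with (mkConfig 2 0 tp0).
    rewrite cm_step by lia. cbn [cm_delta Nat.leb Nat.eqb]. apply reach_refl. cbn. lia.
Qed.

Lemma iter_halted M c t : halted M c -> Nat.iter t (step M) c = c.
Proof.
  intros Hh. induction t as [|t IH]; [easy|].
  change (Nat.iter (S t) (step M) c) with (step M (Nat.iter t (step M) c)). rewrite IH. unfold step.
  destruct Hh as [-> | ->]; rewrite Nat.eqb_refl, ?orb_true_r; reflexivity.
Qed.

(** A halted configuration is a fixed point of [step], so the head bound along the finite run
    extends to all times. *)
Theorem cm_decides P H x pc s b :
  length x <= H -> flat_reach H P (0, init_state x) (pc, s) ->
  nth_error P pc = Some (IHalt b) ->
  (exists t, halted (cm_TM P) (run (cm_TM P) x t) /\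
     (cf_state (run (cm_TM P) x t) = tm_accept (cm_TM P) <-> b = true)) /\
  forall t, cf_head (run (cm_TM P) x t) <= S H.
Proof.
  intros HH Hr Hi. destruct (init_tape P H x HH) as (tp0 & Ht0 & R0).
  destruct (reach_flat_reach _ _ _ _ Hr tp0 Ht0) as (tp1 & Ht1 & R1). cbn [fst snd] in *.
  assert (R2 : reach H (cm_TM P) (mkConfig (exec_st pc) 0 tp1)
                 (mkConfig (if b then 0 else 1) 0 tp1)).
  { apply reach_step; [cbn; lia|]. rewrite cm_step by (unfold exec_st; lia).
    rewrite (cm_delta_exec _ _ _ _ Hi). cbn [exec_delta move_head]. rewrite wr_id.
    apply reach_refl. cbn. lia. }
  destruct (reach_trans _ _ _ _ _ (reach_trans _ _ _ _ _ R0 R1) R2) as (t & Et & Hbound).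
  assert (Hh : halted (cm_TM P) (run (cm_TM P) x t)).
  { unfold run. rewrite Et. unfold halted. cbn. destruct b; auto. }
  split.
  - exists t. split; [easy|]. unfold run. rewrite Et. cbn. now destruct b.
  - intros t'. destruct (le_lt_dec t' t); [now apply Hbound|].
    replace t' with ((t' - t) + t) by lia. unfold run. rewrite iter_add.
    rewrite iter_halted by easy. now apply Hbound.
Qed.

(** * A bounded while language *)

Inductive cprog :=
| CSkip
| CInc (r : nat)
| CDec (r : nat)
| CSeq (c1 c2 : cprog)
| CIf (r : nat) (c1 c2 : cprog)
| CWhile (r : nat) (c : cprog).

Inductive cexec (B : nat) : cprog -> state -> state -> Prop :=
| CE_skip s : cexec B CSkip s s
| CE_inc s r : s r < B -> cexec B (CInc r) s (upd s r (S (s r)))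
| CE_dec s r : cexec B (CDec r) s (upd s r (pred (s r)))
| CE_seq c1 c2 s1 s2 s3 : cexec B c1 s1 s2 -> cexec B c2 s2 s3 -> cexec B (CSeq c1 c2) s1 s3
| CE_if r c1 c2 s s' : cexec B (if s r =? 0 then c2 else c1) s s' ->
    cexec B (CIf r c1 c2) s s'
| CE_while_end r c s : s r = 0 -> cexec B (CWhile r c) s s
| CE_while r c s1 s2 s3 : s1 r <> 0 -> cexec B c s1 s2 -> cexec B (CWhile r c) s2 s3 ->
    cexec B (CWhile r c) s1 s3.

Fixpoint csize (c : cprog) : nat :=
  match c with
  | CSkip | CInc _ => 1
  | CDec _ => 2
  | CSeq c1 c2 => csize c1 + csize c2
  | CIf _ c1 c2 => S (csize c1 + csize c2)
  | CWhile _ c => S (csize c)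
  end.

(* Code for [c] placed at address [l] and continuing at address [k]. *)
Fixpoint flatten (c : cprog) (l k : nat) : list instr :=
  match c with
  (* A test with equal targets serves as an unconditional jump. *)
  | CSkip => [ITest 0 k k]
  | CInc r => [IInc r k]
  | CDec r => [ITest r k (S l); IDec r k]
  | CSeq c1 c2 => flatten c1 l (l + csize c1) ++ flatten c2 (l + csize c1) k
  | CIf r c1 c2 =>
      ITest r (S l + csize c1) (S l) :: flatten c1 (S l) k ++ flatten c2 (S l + csize c1) k
  | CWhile r c => ITest r k (S l) :: flatten c (S l) l
  end.

Lemma flatten_length c : forall l k, length (flatten c l k) = csize c.
Proof.
  induction c; intros l k; cbn; rewrite ?length_app; auto.
Qed.

Definition code_at (P : list instr) (l : nat) (code : list instr) : Prop :=
  forall i x, nth_error code i = Some x -> nth_error P (l + i) = Some x.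

Lemma code_at_app P l c1 c2 :
  code_at P l (c1 ++ c2) -> code_at P l c1 /\ code_at P (l + length c1) c2.
Proof.
  intros H. split; intros i x Hx.
  - apply H. rewrite nth_error_app1; [easy|]. apply nth_error_Some. congruence.
  - rewrite <- Nat.add_assoc. apply H. rewrite nth_error_app2 by lia.
    now replace (length c1 + i - length c1) with i by lia.
Qed.

Lemma code_at_cons P l x c :
  code_at P l (x :: c) -> nth_error P l = Some x /\ code_at P (S l) c.
Proof.
  intros H. split.
  - specialize (H 0 x eq_refl). now rewrite Nat.add_0_r in H.
  - intros i y Hy. specialize (H (S i) y Hy). now rewrite Nat.add_succ_r in H.
Qed.

Lemma flatten_correct H P c s s' B :
  B < 2 ^ H -> cexec B c s s' -> forall l k, code_at P l (flatten c l k) ->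
  flat_reach H P (l, s) (k, s').
Proof.
  intros HB. induction 1 as [s | s r Hs | s r | c1 c2 s1 s2 s3 _ IH1 _ IH2
    | r c1 c2 s s' _ IH | r c s Hs | r c s1 s2 s3 Hs _ IH1 _ IH2];
    intros l k Hc; cbn [flatten] in Hc.
  - apply code_at_cons in Hc as [Hc _].
    apply flat_reach_one. pose proof (FS_test H P l s 0 k k Hc) as E.
    now destruct (s 0 =? 0).
  - apply code_at_cons in Hc as [Hc _].
    apply flat_reach_one. apply (FS_inc H P l s r k Hc). lia.
  - apply code_at_cons in Hc as [Hc1 Hc2]. apply code_at_cons in Hc2 as [Hc2 _].
    eapply FR_step; [apply (FS_test H P l s r _ _ Hc1)|].
    destruct (Nat.eqb_spec (s r) 0) as [E |].
    + rewrite E. cbn [pred]. replace (upd s r 0) with s; [apply FR_refl|].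
      apply functional_extensionality. intros i. unfold upd.
      now destruct (Nat.eqb_spec i r) as [-> |].
    + apply flat_reach_one. now apply FS_dec.
  - apply code_at_app in Hc as [Hc1 Hc2]. rewrite flatten_length in Hc2.
    eapply flat_reach_trans; [apply IH1; exact Hc1 | apply IH2; exact Hc2].
  - apply code_at_cons in Hc as [Hc1 Hc2]. apply code_at_app in Hc2 as [Hc2 Hc3].
    rewrite flatten_length in Hc3.
    eapply FR_step; [apply (FS_test H P l s r _ _ Hc1)|].
    destruct (s r =? 0); apply IH; [exact Hc3 | exact Hc2].
  - apply code_at_cons in Hc as [Hc _]. apply flat_reach_one.
    pose proof (FS_test H P l s r _ _ Hc) as E. now rewrite Hs in E.
  - pose proof Hc as Hc0. apply code_at_cons in Hc as [Hc1 Hc2].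
    eapply FR_step; [apply (FS_test H P l s1 r _ _ Hc1)|].
    destruct (Nat.eqb_spec (s1 r) 0); [easy|].
    eapply flat_reach_trans; [apply IH1; exact Hc2 | apply IH2; exact Hc0].
Qed.

(** Existence of a terminating bounded execution: proving it establishes termination, absence of
    overflow and the postcondition together. *)
Definition cwp (B : nat) (c : cprog) (Q : state -> Prop) (s : state) : Prop :=
  exists s', cexec B c s s' /\ Q s'.

Lemma cwp_conseq B c (Q Q' : state -> Prop) s :
  cwp B c Q s -> (forall s', Q s' -> Q' s') -> cwp B c Q' s.
Proof. intros (s' & He & Hq) H. exists s'. auto. Qed.

Lemma cwp_inc B r (Q : state -> Prop) s :
  s r < B -> Q (upd s r (S (s r))) -> cwp B (CInc r) Q s.
Proof. intros. eexists. split; [now constructor | easy]. Qed.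

Lemma cwp_dec B r (Q : state -> Prop) s :
  Q (upd s r (pred (s r))) -> cwp B (CDec r) Q s.
Proof. intros. eexists. split; [now constructor | easy]. Qed.

Lemma cwp_seq B c1 c2 Q s : cwp B c1 (cwp B c2 Q) s -> cwp B (CSeq c1 c2) Q s.
Proof.
  intros (s1 & H1 & s2 & H2 & HQ). exists s2. split; [econstructor; eauto | easy].
Qed.

Lemma cwp_if B r c1 c2 Q s :
  (s r <> 0 -> cwp B c1 Q s) -> (s r = 0 -> cwp B c2 Q s) -> cwp B (CIf r c1 c2) Q s.
Proof.
  intros H1 H2. destruct (Nat.eq_dec (s r) 0) as [E | E].
  - destruct (H2 E) as (s' & He & HQ). exists s'. split; [|easy].
    constructor. now rewrite E.
  - destruct (H1 E) as (s' & He & HQ). exists s'. split; [|easy].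
    constructor. now apply Nat.eqb_neq in E as ->.
Qed.

Lemma cwp_while B r c (I : state -> Prop) (mu : state -> nat) (Q : state -> Prop) s :
  I s ->
  (forall s, I s -> s r <> 0 -> cwp B c (fun s' => I s' /\ mu s' < mu s) s) ->
  (forall s, I s -> s r = 0 -> Q s) ->
  cwp B (CWhile r c) Q s.
Proof.
  intros HI Hb HQ. remember (mu s) as m eqn:Em. revert s HI Em.
  induction m as [m IH] using lt_wf_ind. intros s HI ->.
  destruct (Nat.eq_dec (s r) 0) as [E | E].
  - exists s. split; [now constructor | auto].
  - destruct (Hb s HI E) as (s1 & He1 & HI1 & Hmu).
    destruct (IH (mu s1) Hmu s1 HI1 eq_refl) as (s2 & He2 & HQ2).
    exists s2. split; [econstructor; eauto | easy].
Qed.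

Ltac updcase :=
  unfold upd in *;
  repeat match goal with
         | |- context [?a =? ?b] => destruct (Nat.eqb_spec a b); subst; try lia
         end.

Ltac state_eq := apply functional_extensionality; intros ?i; updcase; try easy; try lia.

Definition czero x := CWhile x (CDec x).
Definition cmove x y := CWhile x (CSeq (CDec x) (CInc y)).
(** A counter is read only by destroying it, so adding [x] to [y] while keeping [x] needs a scratch
    counter from which [x] is restored. *)
Definition caddcopy x y z :=
  CSeq (czero z) (CSeq (CWhile x (CSeq (CDec x) (CSeq (CInc y) (CInc z)))) (cmove z x)).

Lemma cwp_zero B x (Q : state -> Prop) s : Q (upd s x 0) -> cwp B (czero x) Q s.
Proof.
  intros HQ. apply (cwp_while _ _ _ (fun s1 => upd s1 x 0 = upd s x 0) (fun s1 => s1 x)); auto.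
  - intros s1 E Hx. apply cwp_dec. split.
    + rewrite <- E. state_eq.
    + rewrite upd_same. lia.
  - intros s1 E Hx. replace s1 with (upd s x 0); [easy|]. rewrite <- E. state_eq.
Qed.

Lemma cwp_move B x y (Q : state -> Prop) s :
  x <> y -> s y + s x <= B -> Q (upd (upd s y (s y + s x)) x 0) -> cwp B (cmove x y) Q s.
Proof.
  intros Hxy HB HQ.
  (* The invariant says that the net effect of the loop, applied to the current state, still yields
     the final state intended for [s]. *)
  apply (cwp_while _ _ _ (fun s1 => upd (upd s1 y (s1 y + s1 x)) x 0 =
                                    upd (upd s y (s y + s x)) x 0
                                    /\ s1 y + s1 x = s y + s x) (fun s1 => s1 x)); auto.
  - intros s1 [E1 E2] Hx. apply cwp_seq, cwp_dec, cwp_inc.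
    + rewrite upd_other by auto. lia.
    + rewrite !upd_same, upd_other, upd_other, upd_same by auto. repeat split; try lia.
      rewrite <- E1. state_eq.
  - intros s1 [E1 E2] Hx. rewrite <- E1 in HQ.
    replace s1 with (upd (upd s1 y (s1 y + s1 x)) x 0) by state_eq. easy.
Qed.

Lemma cwp_addcopy B x y z (Q : state -> Prop) s :
  x <> y -> x <> z -> y <> z -> s y + s x <= B ->
  Q (upd (upd s y (s y + s x)) z 0) -> cwp B (caddcopy x y z) Q s.
Proof.
  intros Hxy Hxz Hyz HB HQ. apply cwp_seq, cwp_zero, cwp_seq.
  set (F := fun s1 : state => upd (upd (upd s1 y (s1 y + s1 x)) z (s1 z + s1 x)) x 0).
  apply (cwp_while _ _ _ (fun s1 => F s1 = F (upd s z 0)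
     /\ s1 y + s1 x = s y + s x /\ s1 z + s1 x = s x) (fun s1 => s1 x)).
  - updcase; lia || auto.
  - intros s1 (E1 & E2 & E3) Hx.
    apply cwp_seq, cwp_dec, cwp_seq, cwp_inc; [rewrite upd_other by auto; lia|].
    apply cwp_inc; [rewrite !upd_other by auto; lia|].
    split; [split; [|split; updcase; lia] | updcase; lia].
    rewrite <- E1. unfold F. state_eq.
  - intros s1 (E1 & E2 & E3) Hx. apply cwp_move; auto; [lia|].
    enough (upd (upd s1 x (s1 x + s1 z)) z 0 = upd (upd s y (s y + s x)) z 0) as -> by easy.
    apply functional_extensionality. intros i.
    assert (E : F s1 i = F (upd s z 0) i) by congruence. unfold F in E.
    revert E. updcase; lia.
Qed.

(** * Arithmetic on counters *)

Inductive op := Add | Sub | Mul | Div | Mod.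

Definition op_sem (o : op) : nat -> nat -> nat :=
  match o with
  | Add => Nat.add | Sub => Nat.sub | Mul => Nat.mul | Div => Nat.div | Mod => Nat.modulo
  end.

(* Operands in [t] and [t + 1], result in [t]. *)
Definition csub t := CWhile (1 + t) (CSeq (CDec (1 + t)) (CDec t)).

Definition cmul t :=
  CSeq (czero (2 + t)) (CSeq (cmove t (2 + t))
    (CWhile (2 + t) (CSeq (CDec (2 + t)) (caddcopy (1 + t) t (3 + t))))).

(* Leaves the quotient in [t + 2], and [divisor - remainder] in [t + 3]. *)
Definition cdivloop t :=
  CSeq (czero (2 + t)) (CSeq (czero (3 + t)) (CSeq (caddcopy (1 + t) (3 + t) (4 + t))
    (CWhile t (CSeq (CDec t) (CSeq (CDec (3 + t))
      (CIf (3 + t) CSkip (CSeq (CInc (2 + t)) (caddcopy (1 + t) (3 + t) (4 + t))))))))).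

(** All scratch counters lie above [t], so the counters from some address on can serve as an
    evaluation stack. *)
Definition cop (o : op) (t : nat) : cprog :=
  match o with
  | Add => cmove (1 + t) t
  | Sub => csub t
  | Mul => cmul t
  | Div => CSeq (cdivloop t) (cmove (2 + t) t)
  (* The division loop leaves [b - r], so the remainder is obtained as [b - (b - r)]. *)
  | Mod => CSeq (cdivloop t) (CSeq (cmove (1 + t) t) (CSeq (czero (1 + t))
             (CSeq (cmove (3 + t) (1 + t)) (csub t))))
  end.

(** Zero divisors are excluded because the counting loop does not in general reproduce the
    conventional values of [a / 0] and [a mod 0]. *)
Definition op_ok (B : nat) (o : op) (a b : nat) : Prop :=
  match o with
  | Add => a + b <= B
  | Sub => True
  | Mul => a * b <= B
  | Div | Mod => b <> 0
  end.

Lemma op_ok_bound B o a b : a <= B -> b <= B -> op_ok B o a b -> op_sem o a b <= B.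
Proof.
  destruct o; cbn; intros Ha Hb H; try lia.
  - pose proof (Nat.Div0.div_le_upper_bound a b a). nia.
  - pose proof (Nat.mod_upper_bound a b H). lia.
Qed.

Lemma cwp_sub B t (Q : state -> Prop) s :
  (forall s', s' t = s t - s (1 + t) -> (forall i, i < t -> s' i = s i) -> Q s') ->
  cwp B (csub t) Q s.
Proof.
  intros HQ.
  apply (cwp_while _ _ _ (fun s1 => s1 t - s1 (1 + t) = s t - s (1 + t)
     /\ forall i, i < t -> s1 i = s i) (fun s1 => s1 (1 + t))).
  - auto.
  - intros s1 [E1 E2] Hx. apply cwp_seq, cwp_dec, cwp_dec. repeat split.
    + updcase; lia.
    + intros i Hi. rewrite !upd_other by lia. auto.
    + updcase; lia.
  - intros s1 [E1 E2] Hx. apply HQ; [lia | auto].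
Qed.

Lemma cwp_mul B t (Q : state -> Prop) s :
  s t <= B -> s t * s (1 + t) <= B ->
  (forall s', s' t = s t * s (1 + t) -> (forall i, i < t -> s' i = s i) -> Q s') ->
  cwp B (cmul t) Q s.
Proof.
  intros HB1 HB HQ. apply cwp_seq, cwp_zero, cwp_seq, cwp_move; [lia | updcase; lia |].
  apply (cwp_while _ _ _ (fun s1 => s1 t + s1 (2 + t) * s1 (1 + t) = s t * s (1 + t)
     /\ s1 (1 + t) = s (1 + t) /\ forall i, i < t -> s1 i = s i) (fun s1 => s1 (2 + t))).
  - repeat split; try (intros i Hi); updcase; lia.
  - intros s1 (E1 & E2 & E3) Hx. apply cwp_seq, cwp_dec.
    destruct (s1 (2 + t)) as [|n] eqn:En; [easy|].
    apply cwp_addcopy; try lia; [updcase; nia|].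
    repeat split; try (intros i Hi; specialize (E3 i Hi)); updcase; nia.
  - intros s1 (E1 & E2 & E3) Hx. apply HQ; [rewrite Hx in E1; lia | auto].
Qed.

Lemma cwp_divloop B t (Q : state -> Prop) s :
  s t <= B -> s (1 + t) <= B -> s (1 + t) <> 0 ->
  (forall s', s' t = 0 -> s' (1 + t) = s (1 + t) -> s' (2 + t) = s t / s (1 + t) ->
     s' (3 + t) = s (1 + t) - s t mod s (1 + t) -> (forall i, i < t -> s' i = s i) -> Q s') ->
  cwp B (cdivloop t) Q s.
Proof.
  intros HB1 HB2 Hb HQ. apply cwp_seq, cwp_zero, cwp_seq, cwp_zero, cwp_seq.
  apply cwp_addcopy; try lia; [updcase; lia|].
  apply (cwp_while _ _ _ (fun s1 => exists rem, s1 (3 + t) + rem = s (1 + t)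
     /\ rem < s (1 + t) /\ s1 t + s1 (2 + t) * s (1 + t) + rem = s t
     /\ s1 (1 + t) = s (1 + t) /\ forall i, i < t -> s1 i = s i) (fun s1 => s1 t)).
  - exists 0. repeat split; try (intros i Hi); updcase; lia.
  - intros s1 (rem & E1 & E2 & E3 & E4 & E5) Hx.
    apply cwp_seq, cwp_dec, cwp_seq, cwp_dec, cwp_if.
    + intros Hnz. eexists. split; [constructor|].
      split; [exists (S rem)|]; repeat split; try (intros i Hi; specialize (E5 i Hi));
        revert Hnz; updcase; lia.
    + intros Hz. assert (Erem : S rem = s (1 + t)) by (revert Hz; updcase; lia).
      apply cwp_seq, cwp_inc; [updcase; nia|].
      apply cwp_addcopy; try lia; [revert Hz; updcase; lia|].
      split; [exists 0|]; repeat split; try (intros i Hi; specialize (E5 i Hi));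
        revert Hz; updcase; nia.
  - intros s1 (rem & E1 & E2 & E3 & E4 & E5) Hx. rewrite Hx in E3.
    assert (Es : s t = s (1 + t) * s1 (2 + t) + rem) by lia.
    rewrite <- (Nat.div_unique _ _ _ _ E2 Es) in HQ.
    rewrite <- (Nat.mod_unique _ _ _ _ E2 Es) in HQ.
    apply HQ; auto. lia.
Qed.

Lemma cwp_op B o t (Q : state -> Prop) s :
  s t <= B -> s (1 + t) <= B -> op_ok B o (s t) (s (1 + t)) ->
  (forall s', s' t = op_sem o (s t) (s (1 + t)) -> (forall i, i < t -> s' i = s i) -> Q s') ->
  cwp B (cop o t) Q s.
Proof.
  intros HB1 HB2 Hok HQ. destruct o; cbn [cop op_ok op_sem] in *.
  - apply cwp_move; [lia | lia |]. apply HQ; [|intros i Hi]; updcase; lia.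
  - now apply cwp_sub.
  - now apply cwp_mul.
  - apply cwp_seq, cwp_divloop; auto. intros s1 E1 E2 E3 E4 E5.
    assert (s1 (2 + t) <= B).
    { rewrite E3. apply (op_ok_bound B Div); auto. }
    apply cwp_move; [lia | lia |].
    apply HQ; [|intros i Hi; specialize (E5 i Hi)]; updcase; lia.
  - apply cwp_seq, cwp_divloop; auto. intros s1 E1 E2 E3 E4 E5.
    apply cwp_seq, cwp_move; [lia | lia |].
    apply cwp_seq, cwp_zero, cwp_seq, cwp_move; [lia | updcase; lia |].
    pose proof (Nat.mod_upper_bound (s t) (s (1 + t)) Hok).
    apply cwp_sub. intros s2 F1 F2. apply HQ.
    + rewrite F1. updcase; lia.
    + intros i Hi. rewrite F2 by easy. specialize (E5 i Hi). updcase; lia.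
Qed.

(** * Expressions and structured commands *)

Inductive expr :=
| Var (r : nat)
| Const (n : nat)
| Op (o : op) (e1 e2 : expr).

Inductive cmd :=
| Asgn (r : nat) (e : expr)
| Seq (c1 c2 : cmd)
| If (e : expr) (c1 c2 : cmd)
| While (e : expr) (c : cmd).

Fixpoint eval (s : state) (e : expr) : nat :=
  match e with
  | Var r => s r
  | Const n => n
  | Op o e1 e2 => op_sem o (eval s e1) (eval s e2)
  end.

Fixpoint eval_ok (B : nat) (s : state) (e : expr) : Prop :=
  match e with
  | Var r => True
  | Const n => n <= B
  | Op o e1 e2 => eval_ok B s e1 /\ eval_ok B s e2 /\ op_ok B o (eval s e1) (eval s e2)
  end.

Inductive exec (B : nat) : cmd -> state -> state -> Prop :=
| E_asgn r e s : eval_ok B s e -> exec B (Asgn r e) s (upd s r (eval s e))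
| E_seq c1 c2 s1 s2 s3 : exec B c1 s1 s2 -> exec B c2 s2 s3 -> exec B (Seq c1 c2) s1 s3
| E_if e c1 c2 s s' : eval_ok B s e -> exec B (if eval s e =? 0 then c2 else c1) s s' ->
    exec B (If e c1 c2) s s'
| E_while_end e c s : eval_ok B s e -> eval s e = 0 -> exec B (While e c) s s
| E_while e c s1 s2 s3 : eval_ok B s1 e -> eval s1 e <> 0 -> exec B c s1 s2 ->
    exec B (While e c) s2 s3 -> exec B (While e c) s1 s3.

Fixpoint expr_below (V : nat) (e : expr) : bool :=
  match e with
  | Var r => r <? V
  | Const _ => true
  | Op _ e1 e2 => expr_below V e1 && expr_below V e2
  end.

Fixpoint cmd_below (V : nat) (c : cmd) : bool :=
  match c with
  | Asgn r e => (r <? V) && expr_below V e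
  | Seq c1 c2 => cmd_below V c1 && cmd_below V c2
  | If e c1 c2 => expr_below V e && cmd_below V c1 && cmd_below V c2
  | While e c => expr_below V e && cmd_below V c
  end.

Fixpoint cconst (t n : nat) : cprog :=
  match n with 0 => czero t | S n' => CSeq (cconst t n') (CInc t) end.

Fixpoint cexpr (e : expr) (t : nat) : cprog :=
  match e with
  | Var r => CSeq (czero t) (caddcopy r t (1 + t))
  | Const n => cconst t n
  | Op o e1 e2 => CSeq (cexpr e1 t) (CSeq (cexpr e2 (1 + t)) (cop o t))
  end.

(** Counters below [V] are the program variables, those from [V] on the evaluation stack. A counter
    loop tests a counter, so the guard is evaluated before the loop and again at the end of each
    pass. *)
Fixpoint ccmd (V : nat) (c : cmd) : cprog :=
  match c with
  | Asgn r e => CSeq (cexpr e V) (CSeq (czero r) (cmove V r))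
  | Seq c1 c2 => CSeq (ccmd V c1) (ccmd V c2)
  | If e c1 c2 => CSeq (cexpr e V) (CIf V (ccmd V c1) (ccmd V c2))
  | While e c => CSeq (cexpr e V) (CWhile V (CSeq (ccmd V c) (cexpr e V)))
  end.

Lemma eval_bound B V s e :
  (forall r, r < V -> s r <= B) -> expr_below V e = true -> eval_ok B s e -> eval s e <= B.
Proof.
  intros Hs. induction e as [r | n | o e1 IH1 e2 IH2]; cbn.
  - intros Hr _. apply Nat.ltb_lt in Hr. auto.
  - auto.
  - intros [H1 H2]%andb_true_iff (K1 & K2 & K3). apply op_ok_bound; auto.
Qed.

Lemma cwp_const B t n : forall (Q : state -> Prop) s,
  n <= B -> Q (upd s t n) -> cwp B (cconst t n) Q s.
Proof.
  induction n as [|n IH]; intros Q s Hn HQ; cbn [cconst].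
  - now apply cwp_zero.
  - apply cwp_seq, IH; [lia|]. apply cwp_inc; [rewrite upd_same; lia|].
    replace (upd (upd s t n) t _) with (upd s t (S n)); [easy|]. state_eq.
Qed.

(** The state [s] fixes the values of the variables, while [s1] is any state agreeing with it below
    [V]; the second operand is evaluated when the stack already differs. *)
Lemma cwp_expr B V s e :
  (forall r, r < V -> s r <= B) -> expr_below V e = true -> eval_ok B s e ->
  forall t (Q : state -> Prop) s1, V <= t -> (forall r, r < V -> s1 r = s r) ->
  (forall s', s' t = eval s e -> (forall i, i < t -> s' i = s1 i) -> Q s') ->
  cwp B (cexpr e t) Q s1.
Proof.
  intros Hs. induction e as [r | n | o e1 IH1 e2 IH2]; cbn; intros Hv Hok t Q s1 Ht Hag HQ.
  - apply Nat.ltb_lt in Hv. specialize (Hs r Hv). specialize (Hag r Hv).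
    apply cwp_seq, cwp_zero, cwp_addcopy; try lia; [updcase; lia|].
    apply HQ; [|intros i Hi]; updcase; lia.
  - apply cwp_const; [easy|]. apply HQ; [|intros i Hi]; updcase; lia.
  - apply andb_true_iff in Hv as [H1 H2]. destruct Hok as (K1 & K2 & K3).
    pose proof (eval_bound B V s e1 Hs H1 K1). pose proof (eval_bound B V s e2 Hs H2 K2).
    apply cwp_seq, (IH1 H1 K1 t); auto. intros s2 E1 E2.
    apply cwp_seq, (IH2 H2 K2 (1 + t)); [lia | intros r Hr; rewrite E2 by lia; auto |].
    intros s3 F1 F2. assert (F3 : s3 t = eval s e1) by (rewrite F2 by lia; easy).
    apply cwp_op; rewrite ?F1, ?F3; try easy.
    intros s4 G1 G2. apply HQ; [easy|].
    intros i Hi. rewrite G2, F2, E2 by lia. reflexivity.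
Qed.

Lemma exec_bounded B V c s s' :
  cmd_below V c = true -> exec B c s s' ->
  (forall r, r < V -> s r <= B) -> forall r, r < V -> s' r <= B.
Proof.
  intros Hv. induction 1 as [r e s Hok | c1 c2 s1 s2 s3 _ IH1 _ IH2 | e c1 c2 s s' Hok _ IH
    | e c s | e c s1 s2 s3 Hok Hz _ IH1 _ IH2]; cbn in Hv; intros Hs.
  - apply andb_true_iff in Hv as [_ Hv]. intros i Hi. unfold upd.
    destruct (i =? r); [|auto]. eapply eval_bound; eauto.
  - apply andb_true_iff in Hv as [H1 H2]. auto.
  - apply andb_true_iff in Hv as [[_ H1]%andb_true_iff H2].
    apply IH; [now destruct (eval s e =? 0) | auto].
  - auto.
  - pose proof Hv as Hv'. apply andb_true_iff in Hv as [_ Hv]. auto.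
Qed.

Lemma ccmd_correct B V c s s' :
  cmd_below V c = true -> exec B c s s' -> (forall r, r < V -> s r <= B) ->
  forall s1, (forall r, r < V -> s1 r = s r) ->
  cwp B (ccmd V c) (fun s1' => forall r, r < V -> s1' r = s' r) s1.
Proof.
  intros Hv. induction 1 as [r e s Hok | c1 c2 s1 s2 s3 He1 IH1 He2 IH2 | e c1 c2 s s' Hok _ IH
    | e c s Hok Hz | e c s1 s2 s3 Hok Hz He1 IH1 He2 IH2]; cbn in Hv; intros Hs t Hag;
    cbn [ccmd].
  - apply andb_true_iff in Hv as [Hr%Nat.ltb_lt Hv].
    apply cwp_seq, (cwp_expr B V s e Hs Hv Hok); auto. intros t1 E1 E2.
    pose proof (eval_bound B V s e Hs Hv Hok).
    apply cwp_seq, cwp_zero, cwp_move; [lia | updcase; lia |].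
    intros i Hi. pose proof (E2 i Hi). pose proof (Hag i Hi). updcase; lia.
  - apply andb_true_iff in Hv as [H1 H2]. apply cwp_seq.
    eapply cwp_conseq; [apply IH1; auto|]. cbn. intros t1 Ht1.
    apply IH2; auto. now apply (exec_bounded B V c1 s1 s2).
  - apply andb_true_iff in Hv as [[Hv H1]%andb_true_iff H2].
    apply cwp_seq, (cwp_expr B V s e Hs Hv Hok); auto. intros t1 E1 E2.
    assert (Hag1 : forall r, r < V -> t1 r = s r) by (intros; rewrite E2 by lia; auto).
    apply cwp_if; rewrite E1; intros Hz.
    + apply Nat.eqb_neq in Hz. rewrite Hz in IH. auto.
    + rewrite Hz in IH. cbn [Nat.eqb] in IH. auto.
  - apply andb_true_iff in Hv as [Hv H1].
    apply cwp_seq, (cwp_expr B V s e Hs Hv Hok); auto. intros t1 E1 E2.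
    exists t1. split; [constructor; congruence|]. intros r Hr. rewrite E2 by lia. auto.
  - pose proof Hv as Hv'. apply andb_true_iff in Hv as [Hv H1].
    apply cwp_seq, (cwp_expr B V s1 e Hs Hv Hok); auto. intros t1 E1 E2.
    assert (Hag1 : forall r, r < V -> t1 r = s1 r) by (intros; rewrite E2 by lia; auto).
    destruct (IH1 H1 Hs t1 Hag1) as (t2 & He2' & Hag2).
    destruct (IH2 Hv' (exec_bounded B V c s1 s2 H1 He1 Hs) t2 Hag2) as (t4 & He4 & Hag4).
    (* The hypothesis for the rest of the loop starts by evaluating the guard. That evaluation is
       the end of the present pass, so the execution is split there. *)
    cbn [ccmd] in He4. inversion He4 as [| | |? ? ? t3 ? He3 Hloop | | |]; subst.
    exists t4. split; [|easy].
    apply CE_while with t3; [congruence | | exact Hloop].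
    now apply CE_seq with t2.
Qed.

Definition compile (V : nat) (c : cmd) (res : nat) : list instr :=
  let p := ccmd V c in
  flatten p 0 (csize p) ++
  [ITest res (1 + csize p) (2 + csize p); IHalt false; IHalt true].

(** Values up to [2 ^ h - 1] have [h] binary digits; the head then stays at most at [S h], which
    gives the strict bound [2 + h]. *)
Theorem compile_decides V c res (L : list bool -> Prop) (h : nat -> nat) :
  res < V -> cmd_below V c = true ->
  (forall x, length x <= h (length x) /\ exists s, exec (2 ^ h (length x) - 1) c (init_state x) s /\
     (s res <> 0 <-> L x)) ->
  wf_TM (cm_TM (compile V c res)) /\
  decides_in_space (cm_TM (compile V c res)) L (fun n => 2 + h n).
Proof.
  intros Hres Hv HL. split; [apply cm_TM_wf|]. intros x.
  destruct (HL x) as (Hx & s & He & HLx). set (H := h (length x)) in *.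
  assert (HH : 0 < 2 ^ H) by (apply Nat.neq_0_lt_0, Nat.pow_nonzero; lia).
  assert (Hval : forall b y, bits_val b y <= 2 ^ length y - 1).
  { intros b. induction y as [|d y IH]; cbn [bits_val length]; [cbn; lia|].
    rewrite Nat.pow_succ_r'. pose proof (Nat.pow_nonzero 2 (length y)).
    destruct (Bool.eqb d b); cbn [Nat.b2n]; lia. }
  assert (Hinit : forall r, r < V -> init_state x r <= 2 ^ H - 1).
  { intros r _. assert (2 ^ length x <= 2 ^ H) by (apply Nat.pow_le_mono_r; lia).
    pose proof (Hval false x). pose proof (Hval true x).
    unfold init_state. destruct (r =? 0), (r =? 1); lia. }
  destruct (ccmd_correct _ _ _ _ _ Hv He Hinit (init_state x) ltac:(easy)) as (t & Ht & Hag).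
  set (P := compile V c res). set (p := ccmd V c) in *.
  assert (Hp : code_at P 0 (flatten p 0 (csize p))).
  { intros i y Hy. unfold P, compile. rewrite nth_error_app1; [easy|].
    apply nth_error_Some. fold p. cbn in *. congruence. }
  assert (Hend : forall i, nth_error P (i + csize p) =
    nth_error [ITest res (1 + csize p) (2 + csize p); IHalt false; IHalt true] i).
  { intros i. unfold P, compile. fold p. rewrite nth_error_app2, flatten_length;
    [|rewrite flatten_length; lia]. now rewrite Nat.add_sub. }
  pose proof (flatten_correct H P p _ _ (2 ^ H - 1) ltac:(lia) Ht 0 (csize p) Hp) as R1.
  pose proof (FS_test H P (csize p) t res _ _ (Hend 0)) as R2.
  pose proof (flat_reach_trans _ _ _ _ _ R1 (flat_reach_one _ _ _ _ R2)) as R3.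
  destruct (cm_decides P H x _ t (negb (t res =? 0)) Hx R3) as [D1 D2].
  - destruct (t res =? 0); [apply (Hend 1) | apply (Hend 2)].
  - split.
    + destruct D1 as (n & Hh & Hn). exists n. split; [easy|]. rewrite Hn, <- HLx, Hag by easy.
      rewrite negb_true_iff, Nat.eqb_neq. reflexivity.
    + intros n. specialize (D2 n). fold P H. lia.
Qed.

(** * Saturation thresholds and codes of points *)

Definition add_vec (u v : list nat) := map (fun p => fst p + snd p) (combine u v).

Lemma add_vec_length u v : length u = length v -> length (add_vec u v) = length u.
Proof. intros H. unfold add_vec. rewrite length_map, length_combine. lia. Qed.

Definition all_valid (k : nat) (A : nset) := forall x, A x -> valid k x.

(** One implication suffices, as [x] and [y] may be exchanged. Infinity is a single point and needs
    no condition. *)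
Definition saturated (T : nat) (A : nset) :=
  forall x y, map (min T) x = map (min T) y -> A (Some x) -> A (Some y).

Lemma map_min_le T T' x y :
  T <= T' -> map (min T') x = map (min T') y -> map (min T) x = map (min T) y.
Proof.
  intros HT E. assert (H : forall z, map (min T) z = map (min T) (map (min T') z)).
  { intros z. rewrite map_map. apply map_ext. intros. lia. }
  rewrite (H x), (H y). now rewrite E.
Qed.

Lemma map_min_idem T x : map (min T) (map (min T) x) = map (min T) x.
Proof. rewrite map_map. apply map_ext. intros. lia. Qed.

Lemma saturated_mono T T' A : T <= T' -> saturated T A -> saturated T' A.
Proof. intros HT H x y E. apply H. now apply (map_min_le T T'). Qed.

Lemma split_sum T T' : 2 * T <= T' -> forall u v y,
  length u = length v -> map (min T') (add_vec u v) = map (min T') y ->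
  exists u' v', length u' = length v' /\ y = add_vec u' v' /\
    map (min T) u = map (min T) u' /\ map (min T) v = map (min T) v'.
Proof.
  intros HT. induction u as [|a u IH]; intros [|b v] [|c y] Hl E; try discriminate.
  - now exists [], [].
  - cbn in E. injection E as Eh Et. injection Hl as Hl.
    destruct (IH v y Hl Et) as (u' & v' & Hl' & -> & Eu & Ev).
    assert (exists a' b', c = a' + b' /\ min T a = min T a' /\ min T b = min T b')
      as (a' & b' & -> & Ea & Eb).
    (* A summand below [T] is kept and the other one takes the rest, which is still at least [T]
       because [c] is either the old sum or at least [2 * T]. Two small summands have a sum below
       [T'], so [c] equals it. *)
    { destruct (le_lt_dec T a), (le_lt_dec T b).
      - exists T, (c - T). lia.
      - exists (c - b), b. lia.
      - exists a, (c - a). lia.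
      - exists a, b. lia. }
    exists (a' :: u'), (b' :: v'). cbn. rewrite Eu, Ev, Ea, Eb. auto.
Qed.

Lemma saturated_plus T T' k A B :
  2 * T <= T' -> all_valid k A -> all_valid k B -> saturated T A -> saturated T B ->
  saturated T' (set_plus A B).
Proof.
  intros HT VA VB HA HB x y E (a & b & Ha & Hb & Ex).
  destruct a as [u|], b as [v|]; try discriminate. injection Ex as ->.
  pose proof (VA _ Ha) as Hu. pose proof (VB _ Hb) as Hv. cbn in Hu, Hv.
  destruct (split_sum T T' HT u v y) as (u' & v' & _ & -> & Eu & Ev); [lia | easy |].
  exists (Some u'), (Some v'). repeat split; [now apply (HA u) | now apply (HB v)].
Qed.

(** Truncation is compatible with sums but not with differences, so subtraction is always rewritten
    as an addition. *)
Lemma sub_elt_spec u v x : length u = length v ->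
  sub_elt (Some u) (Some v) = Some (Some x) <-> length x = length v /\ u = add_vec x v.
Proof.
  revert v x. induction u as [|a u IH]; intros [|b v] x Hl; try discriminate.
  - cbn. split.
    + now intros [= <-].
    + intros [Hx _]. apply length_zero_iff_nil in Hx as ->. reflexivity.
  - injection Hl as Hl. specialize (IH v). cbn in *.
    destruct (Nat.leb_spec b a) as [Hba | Hba]; cbn.
    + destruct (forallb _ (combine u v)); split.
      * intros [= <-]. destruct (IH (map (fun p => fst p - snd p) (combine u v)) Hl)
          as [H _]. destruct (H eq_refl) as [Hx Hu]. cbn. split; [lia|].
        unfold add_vec in *. cbn. rewrite <- Hu. f_equal. lia.
      * intros [Hx E]. destruct x as [|c x]; [discriminate|]. injection Hx as Hx.
        cbn in E. injection E as -> E.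
        destruct (IH x Hl) as [_ H]. injection (H (conj Hx E)) as <-.
        repeat f_equal. lia.
      * discriminate.
      * intros [Hx E]. destruct x as [|c x]; [discriminate|]. injection Hx as Hx.
        cbn in E. injection E as -> E.
        destruct (IH x Hl) as [_ H]. discriminate (H (conj Hx E)).
    + split; [discriminate|]. intros [Hx E]. destruct x as [|c x]; [discriminate|].
      cbn in E. injection E as -> E. lia.
Qed.

Lemma map_min_add T x y v :
  map (min T) x = map (min T) y -> map (min T) (add_vec x v) = map (min T) (add_vec y v).
Proof.
  revert y v. induction x as [|a x IH]; intros [|b y] v E; try discriminate; [easy|].
  destruct v as [|c v]; [easy|]. cbn in *. injection E as E1 E2.
  f_equal; [lia | now apply IH].
Qed.

Lemma map_min_length T x y : map (min T) x = map (min T) y -> length x = length y.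
Proof. intros E. apply (f_equal (@length nat)) in E. now rewrite !length_map in E. Qed.

(** The same subtrahend [v] serves both points: the minuends [x + v] and [y + v] agree up to [T].
    Hence the threshold does not grow. *)
Lemma saturated_minus T k A B :
  all_valid k A -> all_valid k B -> saturated T A -> saturated T (set_minus A B).
Proof.
  intros VA VB HA x y E (a & b & Ha & Hb & Ex).
  destruct a as [u|], b as [v|]; try discriminate.
  pose proof (VA _ Ha) as Hu. pose proof (VB _ Hb) as Hv. cbn in Hu, Hv.
  apply sub_elt_spec in Ex as [Hx ->]; [|lia].
  pose proof (map_min_length _ _ _ E).
  exists (Some (add_vec y v)), (Some v). split; [|split]; [|easy|].
  - apply (HA (add_vec x v)); [now apply map_min_add | easy].
  - apply sub_elt_spec; [rewrite add_vec_length; lia | split; [lia | easy]].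
Qed.

Definition inputs_ok (k T : nat) (gs : list gate) :=
  forall i e, nth i gs (GInput None) = GInput e ->
    valid k e /\ forall v, e = Some v -> Forall (fun x => x < T) v.

Lemma gate_sem_valid k T gs f i : inputs_ok k T gs -> all_valid k (gate_sem k gs f i).
Proof.
  intros Hin. revert i. induction f as [|f IH]; intros i x; cbn [gate_sem]; [easy|].
  destruct (nth i gs (GInput None)) as [e | j | o j1 j2] eqn:Eg.
  - intros ->. now apply (Hin i).
  - intros [H _]. easy.
  - pose proof (IH j1) as V1. pose proof (IH j2) as V2. destruct o; cbn [sem_binop].
    + intros [H | H]; [apply V1, H | apply V2, H].
    + intros [H _]. now apply V1.
    + intros (a & b & Ha & Hb & ->). apply V1 in Ha. apply V2 in Hb.
      destruct a as [u|], b as [v|]; try easy. cbn in Ha, Hb.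
      change (length (add_vec u v) = k). rewrite add_vec_length; lia.
    + intros (a & b & Ha & Hb & E). apply V1 in Ha. apply V2 in Hb.
      destruct a, b, x; cbn [valid] in *; try easy; try discriminate.
      apply sub_elt_spec in E as [E _]; lia.
Qed.

Lemma Forall_min_eq T v : Forall (fun x => x < T) v -> forall y,
  map (min T) v = map (min T) y -> v = y.
Proof.
  induction 1 as [|a v Ha _ IH]; intros [|b y] E; try discriminate; [easy|].
  cbn in E. injection E as E1 E2. f_equal; [lia | auto].
Qed.

(* Only [+] doubles the threshold: a coordinate of a sum that is at least
   twice the threshold has a saturated summand, which can absorb any change. *)
Lemma gate_sem_saturated k T gs f : inputs_ok k T gs ->
  forall i, saturated (T * 2 ^ f) (gate_sem k gs f i).
Proof.
  intros Hin. induction f as [|f IH]; intros i; [easy|]. cbn [gate_sem].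
  rewrite Nat.pow_succ_r'.
  assert (Hpos : 2 ^ f <> 0) by (apply Nat.pow_nonzero; lia).
  assert (HT : T * 2 ^ f <= T * (2 * 2 ^ f)) by nia.
  destruct (nth i gs (GInput None)) as [e | j | o j1 j2] eqn:Eg.
  - intros x y E <-. unfold set_single. f_equal. symmetry. apply (Forall_min_eq T).
    + now apply (Hin i (Some x) Eg).
    + revert E. apply map_min_le. nia.
  - intros x y E [Hv Hn]. pose proof (map_min_length _ _ _ E). split; [cbn in *; lia|].
    intros Hy. apply Hn. apply (saturated_mono _ _ _ HT (IH j) y x); auto.
  - pose proof (gate_sem_valid k T gs f j1 Hin). pose proof (gate_sem_valid k T gs f j2 Hin).
    pose proof (saturated_mono _ _ _ HT (IH j1)) as S1.
    pose proof (saturated_mono _ _ _ HT (IH j2)) as S2.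
    destruct o; cbn [sem_binop].
    + intros x y E [Hx | Hx]; [left; now apply (S1 x) | right; now apply (S2 x)].
    + intros x y E [Hx Hx']; split; [now apply (S1 x) | now apply (S2 x)].
    + apply (saturated_plus (T * 2 ^ f) _ k); auto. lia.
    + apply (saturated_minus _ k); auto.
Qed.

(* Without finite inputs the result sets do not distinguish finite points,
   so the dimension is irrelevant. *)
Definition same_kind (k k' : nat) (x y : elt) :=
  match x, y with
  | None, None => True
  | Some u, Some v => length u = k /\ length v = k'
  | _, _ => False
  end.

Lemma add_vec_zero y n : length y = n -> add_vec y (repeat 0 n) = y.
Proof.
  revert n. induction y as [|a y IH]; intros [|n] E; try discriminate; [easy|].
  injection E as E. cbn. rewrite (IH n E : map _ (combine y _) = y). f_equal. lia.
Qed.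

(** The induction treats both dimensions symmetrically because complement uses the hypothesis with
    the roles exchanged. All finite points being alike, a finite sum or difference is witnessed by
    the point itself and the zero vector. *)
Lemma gate_sem_dimension k k' gs :
  (forall i e, nth i gs (GInput None) = GInput e -> e = None) ->
  forall f i x y, same_kind k k' x y -> gate_sem k gs f i x -> gate_sem k' gs f i y.
Proof.
  intros Hin f. revert k k'. induction f as [|f IH]; intros k k' i x y Hxy; [easy|].
  cbn [gate_sem].
  assert (Hok : forall k, inputs_ok k 0 gs).
  { intros k0 j e Ej. rewrite (Hin j e Ej). easy. }
  assert (Hvy : valid k' y) by (destruct x, y; cbn in *; easy).
  assert (Hyx : same_kind k' k y x) by (destruct x, y; cbn in *; easy).
  destruct (nth i gs (GInput None)) as [e | j | o j1 j2] eqn:Eg.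
  - rewrite (Hin i e Eg). intros ->. now destruct y.
  - intros [_ Hn]. split; [easy|]. intros Hy. apply Hn. revert Hy. now apply IH.
  - assert (V1 := gate_sem_valid k 0 gs f j1 (Hok k)).
    assert (V2 := gate_sem_valid k 0 gs f j2 (Hok k)).
    assert (Hz : forall z, valid k z -> same_kind k k' z
                   (match z with None => None | Some _ => Some (repeat 0 k') end)).
    { intros [z|] Hz; cbn in *; [|easy]. now rewrite repeat_length. }
    destruct o; cbn [sem_binop].
    + intros [H | H]; [left | right]; revert H; now apply IH.
    + intros [H H']; split; [revert H | revert H']; now apply IH.
    + intros (a & b & Ha & Hb & ->).
      destruct y as [w|].
      * destruct a as [u|], b as [v|]; try easy. exists (Some w), (Some (repeat 0 k')).
        cbn [valid] in Hvy. split; [|split].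
        -- apply (IH k k' j1 (Some u)); [split; [now apply (V1 (Some u)) | easy] | easy].
        -- apply (IH k k' j2 (Some v)); [apply (Hz (Some v)); now apply V2 | easy].
        -- cbn. f_equal. symmetry. now apply add_vec_zero.
      * eexists _, _. split; [|split].
        -- apply (IH k k' j1 a _ (Hz a (V1 _ Ha)) Ha).
        -- apply (IH k k' j2 b _ (Hz b (V2 _ Hb)) Hb).
        -- now destruct a, b.
    + intros (a & b & Ha & Hb & E).
      destruct b as [v|]; [|now destruct a].
      destruct a as [u|].
      * destruct x as [x|].
        2: { cbn in E. destruct (forallb _ _); discriminate. }
        destruct y as [w|]; [|easy]. cbn [valid] in Hvy.
        exists (Some w), (Some (repeat 0 k')). split; [|split].
        -- apply (IH k k' j1 (Some u)); [split; [now apply (V1 (Some u)) | easy] | easy].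
        -- apply (IH k k' j2 (Some v)); [apply (Hz (Some v)); now apply V2 | easy].
        -- apply sub_elt_spec; rewrite repeat_length; [easy|]. split; [easy|].
           symmetry. now apply add_vec_zero.
      * injection E as <-. destruct y; [easy|].
        exists None, (Some (repeat 0 k')). split; [|split]; [| |easy].
        -- now apply (IH k k' j1 None).
        -- apply (IH k k' j2 (Some v)); [apply (Hz (Some v)); now apply V2 | easy].
Qed.

(** * Codes of boxed points, and the operands that justify a point *)

Fixpoint pack (D : nat) (l : list nat) : nat :=
  match l with [] => 0 | a :: l' => a + D * pack D l' end.

Fixpoint unpack (D K p : nat) : list nat :=
  match K with 0 => [] | S K' => p mod D :: unpack D K' (p / D) end.

Lemma unpack_length D K : forall p, length (unpack D K p) = K.
Proof. induction K; intros p; cbn; auto. Qed.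

Lemma pack_cons D a l : a < D -> pack D (a :: l) mod D = a /\ pack D (a :: l) / D = pack D l.
Proof.
  intros H. cbn [pack]. rewrite (Nat.mul_comm D). split.
  - rewrite Nat.Div0.mod_add. now apply Nat.mod_small.
  - rewrite Nat.div_add by lia. now rewrite Nat.div_small.
Qed.

Lemma pack_bound D l : Forall (fun x => x < D) l -> pack D l < D ^ length l.
Proof. induction 1; cbn [pack length]; [cbn; lia|]. rewrite Nat.pow_succ_r'. nia. Qed.

Lemma pack_app D l l' : pack D (l ++ l') = pack D l + D ^ length l * pack D l'.
Proof. induction l as [|a l IH]; cbn [pack app length]; [cbn; lia|]. rewrite Nat.pow_succ_r', IH. nia. Qed.

Lemma unpack_pack D l : Forall (fun x => x < D) l -> unpack D (length l) (pack D l) = l.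
Proof.
  induction 1 as [|a l Ha _ IH]; [easy|]. cbn [length unpack].
  destruct (pack_cons D a l Ha) as [-> ->]. now rewrite IH.
Qed.

Lemma unpack_lt D K : 0 < D -> forall p, Forall (fun x => x < D) (unpack D K p).
Proof.
  intros HD. induction K; intros p; cbn; constructor; auto. apply Nat.mod_upper_bound. lia.
Qed.

Lemma pack_unpack D K : 0 < D -> forall p, p < D ^ K -> pack D (unpack D K p) = p.
Proof.
  intros HD. induction K as [|K IH]; intros p Hp; cbn [unpack pack]; [cbn in Hp; lia|].
  rewrite Nat.pow_succ_r' in Hp.
  rewrite IH by (apply Nat.Div0.div_lt_upper_bound; lia).
  rewrite Nat.add_comm. symmetry. apply Nat.div_mod. lia.
Qed.

(* Points of [0..T]^K are numbers below [(T+1)^K]; infinity and a mark for an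
   unconstrained operand are the next two numbers. *)
Definition inf_code (T K : nat) : nat := S T ^ K.
Definition skip_code (T K : nat) : nat := 1 + inf_code T K.
Definition num_codes (T K : nat) : nat := 2 + inf_code T K.

Definition decode (T K p : nat) : elt :=
  if p <? inf_code T K then Some (unpack (S T) K p) else None.

Definition encode (T K : nat) (e : elt) : nat :=
  match e with None => inf_code T K | Some v => pack (S T) v end.

Lemma lt_S_le T l : Forall (fun x => x <= T) l <-> Forall (fun x => x < S T) l.
Proof. split; apply Forall_impl; intros; lia. Qed.

Lemma decode_encode T K e :
  valid K e -> (forall v, e = Some v -> Forall (fun x => x <= T) v) ->
  decode T K (encode T K e) = e /\ encode T K e <= inf_code T K.
Proof.
  intros He HT. unfold decode. destruct e as [v|]; cbn [encode valid] in *.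
  - specialize (HT v eq_refl). rewrite lt_S_le in HT. subst K.
    pose proof (pack_bound _ _ HT). unfold inf_code.
    apply Nat.ltb_lt in H as H'. rewrite H', unpack_pack by easy. split; [easy | lia].
  - now rewrite Nat.ltb_irrefl.
Qed.

Lemma encode_decode T K p : p <= inf_code T K -> encode T K (decode T K p) = p.
Proof.
  intros Hp. unfold decode. destruct (Nat.ltb_spec p (inf_code T K)); cbn [encode].
  - apply pack_unpack; [lia | easy].
  - lia.
Qed.

Lemma decode_valid T K p : valid K (decode T K p).
Proof. unfold decode. destruct (p <? _); [apply unpack_length | easy]. Qed.

Fixpoint all_digits (f : nat -> nat -> nat -> bool) (D K u v a : nat) : bool :=
  match K with
  | 0 => true
  | S K' => f (u mod D) (v mod D) (a mod D) && all_digits f D K' (u / D) (v / D) (a / D)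
  end.

Definition plus_digit (u v a : nat) : bool := u + v =? a.
Definition minus_digit (T u v a : nat) : bool := u =? min T (a + v).

Lemma plus_digits_spec D K : forall u v a,
  all_digits plus_digit D K u v a = true <->
  unpack D K a = add_vec (unpack D K u) (unpack D K v).
Proof.
  induction K as [|K IH]; intros u v a; [easy|].
  cbn [all_digits unpack]. rewrite andb_true_iff, IH. unfold plus_digit.
  rewrite Nat.eqb_eq. unfold add_vec. cbn. split.
  - intros [-> ->]. reflexivity.
  - intros [= E1 E2]. auto.
Qed.

Lemma minus_digits_spec T D K : forall u v a,
  all_digits (minus_digit T) D K u v a = true <->
  unpack D K u = map (min T) (add_vec (unpack D K a) (unpack D K v)).
Proof.
  induction K as [|K IH]; intros u v a; [easy|].
  cbn [all_digits unpack]. rewrite andb_true_iff, IH. unfold minus_digit.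
  rewrite Nat.eqb_eq. unfold add_vec. cbn [combine map fst snd]. split.
  - intros [-> ->]. reflexivity.
  - intros [= E1 E2]. auto.
Qed.

(** The operand pairs that may be proposed for [a]. A union commits to one operand and skips the
    other; an input gate has no operands and skips both. The strict bound on [v] for differences
    expresses that infinity cannot be subtracted. Complement has no proposal, since it passes the
    query on. *)
Definition rel (T K : nat) (g : gate) (a u v : nat) : bool :=
  let inf := inf_code T K in
  let skip := skip_code T K in
  match g with
  | GInput e => (u =? skip) && (v =? skip) && (a =? encode T K e)
  | GCompl _ => false
  | GBin OUnion _ _ => (u =? a) && (v =? skip) || (u =? skip) && (v =? a)
  | GBin OInter _ _ => (u =? a) && (v =? a)
  | GBin OPlus _ _ =>
      (u <=? inf) && (v <=? inf) &&
      (if (u =? inf) || (v =? inf) then a =? inf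
       else (a <? inf) && all_digits plus_digit (S T) K u v a)
  | GBin OMinus _ _ =>
      (u <=? inf) && (v <? inf) &&
      (if u =? inf then a =? inf
       else (a <? inf) && all_digits (minus_digit T) (S T) K u v a)
  end.

Definition holds_or_skip (T K : nat) (A : nset) (u : nat) : Prop :=
  u = skip_code T K \/ A (decode T K u).

Lemma add_vec_le T x y : length x = length y ->
  Forall (fun z => z <= T) (add_vec x y) ->
  Forall (fun z => z <= T) x /\ Forall (fun z => z <= T) y.
Proof.
  revert y. induction x as [|a x IH]; intros [|b y] Hl H; try discriminate; [easy|].
  inversion H as [|? ? H1 H2]; subst. injection Hl as Hl. cbn in H1.
  destruct (IH y Hl H2). split; constructor; auto; lia.
Qed.

Lemma map_min_Forall T x : Forall (fun z => z <= T) (map (min T) x).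
Proof. induction x; cbn; constructor; auto. lia. Qed.

Definition truncate (T : nat) (e : elt) : elt :=
  match e with None => None | Some v => Some (map (min T) v) end.

Lemma decode_truncate T K e : valid K e ->
  exists p, p <= inf_code T K /\ decode T K p = truncate T e.
Proof.
  intros He. exists (encode T K (truncate T e)).
  destruct (decode_encode T K (truncate T e)) as [-> H]; auto.
  - destruct e; cbn in *; [now rewrite length_map | easy].
  - intros v Hv. destruct e; [|discriminate]. injection Hv as <-. apply map_min_Forall.
Qed.

Lemma saturated_truncate T A e : saturated T A -> A e -> A (truncate T e).
Proof.
  intros HA. destruct e as [v|]; [|easy]. apply HA. now rewrite map_min_idem.
Qed.

Lemma decode_Some T K p v : decode T K p = Some v ->
  p < inf_code T K /\ v = unpack (S T) K p.
Proof.
  unfold decode. destruct (Nat.ltb_spec p (inf_code T K)); [|easy]. now intros [= <-].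
Qed.

Lemma decode_None T K p : decode T K p = None -> inf_code T K <= p.
Proof. unfold decode. destruct (Nat.ltb_spec p (inf_code T K)); [easy | auto]. Qed.

(** Every pair of operands can be moved into the box. Summands of a boxed finite point are boxed
    already; operands of an infinite result are truncated, which saturation permits; in a finite
    difference the subtrahend is truncated and the minuend becomes the truncation of the sum of
    result and subtrahend. *)
Lemma rel_spec T K o j1 j2 A B a :
  all_valid K A -> all_valid K B -> saturated T A -> saturated T B -> a <= inf_code T K ->
  (exists u v, u < num_codes T K /\ v < num_codes T K /\
     rel T K (GBin o j1 j2) a u v = true /\ holds_or_skip T K A u /\ holds_or_skip T K B v)
  <-> sem_binop o A B (decode T K a).
Proof.
  intros VA VB SA SB Ha. unfold rel, holds_or_skip, num_codes, skip_code.
  set (inf := inf_code T K) in *.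
  destruct o; cbn [sem_binop].
  - split.
    + intros (u & v & Hu & Hv & Hr & Hu' & Hv').
      apply orb_true_iff in Hr as [[E1%Nat.eqb_eq E2%Nat.eqb_eq]%andb_true_iff
                                  | [E1%Nat.eqb_eq E2%Nat.eqb_eq]%andb_true_iff]; subst u v.
      * left. destruct Hu'; [lia | easy].
      * right. destruct Hv'; [lia | easy].
    + intros [H | H]; [exists a, (1 + inf) | exists (1 + inf), a];
        rewrite !Nat.eqb_refl; cbn; rewrite ?orb_true_r; repeat split; auto; lia.
  - split.
    + intros (u & v & Hu & Hv & [E1%Nat.eqb_eq E2%Nat.eqb_eq]%andb_true_iff & Hu' & Hv').
      subst u v. split; [destruct Hu' | destruct Hv']; easy || lia.
    + intros [H1 H2]. exists a, a. rewrite Nat.eqb_refl. repeat split; auto; lia.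
  - split.
    + intros (u & v & Hu & Hv & Hr & Hu' & Hv').
      apply andb_true_iff in Hr as [[L1%Nat.leb_le L2%Nat.leb_le]%andb_true_iff Hr].
      exists (decode T K u), (decode T K v).
      destruct Hu' as [? | Hu']; [lia|]. destruct Hv' as [? | Hv']; [lia|].
      repeat split; auto. unfold decode. fold inf.
      destruct (Nat.eqb_spec u inf) as [-> |], (Nat.eqb_spec v inf) as [-> |]; cbn [orb] in Hr.
      1-3: apply Nat.eqb_eq in Hr as ->; rewrite Nat.ltb_irrefl; try easy.
      1: now destruct (u <? inf).
      apply andb_true_iff in Hr as [La Hr]. rewrite La. apply plus_digits_spec in Hr.
      destruct (Nat.ltb_spec u inf), (Nat.ltb_spec v inf); try lia. cbn [add_elt].
      now rewrite Hr.
    + intros (x & y & Hx & Hy & E). pose proof (VA _ Hx) as Vx. pose proof (VB _ Hy) as Vy.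
      assert (Hex : exists p q, p <= inf /\ q <= inf /\ A (decode T K p) /\ B (decode T K q) /\
                     decode T K a = add_elt (decode T K p) (decode T K q)).
      { destruct (decode T K a) as [w|] eqn:Ea.
        - destruct x as [x|], y as [y|]; try discriminate. injection E as E. cbn in Vx, Vy.
          apply decode_Some in Ea as [_ Ea].
          assert (Hw : Forall (fun z => z <= T) w)
            by (subst w; apply lt_S_le, unpack_lt; lia).
          rewrite E in Hw. apply add_vec_le in Hw as [Hwx Hwy]; [|lia].
          destruct (decode_encode T K (Some x)) as [Dx Lx]; auto.
          { now intros ? [= <-]. }
          destruct (decode_encode T K (Some y)) as [Dy Ly]; auto.
          { now intros ? [= <-]. }
          exists (encode T K (Some x)), (encode T K (Some y)). rewrite Dx, Dy.
          repeat split; auto. cbn. now rewrite E.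
        - destruct (decode_truncate T K x Vx) as (p & Lp & Dp).
          destruct (decode_truncate T K y Vy) as (q & Lq & Dq).
          exists p, q. rewrite Dp, Dq. repeat split; auto.
          + exact (saturated_truncate T A x SA Hx).
          + exact (saturated_truncate T B y SB Hy).
          + now destruct x, y. }
      destruct Hex as (p & q & Lp & Lq & Hp & Hq & Epq).
      exists p, q. split; [lia|]. split; [lia|]. split; [|auto].
      apply Nat.leb_le in Lp as Lp'. apply Nat.leb_le in Lq as Lq'. rewrite Lp', Lq'. cbn [andb].
      unfold decode in Epq. fold inf in Epq.
      destruct (Nat.eqb_spec p inf) as [-> |]; cbn [orb].
      { rewrite Nat.ltb_irrefl in Epq. destruct (Nat.ltb_spec a inf); [easy|].
        apply Nat.eqb_eq. lia. }
      destruct (Nat.eqb_spec q inf) as [-> |]; cbn [orb].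
      { rewrite Nat.ltb_irrefl in Epq. destruct (p <? inf), (Nat.ltb_spec a inf); try easy;
        apply Nat.eqb_eq; lia. }
      destruct (Nat.ltb_spec p inf), (Nat.ltb_spec q inf); try lia.
      destruct (a <? inf); [|easy]. cbn [andb]. apply plus_digits_spec.
      cbn in Epq. now injection Epq.
  - split.
    + intros (u & v & Hu & Hv & Hr & Hu' & Hv').
      apply andb_true_iff in Hr as [[L1%Nat.leb_le L2%Nat.ltb_lt]%andb_true_iff Hr].
      destruct Hu' as [? | Hu']; [lia|]. destruct Hv' as [? | Hv']; [lia|].
      unfold decode in *. fold inf in Hu', Hv' |- *.
      apply Nat.ltb_lt in L2 as L2'. rewrite L2' in Hv'.
      destruct (Nat.eqb_spec u inf) as [-> |].
      * apply Nat.eqb_eq in Hr as ->. rewrite Nat.ltb_irrefl in *.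
        eexists None, _. split; [|split]; [exact Hu' | exact Hv' | reflexivity].
      * apply andb_true_iff in Hr as [La Hr]. rewrite La. apply minus_digits_spec in Hr.
        destruct (Nat.ltb_spec u inf); [|lia].
        (* The true minuend [a + v] may lie outside the box; saturation transfers membership to it
           from its truncation [u]. *)
        eexists (Some (add_vec (unpack (S T) K a) (unpack (S T) K v))), _.
        split; [|split]; [|exact Hv'|].
        -- apply (SA (unpack (S T) K u)); [|easy]. now rewrite Hr, map_min_idem.
        -- apply sub_elt_spec; rewrite ?add_vec_length; now rewrite !unpack_length.
    + intros (x & y & Hx & Hy & E). pose proof (VA _ Hx) as Vx. pose proof (VB _ Hy) as Vy.
      destruct y as [y|]; [|now destruct x].
      destruct (decode_truncate T K _ Vy) as (q & Lq & Dq).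
      pose proof (saturated_truncate _ _ _ SB Hy) as Hq. rewrite <- Dq in Hq.
      apply decode_Some in Dq as Dq'. destruct Dq' as [Lq' Eq].
      apply Nat.ltb_lt in Lq' as Lq2. fold inf in Lq2, Lq'.
      destruct x as [x|].
      * destruct (decode T K a) as [w|] eqn:Ea.
        2: { cbn in E. destruct (forallb _ _); discriminate. }
        cbn in Vx, Vy. apply sub_elt_spec in E as [Lw ->]; [|lia].
        apply decode_Some in Ea as [La ->]. fold inf in La. apply Nat.ltb_lt in La as La'.
        set (w := unpack (S T) K a) in *.
        assert (Lu : length (map (min T) (add_vec w (unpack (S T) K q))) = K).
        { rewrite length_map, add_vec_length; unfold w; now rewrite !unpack_length. }
        destruct (decode_encode T K (Some (map (min T) (add_vec w (unpack (S T) K q)))))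
          as [Dp Lp]; auto.
        { intros ? [= <-]. apply map_min_Forall. }
        set (p := encode T K _) in *. apply decode_Some in Dp as Dp'. destruct Dp' as [Lp' Ep].
        fold inf in Lp, Lp'.
        exists p, q. split; [lia|]. split; [lia|]. split; [|split; right; auto].
        -- rewrite Lq2, La'. replace (p <=? inf) with true by (symmetry; apply Nat.leb_le; lia).
           destruct (Nat.eqb_spec p inf); [lia|]. cbn [andb].
           apply minus_digits_spec. now rewrite <- Ep.
        (* The sums of [w] with [y] and with the truncation of [y] have the same truncation. *)
        -- rewrite Dp. revert Hx. apply SA. rewrite map_min_idem, <- Eq.
           clear. revert y. induction w as [|c w IH]; intros [|b y]; cbn; auto.
           f_equal; [lia | apply IH].
      * injection E as E. symmetry in E. apply decode_None in E. fold inf in E.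
        exists inf, q. split; [lia|]. split; [lia|]. split; [|split; right; auto].
        -- rewrite Lq2, Nat.leb_refl, Nat.eqb_refl. cbn [andb]. apply Nat.eqb_eq. lia.
        -- unfold decode. fold inf. now rewrite Nat.ltb_irrefl.
Qed.

(** * Membership as a game, and its depth-first search *)

(* A position [(i, a, b)] with [b = num_codes] queries the point [a] at gate [i];
   otherwise gate [i] is binary or an input and [(a, b)] are its proposed
   operands, of which the opponent may challenge one. *)
Definition pos := (nat * nat * nat)%type.

(** A move is a number: at a query it packs the two proposed operands in base [W], at a proposal 0
    or 1 selects the operand to challenge. Operand codes are below [W], so [b = W] is free to mark
    queries. A complement gate forwards the query in one move, which leaves it to the other
    player. *)
Definition child (T K : nat) (gs : list gate) (z : pos) (m : nat) : option pos :=
  let '(i, a, b) := z in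
  let W := num_codes T K in
  let g := nth i gs (GInput None) in
  if b =? W then
    match g with
    | GCompl j => if m =? 0 then Some (j, a, W) else None
    | _ => if rel T K g a (m / W) (m mod W) then Some (i, m / W, m mod W) else None
    end
  else
    match g with
    | GBin _ j1 j2 =>
        if m =? 0 then if a =? skip_code T K then None else Some (j1, a, W)
        else if m =? 1 then if b =? skip_code T K then None else Some (j2, b, W)
        else None
    | _ => None
    end.

(** Normal play: a player without a move loses. The fuel [d] has to exceed the length of every play
    for the value to be the true one. *)
Fixpoint wins (next : pos -> nat -> option pos) (M d : nat) (z : pos) : bool :=
  match d with
  | 0 => false
  | S d' =>
      existsb (fun m => match next z m with Some z' => negb (wins next M d' z') | None => false end)
        (seq 0 M)
  end.

Definition refuted (next : pos -> nat -> option pos) (M d : nat) (z : pos) (m : nat) : Prop :=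
  exists z', next z m = Some z' /\ wins next M d z' = false.

Lemma wins_S next M d z :
  wins next M (S d) z = true <-> exists m, m < M /\ refuted next M d z m.
Proof.
  cbn [wins]. rewrite existsb_exists. split.
  - intros (m & Hm%in_seq & H). exists m. split; [lia|].
    unfold refuted. destruct (next z m) as [z'|]; [|easy]. exists z'.
    now apply negb_true_iff in H.
  - intros (m & Hm & z' & E & H). exists m. rewrite in_seq, E, H. split; [lia | easy].
Qed.

Lemma code_split W u v : v < W -> (u * W + v) / W = u /\ (u * W + v) mod W = v.
Proof.
  intros H. split.
  - rewrite Nat.div_add_l by lia. rewrite Nat.div_small by lia. lia.
  - rewrite Nat.add_comm, Nat.Div0.mod_add. now apply Nat.mod_small.
Qed.

Lemma wins_operands T K gs d i u v o j1 j2 :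
  nth i gs (GInput None) = GBin o j1 j2 -> u < num_codes T K -> v < num_codes T K ->
  let M := num_codes T K * num_codes T K in
  wins (child T K gs) M (S d) (i, u, v) = false <->
  (u = skip_code T K \/ wins (child T K gs) M d (j1, u, num_codes T K) = true) /\
  (v = skip_code T K \/ wins (child T K gs) M d (j2, v, num_codes T K) = true).
Proof.
  intros Eg Hu Hv M.
  (* Both challenges, 0 and 1, must be among the moves searched. *)
  assert (HM : 2 <= M) by (unfold M, num_codes; nia).
  rewrite <- not_true_iff_false, wins_S.
  assert (R : forall m, refuted (child T K gs) M d (i, u, v) m <->
     (m = 0 /\ u <> skip_code T K /\ wins (child T K gs) M d (j1, u, num_codes T K) = false)
     \/ (m = 1 /\ v <> skip_code T K /\ wins (child T K gs) M d (j2, v, num_codes T K) = false)).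
  { intros m. unfold refuted, child at 1. rewrite Eg.
    destruct (Nat.eqb_spec v (num_codes T K)); [lia|].
    destruct (Nat.eqb_spec m 0) as [-> |]; [|destruct (Nat.eqb_spec m 1) as [-> |]].
    - destruct (Nat.eqb_spec u (skip_code T K)).
      + split; [now intros (? & ? & ?) | lia].
      + split; [|intros [(_ & _ & H) | ?]; [eauto | lia]].
        intros (z' & [= <-] & H). auto.
    - destruct (Nat.eqb_spec v (skip_code T K)).
      + split; [now intros (? & ? & ?) | lia].
      + split; [|intros [? | (_ & _ & H)]; [lia | eauto]].
        intros (z' & [= <-] & H). auto.
    - split; [now intros (? & ? & ?) | lia]. }
  setoid_rewrite R.
  destruct (wins (child T K gs) M d (j1, u, num_codes T K)) eqn:E1,
    (wins (child T K gs) M d (j2, v, num_codes T K)) eqn:E2;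
  destruct (Nat.eq_dec u (skip_code T K)), (Nat.eq_dec v (skip_code T K)); split;
  try (intros _; auto; fail).
  all: try (intros _ (m & _ & [(_ & ? & ?) | (_ & ? & ?)]); congruence).
  all: try (intros H; exfalso; apply H; exists 0; split; [lia | left; auto]; fail).
  all: try (intros H; exfalso; apply H; exists 1; split; [lia | right; auto]; fail).
  all: intros [[?|?] [?|?]]; congruence.
Qed.

Lemma encode_eq T K e a :
  valid K e -> (forall v, e = Some v -> Forall (fun x => x <= T) v) -> a <= inf_code T K ->
  a = encode T K e <-> decode T K a = e.
Proof.
  intros He HT Ha. split.
  - intros ->. now apply decode_encode.
  - intros <-. symmetry. now apply encode_decode.
Qed.

(** Each gate costs at most two moves, a proposal and a challenge, hence the factor 2 in the game
    fuel [d]. The semantic fuel [f] is bounded below so that it does not run out, and above so that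
    the threshold [T0 * 2 ^ f] stays within [T]. *)
Lemma wins_gate T0 T K gs :
  inputs_ok K T0 gs -> T0 * 2 ^ length gs <= T ->
  (forall i, i < length gs -> wf_gate K (length gs) i (nth i gs (GInput None))) ->
  forall f i d a, i < length gs -> a <= inf_code T K ->
  length gs - i <= f -> f <= length gs -> 2 * (length gs - i) <= d ->
  wins (child T K gs) (num_codes T K * num_codes T K) d (i, a, num_codes T K) = true <->
  gate_sem K gs f i (decode T K a).
Proof.
  intros Hin HT Hwf. set (M := num_codes T K * num_codes T K).
  set (W := num_codes T K) in *.
  assert (HW : inf_code T K + 2 = W) by (unfold W, num_codes; lia).
  assert (HM : W <= M) by (unfold M; nia).
  assert (Hp : forall f, f <= length gs -> 1 <= 2 ^ f <= 2 ^ length gs).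
  { intros f Hf. split; [apply Nat.neq_0_lt_0, Nat.pow_nonzero; lia|].
    apply Nat.pow_le_mono_r; lia. }
  induction f as [|f IH]; intros i d a Hi Ha Hf Hf' Hd; [lia|].
  destruct d as [|[|d]]; [lia | lia |].
  pose proof (Hwf i Hi) as Hg. rewrite wins_S. cbn [gate_sem].
  assert (Hsplit : forall m, m < M -> m / W < W /\ m mod W < W).
  { intros m Hm. split; [apply Nat.Div0.div_lt_upper_bound; easy|].
    apply Nat.mod_upper_bound. lia. }
  assert (Hjoin : forall u v, u < W -> v < W -> u * W + v < M) by (unfold M; nia).
  destruct (nth i gs (GInput None)) as [e | j | o j1 j2] eqn:Eg; cbn [wf_gate] in Hg.
  - destruct (Hin i e Eg) as [Ve Ue].
    assert (Ue' : forall v, e = Some v -> Forall (fun x => x <= T) v).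
    { intros v E. specialize (Ue v E). revert Ue. apply Forall_impl. intros x Hx.
      specialize (Hp (length gs)). nia. }
    unfold set_single. rewrite <- (encode_eq T K e a) by easy. split.
    + intros (m & Hm & z' & E & _). unfold child in E. fold W in E.
      rewrite Nat.eqb_refl, Eg in E. unfold rel in E.
      destruct (Nat.eqb_spec a (encode T K e)); [easy|].
      now rewrite andb_false_r in E.
    + intros E. exists (skip_code T K * W + skip_code T K).
      unfold skip_code. split; [apply Hjoin; lia|].
      destruct (code_split W (1 + inf_code T K) (1 + inf_code T K)) as [E1 E2]; [lia|].
      exists (i, skip_code T K, skip_code T K). split.
      * unfold child. fold W. rewrite Nat.eqb_refl, Eg, E1, E2. unfold rel.
        fold (skip_code T K). now rewrite !Nat.eqb_refl, E, Nat.eqb_refl.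
      * apply not_true_iff_false. rewrite wins_S. intros (m & Hm & z' & E' & _).
        unfold child in E'. fold W in E'. rewrite Eg in E'.
        destruct (Nat.eqb_spec (skip_code T K) W); [unfold skip_code in *; lia | easy].
  - assert (Hj : wins (child T K gs) M (S d) (j, a, W) = true <->
                 gate_sem K gs f j (decode T K a)) by (apply IH; lia).
    rewrite <- not_false_iff_true in Hj. unfold set_compl. rewrite <- Hj. split.
    + intros (m & Hm & z' & E & H). split; [apply decode_valid|].
      unfold child in E. fold W in E. rewrite Nat.eqb_refl, Eg in E.
      destruct (m =? 0); [|easy]. injection E as <-. auto.
    + intros [_ H]. exists 0. split; [lia|]. exists (j, a, W). split.
      * unfold child. fold W. now rewrite Nat.eqb_refl, Eg.
      * destruct (wins (child T K gs) M (S d) (j, a, W)); [|easy]. exfalso. now apply H.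
  - assert (Sat : forall j, saturated T (gate_sem K gs f j)).
    { intros j. apply (saturated_mono (T0 * 2 ^ f)); [|now apply gate_sem_saturated].
      specialize (Hp f ltac:(lia)). nia. }
    rewrite <- (rel_spec T K o j1 j2)
      by (eauto using gate_sem_valid).
    assert (Hc : forall u j, i < j < length gs -> u < W ->
      holds_or_skip T K (gate_sem K gs f j) u <->
      (u = skip_code T K \/ wins (child T K gs) M d (j, u, W) = true)).
    { intros u j Hj Hu. unfold holds_or_skip. split; (intros [H | H]; [left; auto|]).
      - destruct (Nat.eq_dec u (skip_code T K)) as [|Hn]; [auto|]. right.
        unfold skip_code in Hn. apply IH; auto; lia.
      - destruct (Nat.eq_dec u (skip_code T K)) as [|Hn]; [auto|]. right.
        unfold skip_code in Hn. revert H. apply IH; auto; lia. }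
    split.
    + intros (m & Hm & z' & E & H). destruct (Hsplit m Hm) as [Hu Hv].
      unfold child in E. fold W in E. rewrite Nat.eqb_refl, Eg in E.
      destruct (rel T K (GBin o j1 j2) a (m / W) (m mod W)) eqn:Er; [|easy].
      injection E as <-. apply (wins_operands T K gs d i _ _ o j1 j2 Eg Hu Hv) in H as [H1 H2].
      exists (m / W), (m mod W). repeat split; auto; apply Hc; easy.
    + intros (u & v & Hu & Hv & Er & H1 & H2). fold W in Hu, Hv.
      exists (u * W + v). split; [auto|].
      destruct (code_split W u v Hv) as [E1 E2].
      exists (i, u, v). split.
      * unfold child. fold W. now rewrite Nat.eqb_refl, Eg, E1, E2, Er.
      * apply (wins_operands T K gs d i _ _ o j1 j2 Eg Hu Hv).
        split; apply Hc; easy.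
Qed.

(** * Depth-first search with an explicit stack *)

Definition frame := (pos * nat)%type.

(* Depth-first search. When the moves of the top position are exhausted it is
   lost, so the position below it is won, so the move leading to that one
   failed: two frames are popped at once. *)
Definition search_step (next : pos -> nat -> option pos) (M : nat) (st : list frame)
  : list frame + bool :=
  match st with
  | [] => inr true
  | (z, m) :: st' =>
      if m <? M then
        match next z m with
        | Some z' => inl ((z', 0) :: (z, m) :: st')
        | None => inl ((z, S m) :: st')
        end
      else
        match st' with
        | [] => inr false
        | [_] => inr true
        | _ :: (z2, m2) :: st2 => inl ((z2, S m2) :: st2)
        end
  end.

Inductive search (next : pos -> nat -> option pos) (M : nat) : list frame -> bool -> Prop :=
| search_done st w : search_step next M st = inr w -> search next M st w
| search_more st st' w : search_step next M st = inl st' -> search next M st' w ->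
    search next M st w.

(** The continuation of the search once the frame above [st] is decided with outcome [b]. It lets
    the correctness of a subtree search be stated for an arbitrary stack below it. *)
Definition resume (next : pos -> nat -> option pos) (M : nat) (b : bool) (st : list frame)
  (w : bool) : Prop :=
  match b, st with
  | true, [] => w = true
  | true, (z, m) :: st' => search next M ((z, S m) :: st') w
  | false, [] => w = false
  | false, [_] => w = true
  | false, _ :: (z, m) :: st' => search next M ((z, S m) :: st') w
  end.

(** Outer induction on the depth, inner induction on the number of moves left in the top frame; the
    [existsb] ranges over just these moves. As [search] is inductive, this also proves that the
    search terminates. *)
Lemma search_wins next M (rank : pos -> nat) :
  (forall z m z', m < M -> next z m = Some z' -> rank z' < rank z) ->
  forall d z m st w, rank z < d -> m <= M ->
  resume next M (existsb (fun m => match next z m with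
     Some z' => negb (wins next M (pred d) z') | None => false end) (seq m (M - m))) st w ->
  search next M ((z, m) :: st) w.
Proof.
  intros Hrank. induction d as [|d IHd]; [lia|]. intros z m st w Hd. cbn [pred].
  remember (M - m) as n eqn:En. revert m En.
  induction n as [|n IHn]; intros m En Hm Hres.
  - cbn [seq existsb] in Hres.
    assert (Hs : m <? M = false) by (apply Nat.ltb_ge; lia).
    destruct st as [|f1 [|[z2 m2] st2]]; cbn [resume] in Hres.
    + apply search_done. cbn [search_step]. now rewrite Hs, Hres.
    + apply search_done. cbn [search_step]. now rewrite Hs, Hres.
    + apply search_more with ((z2, S m2) :: st2); [|easy]. cbn [search_step]. now rewrite Hs.
  - assert (Hs : m <? M = true) by (apply Nat.ltb_lt; lia).
    cbn [seq existsb] in Hres.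
    destruct (next z m) as [z'|] eqn:Ez.
    + apply search_more with ((z', 0) :: (z, m) :: st).
      { cbn [search_step]. now rewrite Hs, Ez. }
      pose proof (Hrank z m z' ltac:(lia) Ez) as Hr.
      destruct d as [|d]; [lia|].
      apply IHd; [lia | lia |].
      rewrite Nat.sub_0_r. change (existsb _ _) with (wins next M (S d) z').
      destruct (wins next M (S d) z'); cbn [negb orb resume] in *.
      * apply IHn; [lia | lia | easy].
      * destruct st as [|f1 st]; exact Hres.
    + apply search_more with ((z, S m) :: st).
      { cbn [search_step]. now rewrite Hs, Ez. }
      apply IHn; [lia | lia | easy].
Qed.

(** Two plies per gate: a query ranks one above the proposals at the same gate, and these above all
    queries at later gates. *)
Definition rank (T K n : nat) (z : pos) : nat :=
  let '(i, _, b) := z in 2 * (n - i) + Nat.b2n (b =? num_codes T K).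

Definition pos_ok (T K : nat) (gs : list gate) (z : pos) : Prop :=
  let '(i, a, b) := z in
  i < length gs /\ a < num_codes T K /\ b <= num_codes T K /\
  (b = num_codes T K -> a <= inf_code T K).

Lemma child_rank T K gs z m z' :
  (forall i, i < length gs -> wf_gate K (length gs) i (nth i gs (GInput None))) ->
  m < num_codes T K * num_codes T K -> child T K gs z m = Some z' ->
  rank T K (length gs) z' < rank T K (length gs) z.
Proof.
  intros Hwf Hm. destruct z as [[i a] b]. unfold child.
  assert (Hv : m mod num_codes T K < num_codes T K)
    by (apply Nat.mod_upper_bound; unfold num_codes; lia).
  revert Hv. generalize (m / num_codes T K) (m mod num_codes T K). intros u v Hv.
  assert (Hw : wf_gate K (length gs) i (nth i gs (GInput None))).
  { destruct (le_lt_dec (length gs) i); [now rewrite nth_overflow | auto]. }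
  destruct (Nat.eqb_spec b (num_codes T K)) as [-> | Hne].
  - destruct (nth i gs (GInput None)) as [e | j | o j1 j2]; cbn [wf_gate] in Hw.
    2: { destruct (m =? 0); [|easy]. intros [= <-]. cbn [rank].
         rewrite Nat.eqb_refl. cbn [Nat.b2n]. lia. }
    all: destruct (rel _ _ _ _ _ _); [|easy]; intros [= <-]; cbn [rank];
      rewrite Nat.eqb_refl; destruct (Nat.eqb_spec v (num_codes T K)); cbn [Nat.b2n]; lia.
  - apply Nat.eqb_neq in Hne.
    destruct (nth i gs (GInput None)) as [e | j | o j1 j2]; cbn [wf_gate] in Hw; try easy.
    destruct (m =? 0); [|destruct (m =? 1); [|easy]];
      [destruct (a =? _) | destruct (b =? skip_code T K)]; try easy;
      intros [= <-]; cbn [rank]; rewrite Nat.eqb_refl, Hne; cbn [Nat.b2n]; lia.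
Qed.

Lemma child_ok T K gs z m z' :
  (forall i, i < length gs -> wf_gate K (length gs) i (nth i gs (GInput None))) ->
  m < num_codes T K * num_codes T K ->
  pos_ok T K gs z -> child T K gs z m = Some z' -> pos_ok T K gs z'.
Proof.
  intros Hwf Hm. destruct z as [[i a] b]. cbn [pos_ok]. intros (Hi & Ha & Hb & Hab).
  specialize (Hwf i Hi). unfold child.
  assert (Hsplit : m / num_codes T K < num_codes T K /\ m mod num_codes T K < num_codes T K).
  { split; [apply Nat.Div0.div_lt_upper_bound; easy|].
    apply Nat.mod_upper_bound. unfold num_codes. lia. }
  revert Hsplit. generalize (m / num_codes T K) (m mod num_codes T K). intros u v [Hu Hv].
  assert (Hpt : forall c, c < num_codes T K -> c <> skip_code T K -> c <= inf_code T K)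
    by (unfold num_codes, skip_code; lia).
  destruct (Nat.eqb_spec b (num_codes T K)) as [-> | Hne].
  - destruct (nth i gs (GInput None)) as [e | j | o j1 j2]; cbn [wf_gate] in Hwf.
    2: { destruct (m =? 0); [|easy]. intros [= <-]. cbn [pos_ok]. repeat split; auto; lia. }
    all: destruct (rel _ _ _ _ _ _); [|easy]; intros [= <-];
      cbn [pos_ok]; repeat split; lia.
  - destruct (nth i gs (GInput None)) as [e | j | o j1 j2]; cbn [wf_gate] in Hwf; try easy.
    destruct (m =? 0); [|destruct (m =? 1); [|easy]].
    + destruct (Nat.eqb_spec a (skip_code T K)); [easy|]. intros [= <-]. cbn [pos_ok].
      repeat split; auto; lia.
    + destruct (Nat.eqb_spec b (skip_code T K)); [easy|]. intros [= <-]. cbn [pos_ok].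
      assert (b < num_codes T K) by lia. repeat split; auto; lia.
Qed.

(* The heights of the frames bound the stack by the rank of the root. *)
Fixpoint stack_ok (T K : nat) (gs : list gate) (C : nat) (st : list frame) : Prop :=
  match st with
  | [] => True
  | (z, m) :: st' =>
      pos_ok T K gs z /\ m <= num_codes T K * num_codes T K /\
      rank T K (length gs) z + length st' <= C /\ stack_ok T K gs C st'
  end.

(** A frame below the top waits for the result of an actual move, so its counter is strictly below
    the number of moves; this leaves room for the increment when two frames are popped. *)
Lemma search_step_ok T K gs C st st' :
  (forall i, i < length gs -> wf_gate K (length gs) i (nth i gs (GInput None))) ->
  (forall z m st1, st = (z, m) :: st1 -> forall f, In f st1 -> snd f < num_codes T K * num_codes T K) ->
  stack_ok T K gs C st ->
  search_step (child T K gs) (num_codes T K * num_codes T K) st = inl st' ->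
  stack_ok T K gs C st' /\
  (forall z m st1, st' = (z, m) :: st1 -> forall f, In f st1 -> snd f < num_codes T K * num_codes T K).
Proof.
  intros Hwf. set (M := num_codes T K * num_codes T K).
  destruct st as [|[z m] st]; [easy|]. cbn [stack_ok search_step].
  intros Hlt (Hz & Hm & Hr & Hst). specialize (Hlt z m st eq_refl).
  destruct (Nat.ltb_spec m M) as [HmM | HmM].
  - destruct (child T K gs z m) as [z'|] eqn:Ez; intros [= <-].
    + pose proof (child_ok _ _ _ _ _ _ Hwf HmM Hz Ez) as Hz'.
      pose proof (child_rank _ _ _ _ _ _ Hwf HmM Ez) as Hr'.
      cbn [stack_ok length]. split; [repeat split; auto; lia|].
      intros ? ? ? [= <- <- <-] f [<- | Hf]; [exact HmM | now apply Hlt].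
    + cbn [stack_ok]. split; [repeat split; auto; lia|].
      intros ? ? ? [= <- <- <-] f Hf. now apply Hlt.
  - destruct st as [|[z1 m1] [|[z2 m2] st2]]; try discriminate. intros [= <-].
    cbn [stack_ok length] in *. destruct Hst as (_ & _ & _ & Hz2 & Hm2 & Hr2 & Hst2).
    pose proof (Hlt (z2, m2) (or_intror (or_introl eq_refl))) as H2. cbn in H2.
    split; [repeat split; auto; lia|].
    intros ? ? ? [= <- <- <-] f Hf. apply Hlt. now right; right.
Qed.

(** * Parsing instances *)

(** The accumulator holds the digits of the number being read. A digit 0 on accumulator 0 is a
    leading zero and is rejected: the language contains exact encodings only, so parsing must be a
    true inverse. *)
Fixpoint parse (x : list bool) (acc : nat) : option (list nat) :=
  match x with
  | [] => if acc =? 0 then Some [] else None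
  | false :: d :: x' => if acc + Nat.b2n d =? 0 then None else parse x' (2 * acc + Nat.b2n d)
  | true :: true :: x' => option_map (cons acc) (parse x' 0)
  | _ => None
  end.

Definition spread (ds : list bool) : list bool := flat_map (fun d => [false; d]) ds.

Lemma spread_app ds ds' : spread (ds ++ ds') = spread ds ++ spread ds'.
Proof. apply flat_map_app. Qed.

Lemma nat_bits_double n b :
  n + Nat.b2n b <> 0 -> nat_bits (2 * n + Nat.b2n b) = nat_bits n ++ [b].
Proof.
  intros H. unfold nat_bits.
  rewrite Nnat.Nat2N.inj_add, Nnat.Nat2N.inj_mul.
  destruct n as [|n].
  - destruct b; [easy | cbn in H; lia].
  - cbn [N.of_nat]. destruct b; reflexivity.
Qed.

Lemma list_ind2 {A} (P : list A -> Prop) :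
  P [] -> (forall a, P [a]) -> (forall a b l, P l -> P (a :: b :: l)) -> forall l, P l.
Proof.
  intros H0 H1 H2 l. enough (P l /\ forall a, P (a :: l)) by tauto.
  induction l as [|b l [IH1 IH2]]; split; auto.
Qed.

Lemma parse_sound x : forall acc l,
  parse x acc = Some l -> spread (nat_bits acc) ++ x = enc_nats l.
Proof.
  induction x as [| a | a d x IH] using list_ind2; intros acc l; cbn [parse].
  - destruct (Nat.eqb_spec acc 0) as [-> |]; [|easy]. now intros [= <-].
  - now destruct a.
  - destruct a.
    + destruct d; [|easy]. destruct (parse x 0) as [l'|] eqn:E; [|easy].
      intros [= <-]. apply IH in E. unfold enc_nats in *. cbn [flat_map]. rewrite <- E.
      unfold enc_nat, spread. cbn. now rewrite <- app_assoc.
    + destruct (Nat.eqb_spec (acc + Nat.b2n d) 0) as [|Hne]; [easy|].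
      intros E%IH. rewrite <- E, nat_bits_double, spread_app by easy.
      cbn. now rewrite <- app_assoc.
Qed.

Lemma parse_spread n : forall x, parse (spread (nat_bits n) ++ x) 0 = parse x n.
Proof.
  induction n as [n IH] using lt_wf_ind. intros x.
  destruct (Nat.eq_dec n 0) as [-> | Hn]; [easy|].
  pose proof (Nat.div_mod_eq n 2) as Hd. pose proof (Nat.mod_upper_bound n 2 ltac:(lia)).
  set (b := n mod 2 =? 1). assert (Hb : Nat.b2n b = n mod 2).
  { unfold b. destruct (n mod 2) as [|[|]]; cbn; lia. }
  rewrite Hd, <- Hb, nat_bits_double, spread_app, <- app_assoc by lia.
  rewrite IH by lia. cbn [spread flat_map app parse].
  destruct (Nat.eqb_spec (n / 2 + Nat.b2n b) 0); [lia | reflexivity].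
Qed.

Lemma parse_complete l : parse (enc_nats l) 0 = Some l.
Proof.
  induction l as [|a l IH]; [easy|].
  change (enc_nats (a :: l)) with (enc_nat a ++ enc_nats l). unfold enc_nat.
  rewrite <- app_assoc. fold (spread (nat_bits a)). rewrite parse_spread.
  cbn [app parse]. now rewrite IH.
Qed.

Definition take_gate (k : nat) (l : list nat) : option (gate * list nat) :=
  match l with
  | 0 :: 0 :: r => Some (GInput None, r)
  | 0 :: 1 :: r =>
      if k <=? length r then Some (GInput (Some (firstn k r)), skipn k r) else None
  | 1 :: j :: r => Some (GCompl j, r)
  | 2 :: j1 :: j2 :: r => Some (GBin OUnion j1 j2, r)
  | 3 :: j1 :: j2 :: r => Some (GBin OInter j1 j2, r)
  | 4 :: j1 :: j2 :: r => Some (GBin OPlus j1 j2, r)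
  | 5 :: j1 :: j2 :: r => Some (GBin OMinus j1 j2, r)
  | _ => None
  end.

Definition input_valid (k : nat) (g : gate) : Prop :=
  match g with GInput e => valid k e | _ => True end.

Lemma take_gate_sound k l g r :
  take_gate k l = Some (g, r) -> l = gate_code g ++ r /\ input_valid k g.
Proof.
  unfold take_gate.
  repeat match goal with
  | |- match ?x with _ => _ end = _ -> _ => destruct x eqn:?; try discriminate
  | |- (if ?x then _ else _) = _ -> _ => destruct x eqn:?; try discriminate
  end; intros [= <- <-]; cbn; auto.
  rewrite firstn_skipn. split; [easy|]. rewrite length_firstn.
  match goal with H : (k <=? _) = true |- _ => apply Nat.leb_le in H; lia end.
Qed.

Lemma take_gate_complete k g r : input_valid k g -> take_gate k (gate_code g ++ r) = Some (g, r).
Proof.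
  destruct g as [[v|] | j | o j1 j2]; intros Hv; try reflexivity.
  - cbn in *. subst k. rewrite length_app.
    replace (length v <=? length v + length r) with true by (symmetry; apply Nat.leb_le; lia).
    rewrite firstn_app, skipn_app, Nat.sub_diag, firstn_all, skipn_all. cbn.
    now rewrite app_nil_r.
  - now destruct o.
Qed.

Definition gate_okb (n i : nat) (g : gate) : bool :=
  match g with
  | GInput _ => true
  | GCompl j => (i <? j) && (j <? n)
  | GBin _ j1 j2 => (i <? j1) && (j1 <? n) && ((i <? j2) && (j2 <? n))
  end.

Lemma wf_gate_iff k n i g :
  wf_gate k n i g <-> input_valid k g /\ gate_okb n i g = true.
Proof.
  destruct g as [e | j | o j1 j2]; cbn [wf_gate input_valid gate_okb];
    rewrite ?andb_true_iff, ?Nat.ltb_lt; intuition auto.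
Qed.

(* [m] gates remain, so the next one has index [n - m]. *)
Fixpoint parse_gates (k n m : nat) (l : list nat) : option (list gate * list nat) :=
  match m with
  | 0 => Some ([], l)
  | S m' =>
      match take_gate k l with
      | Some (g, r) =>
          if gate_okb n (n - m) g then
            option_map (fun p => (g :: fst p, snd p)) (parse_gates k n m' r)
          else None
      | None => None
      end
  end.

Lemma parse_gates_sound k n m : forall l gs r, m <= n -> parse_gates k n m l = Some (gs, r) ->
  l = flat_map gate_code gs ++ r /\ length gs = m /\
  forall i, i < m -> wf_gate k n (n - m + i) (nth i gs (GInput None)).
Proof.
  induction m as [|m IH]; intros l gs r Hm; cbn [parse_gates].
  - intros [= <- <-]. repeat split; auto. lia.
  - destruct (take_gate k l) as [[g l']|] eqn:Et; [|easy].
    destruct (gate_okb n (n - S m) g) eqn:Eg; [|easy].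
    destruct (parse_gates k n m l') as [[gs' r']|] eqn:Ep; [|easy].
    intros [= <- <-]. cbn [fst snd]. apply take_gate_sound in Et as [-> Hv].
    destruct (IH l' gs' r' ltac:(lia) Ep) as (-> & Hl & Hw).
    cbn [flat_map length]. rewrite <- app_assoc. repeat split; [lia|].
    intros [|i] Hi; cbn [nth].
    + rewrite Nat.add_0_r. now apply wf_gate_iff.
    + replace (n - S m + S i) with (n - m + i) by lia. apply Hw. lia.
Qed.

Lemma parse_gates_complete k n m : forall gs r, m <= n -> length gs = m ->
  (forall i, i < m -> wf_gate k n (n - m + i) (nth i gs (GInput None))) ->
  parse_gates k n m (flat_map gate_code gs ++ r) = Some (gs, r).
Proof.
  induction m as [|m IH]; intros gs r Hm Hl Hw.
  - now apply length_zero_iff_nil in Hl as ->.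
  - destruct gs as [|g gs]; [discriminate|]. injection Hl as Hl.
    cbn [parse_gates flat_map]. rewrite <- app_assoc.
    pose proof (Hw 0 ltac:(lia)) as H0. cbn [nth] in H0. rewrite Nat.add_0_r in H0.
    apply wf_gate_iff in H0 as [Hv Ho]. rewrite take_gate_complete, Ho by easy.
    rewrite IH; [reflexivity | lia | easy |].
    intros i Hi. replace (n - m + i) with (n - S m + S i) by lia.
    apply (Hw (S i)). lia.
Qed.

Definition parse_point (k : nat) (l : list nat) : option elt :=
  match l with
  | [0] => Some None
  | 1 :: v => if length v =? k then Some (Some v) else None
  | _ => None
  end.

Lemma parse_point_spec k l b : parse_point k l = Some b <-> l = elt_code b /\ valid k b.
Proof.
  split.
  - destruct l as [|[|[|a]] l]; try discriminate; cbn.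
    + destruct l; [|discriminate]. now intros [= <-].
    + destruct (Nat.eqb_spec (length l) k); [|discriminate]. now intros [= <-].
  - intros [-> Hv]. destruct b as [v|]; [|easy]. cbn in *. subst k. now rewrite Nat.eqb_refl.
Qed.

Definition decode_instance (l : list nat) : option (nat * circuit * elt) :=
  match l with
  | k :: n :: out :: r =>
      if (1 <=? k) && (out <? n) then
        match parse_gates k n n r with
        | Some (gs, r') =>
            option_map (fun b => (k, mkCircuit gs out, b)) (parse_point k r')
        | None => None
        end
      else None
  | _ => None
  end.

Lemma decode_instance_spec l k C b :
  decode_instance l = Some (k, C, b) <->
  l = instance_code k C b /\ wf_circuit k C /\ valid k b.
Proof.
  unfold wf_circuit, instance_code. split.
  - destruct l as [|k' [|n [|out r]]]; try discriminate. cbn [decode_instance].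
    destruct (Nat.leb_spec 1 k') as [Hk|]; [|easy].
    destruct (Nat.ltb_spec out n) as [Hout|]; [|easy]. cbn [andb].
    destruct (parse_gates k' n n r) as [[gs r']|] eqn:Eg; [|easy].
    destruct (parse_point k' r') as [b'|] eqn:Eb; [|easy].
    intros [= <- <- <-]. cbn [c_gates c_out].
    apply parse_point_spec in Eb as [-> Hb].
    apply parse_gates_sound in Eg as (-> & Hl & Hw); [|lia]. subst n.
    rewrite Nat.sub_diag in Hw. auto.
  - intros (-> & (Hk & Hout & Hw) & Hb). destruct C as [gs out]. cbn [c_gates c_out app] in *.
    cbn [decode_instance]. apply Nat.leb_le in Hk as ->. apply Nat.ltb_lt in Hout as ->.
    cbn [andb]. rewrite parse_gates_complete; [|lia | easy | now rewrite Nat.sub_diag].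
    now rewrite (proj2 (parse_point_spec k (elt_code b) b)).
Qed.

Lemma MC_star_spec x :
  MC_star x <-> exists l k C b,
    parse x 0 = Some l /\ decode_instance l = Some (k, C, b) /\ circ_sem k C b.
Proof.
  unfold MC_star, enc_instance. split.
  - intros (k & C & b & Hw & Hv & -> & Hs). exists (instance_code k C b), k, C, b.
    split; [apply parse_complete|]. split; [now apply decode_instance_spec | easy].
  - intros (l & k & C & b & Hp & (-> & Hw & Hv)%decode_instance_spec & Hs).
    exists k, C, b. repeat split; auto; try apply Hw. now apply parse_sound in Hp.
Qed.

(* The dimension is written in binary and may be exponential, but then the
   instance mentions no finite point and dimension 1 gives the same answer. *)
Definition reduced_dim (k len : nat) : nat := if k <=? len then k else 1.

Lemma length_flat_map_In {A B} (f : A -> list B) l a :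
  In a l -> length (f a) <= length (flat_map f l).
Proof.
  induction l as [|a' l IH]; [easy|]. cbn. rewrite length_app.
  intros [-> | H]; [lia | specialize (IH H); lia].
Qed.

Lemma reduced_dim_spec l k C b K :
  decode_instance l = Some (k, C, b) -> K = reduced_dim k (length l) ->
  1 <= K /\ wf_circuit K C /\ valid K b /\ (circ_sem k C b <-> circ_sem K C b) /\
  (K = k \/ b = None /\ forall i e, nth i (c_gates C) (GInput None) = GInput e -> e = None).
Proof.
  intros (-> & (Hk & Hout & Hw) & Hb)%decode_instance_spec ->. unfold reduced_dim.
  set (len := length (instance_code k C b)).
  destruct (Nat.leb_spec k len) as [Hle | Hlt].
  { repeat split; auto; try lia; apply Hw; easy. }
  assert (Hg : forall i e, nth i (c_gates C) (GInput None) = GInput e -> e = None).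
  { intros i e E. destruct e as [v|]; [exfalso | easy].
    destruct (le_lt_dec (length (c_gates C)) i) as [Hi | Hi];
      [rewrite nth_overflow in E by easy; discriminate|].
    pose proof (Hw i Hi) as Hv. rewrite E in Hv. cbn in Hv.
    pose proof (nth_In (c_gates C) (GInput None) Hi) as HI. rewrite E in HI.
    apply (length_flat_map_In gate_code) in HI. cbn in HI.
    unfold len, instance_code in Hlt. rewrite !length_app in Hlt. lia. }
  assert (Hbn : b = None).
  { destruct b as [v|]; [exfalso | easy]. cbn in Hb.
    unfold len, instance_code in Hlt. rewrite !length_app in Hlt. cbn in Hlt. lia. }
  subst b. repeat split; auto.
  - intros i Hi. specialize (Hw i Hi).
    destruct (nth i (c_gates C) (GInput None)) as [e | |] eqn:E; auto.
    now rewrite (Hg i e E).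
  - apply gate_sem_dimension; easy.
  - apply gate_sem_dimension; easy.
Qed.

Lemma pos_bits_bound p : Pos.to_nat p < 2 ^ length (pos_bits p).
Proof.
  induction p; cbn [pos_bits]; rewrite ?length_app, ?Pos2Nat.inj_xI, ?Pos2Nat.inj_xO;
    cbn [length]; rewrite ?Nat.add_1_r, ?Nat.pow_succ_r'; try lia.
  all: cbn; lia.
Qed.

(** This is where the input length controls everything else: the number of tokens, hence of gates,
    and the size of each entry. *)
Lemma enc_nats_bound l :
  length l <= length (enc_nats l) /\ Forall (fun a => a < 2 ^ length (enc_nats l)) l.
Proof.
  induction l as [|a l [IH1 IH2]]; [split; auto|].
  change (enc_nats (a :: l)) with (enc_nat a ++ enc_nats l). rewrite length_app.
  assert (Hs : forall ds, length (spread ds) = 2 * length ds).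
  { induction ds as [|d ds IHd]; [easy|].
    change (spread (d :: ds)) with ([false; d] ++ spread ds).
    rewrite length_app. cbn [length]. lia. }
  assert (Ha : a < 2 ^ length (nat_bits a)).
  { unfold nat_bits. destruct a as [|a]; [cbn; lia|]. cbn [N.of_nat].
    rewrite <- (SuccNat2Pos.id_succ a) at 1. apply pos_bits_bound. }
  assert (He : length (enc_nat a) = 2 * length (nat_bits a) + 2).
  { unfold enc_nat. rewrite length_app. fold (spread (nat_bits a)). now rewrite Hs. }
  cbn [length]. split; [lia|]. constructor.
  - eapply Nat.lt_le_trans; [exact Ha|]. apply Nat.pow_le_mono_r; lia.
  - revert IH2. apply Forall_impl. intros c Hc. eapply Nat.lt_le_trans; [exact Hc|].
    apply Nat.pow_le_mono_r; lia.
Qed.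

(** * The program *)

Definition wp (B : nat) (c : cmd) (Q : state -> Prop) (s : state) : Prop :=
  exists s', exec B c s s' /\ Q s'.

Lemma wp_conseq B c (Q Q' : state -> Prop) s :
  wp B c Q s -> (forall s', Q s' -> Q' s') -> wp B c Q' s.
Proof. intros (s' & He & HQ) H. exists s'. auto. Qed.

Lemma wp_asgn B r e (Q : state -> Prop) s :
  eval_ok B s e -> Q (upd s r (eval s e)) -> wp B (Asgn r e) Q s.
Proof. intros He HQ. eexists. split; [now constructor | easy]. Qed.

Lemma wp_seq B c1 c2 Q s : wp B c1 (wp B c2 Q) s -> wp B (Seq c1 c2) Q s.
Proof.
  intros (s1 & H1 & s2 & H2 & HQ). exists s2. split; [econstructor; eauto | easy].
Qed.

Lemma wp_if B e c1 c2 Q s :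
  eval_ok B s e -> (eval s e <> 0 -> wp B c1 Q s) -> (eval s e = 0 -> wp B c2 Q s) ->
  wp B (If e c1 c2) Q s.
Proof.
  intros He H1 H2. destruct (Nat.eqb_spec (eval s e) 0) as [E | E].
  - destruct (H2 E) as (s' & Hx & HQ). exists s'. split; [|easy].
    constructor; [easy|]. now rewrite E.
  - destruct (H1 E) as (s' & Hx & HQ). exists s'. split; [|easy].
    constructor; [easy|]. now apply Nat.eqb_neq in E as ->.
Qed.

(** The invariant is indexed by a mathematical object, such as the list still to be read, and the
    measure is taken on that object instead of on the registers that encode it. *)
Lemma wp_while B e c {A : Type} (I : A -> state -> Prop) (mu : A -> nat) (Q : state -> Prop) :
  (forall a s, I a s -> eval_ok B s e) ->
  (forall a s, I a s -> eval s e <> 0 ->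
     wp B c (fun s' => exists a', mu a' < mu a /\ I a' s') s) ->
  (forall a s, I a s -> eval s e = 0 -> Q s) ->
  forall a s, I a s -> wp B (While e c) Q s.
Proof.
  intros Hok Hb HQ a. remember (mu a) as m eqn:Em. revert a Em.
  induction m as [m IH] using lt_wf_ind. intros a -> s HI.
  destruct (Nat.eq_dec (eval s e) 0) as [E | E].
  - exists s. split; [constructor; eauto | eauto].
  - destruct (Hb a s HI E) as (s1 & He1 & a' & Hmu & HI1).
    destruct (IH (mu a') Hmu a' eq_refl s1 HI1) as (s2 & He2 & HQ2).
    exists s2. split; [eapply E_while; eauto | easy].
Qed.

(** A computable frame condition: that a command preserves a register is then proved by
    [eq_refl]. *)
Fixpoint assigned (c : cmd) (r : nat) : bool :=
  match c with
  | Asgn r' _ => r =? r'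
  | Seq c1 c2 => assigned c1 r || assigned c2 r
  | If _ c1 c2 => assigned c1 r || assigned c2 r
  | While _ c => assigned c r
  end.

Definition same_except (c : cmd) (s s' : state) : Prop :=
  forall r, assigned c r = false -> s' r = s r.

Lemma exec_same B c s s' : exec B c s s' -> same_except c s s'.
Proof.
  induction 1 as [r e s Hok | c1 c2 s1 s2 s3 _ IH1 _ IH2 | e c1 c2 s s' Hok _ IH
    | e c s | e c s1 s2 s3 Hok Hz _ IH1 _ IH2]; intros i Hi; cbn in Hi.
  - unfold upd. now rewrite Hi.
  - apply orb_false_iff in Hi as [? ?]. now rewrite IH2, IH1.
  - apply orb_false_iff in Hi as [? ?]. apply IH. now destruct (eval s e =? 0).
  - reflexivity.
  - rewrite IH2, IH1 by easy. reflexivity.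
Qed.

Lemma wp_frame B c Q s : wp B c Q s -> wp B c (fun s' => Q s' /\ same_except c s s') s.
Proof. intros (s' & He & HQ). exists s'. eauto using exec_same. Qed.

Declare Scope cmd_scope.
Delimit Scope cmd_scope with cmd.
Bind Scope cmd_scope with cmd expr.

Notation "$ r" := (Var r) (at level 1, r at level 0, format "$ r") : cmd_scope.
Notation "# n" := (Const n) (at level 1, n at level 0, format "# n") : cmd_scope.
Infix "+" := (Op Add) : cmd_scope.
Infix "-" := (Op Sub) : cmd_scope.
Infix "*" := (Op Mul) : cmd_scope.
Infix "/" := (Op Div) : cmd_scope.
Infix "mod" := (Op Mod) : cmd_scope.
Notation "r <- e" := (Asgn r e) (at level 80, no associativity) : cmd_scope.
Notation "c1 ;; c2" := (Seq c1 c2) (at level 85, right associativity) : cmd_scope.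

(** Truncated subtraction provides comparisons with values 0 and 1, so that a product is a
    conjunction. *)
Definition le_expr (a b : expr) : expr := (#1 - (a - b))%cmd.
Definition lt_expr (a b : expr) : expr := (#1 - (#1 - (b - a)))%cmd.
Definition eq_expr (a b : expr) : expr := ((#1 - (a - b)) * (#1 - (b - a)))%cmd.

Infix "<=" := le_expr : cmd_scope.
Infix "<" := lt_expr : cmd_scope.
Infix "==" := eq_expr (at level 70) : cmd_scope.

Lemma eval_le s a b : eval s (a <= b)%cmd = Nat.b2n (eval s a <=? eval s b).
Proof. unfold le_expr. cbn [eval op_sem]. destruct (Nat.leb_spec (eval s a) (eval s b)); cbn [Nat.b2n]; nia. Qed.

Lemma eval_lt s a b : eval s (a < b)%cmd = Nat.b2n (eval s a <? eval s b).
Proof. unfold lt_expr. cbn [eval op_sem]. destruct (Nat.ltb_spec (eval s a) (eval s b)); cbn [Nat.b2n]; nia. Qed.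

Lemma eval_eq s a b : eval s (a == b)%cmd = Nat.b2n (eval s a =? eval s b).
Proof. unfold eq_expr. cbn [eval op_sem]. destruct (Nat.eqb_spec (eval s a) (eval s b)); cbn [Nat.b2n]; nia. Qed.

Lemma ok_le B s a b : 1 <= B -> eval_ok B s a -> eval_ok B s b -> eval_ok B s (a <= b)%cmd.
Proof. cbn. auto. Qed.

Lemma ok_lt B s a b : 1 <= B -> eval_ok B s a -> eval_ok B s b -> eval_ok B s (a < b)%cmd.
Proof. cbn. auto 7. Qed.

Lemma ok_eq B s a b : 1 <= B -> eval_ok B s a -> eval_ok B s b -> eval_ok B s (a == b)%cmd.
Proof.
  unfold eq_expr. cbn [eval_ok op_ok eval op_sem]. intros. repeat split; auto.
  rewrite <- H. change 1 with (1 * 1) at 3. apply Nat.mul_le_mono; lia.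
Qed.

Lemma b2n_and a b : Nat.b2n a * Nat.b2n b = Nat.b2n (a && b).
Proof. now destruct a, b. Qed.

Lemma b2n_neq0 b : Nat.b2n b <> 0 <-> b = true.
Proof. now destruct b. Qed.

Lemma b2n_eq0 b : Nat.b2n b = 0 <-> b = false.
Proof. now destruct b. Qed.

Ltac xeval :=
  repeat (progress cbn [eval op_sem upd Nat.eqb] in *
          || rewrite ?eval_le, ?eval_lt, ?eval_eq in *).

Ltac ok_split :=
  repeat first [apply ok_le | apply ok_lt | apply ok_eq
               | match goal with
                 | |- eval_ok _ _ (Op _ _ _) => split; [|split]
                 | |- eval_ok _ _ (Var _) => exact I
                 | |- eval_ok _ _ (Const _) => cbn [eval_ok]
                 end ];
  cbn [op_ok]; xeval.

(* For an input of length n: [rN] is 2^n, [rThr] the threshold, [rD] the base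
   [rThr + 1], [rA] the packed token list, [rG] a suffix of it, [rInf] the code
   of infinity, and [rS] the packed search stack below the current frame
   ([rgi], [rga], [rgb], [rgm]). *)
Notation rF := 0 (only parsing).
Notation rT := 1 (only parsing).
Notation rN := 2 (only parsing).
Notation rThr := 3 (only parsing).
Notation rD := 4 (only parsing).
Notation rA := 5 (only parsing).
Notation rP := 6 (only parsing).
Notation racc := 7 (only parsing).
Notation rlen := 8 (only parsing).
Notation rok := 9 (only parsing).
Notation rX := 10 (only parsing).
Notation rY := 11 (only parsing).
Notation rb0 := 12 (only parsing).
Notation rb1 := 13 (only parsing).
Notation rk := 14 (only parsing).
Notation rn := 15 (only parsing).
Notation rout := 16 (only parsing).
Notation rK := 17 (only parsing).
Notation rInf := 18 (only parsing).
Notation rW := 19 (only parsing).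
Notation rM := 20 (only parsing).
Notation rE := 21 (only parsing).
Notation rG0 := 22 (only parsing).
Notation rG := 23 (only parsing).
Notation rrem := 24 (only parsing).
Notation ri := 25 (only parsing).
Notation rc := 26 (only parsing).
Notation rf1 := 27 (only parsing).
Notation rf2 := 28 (only parsing).
Notation rQ := 29 (only parsing).
Notation rz := 30 (only parsing).
Notation rpt := 31 (only parsing).
Notation rcnt := 32 (only parsing).
Notation rS := 33 (only parsing).
Notation rh := 34 (only parsing).
Notation rgi := 35 (only parsing).
Notation rga := 36 (only parsing).
Notation rgb := 37 (only parsing).
Notation rgm := 38 (only parsing).
Notation rrun := 39 (only parsing).
Notation rres := 40 (only parsing).
Notation ru := 41 (only parsing).
Notation rv := 42 (only parsing).
Notation rokm := 43 (only parsing).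
Notation rni := 44 (only parsing).
Notation rna := 45 (only parsing).
Notation rnb := 46 (only parsing).
Notation rdu := 47 (only parsing).
Notation rdv := 48 (only parsing).
Notation rda := 49 (only parsing).

(** The value [rX] does not show unread [false] bits at its upper end, so [rY] keeps 2 to the power
    of the number of unread bits. *)
Definition parse_body : cmd := (
  rb0 <- $rX mod #2 ;;
  rX <- $rX / #2 ;;
  rb1 <- $rX mod #2 ;;
  rX <- $rX / #2 ;;
  If ($rY == #2)
    (* A single bit is left although bits come in pairs: the input is rejected and the loop is made
       to stop. *)
    (rok <- #0 ;; rY <- #1)
    (rY <- $rY / #4 ;;
     If ($rb0)
       (If ($rb1)
          (rA <- $rA + $racc * $rP ;; rP <- $rP * $rD ;; rlen <- $rlen + #1 ;; racc <- #0)
          (rok <- #0))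
       (If ($racc + $rb1)
          (racc <- #2 * $racc + $rb1)
          (rok <- #0))))%cmd.

Definition parse_cmd : cmd := (
  (* Each input cell is set in exactly one of the two tracks, so their sum is [2 ^ n - 1]. *)
  rN <- $rF + $rT + #1 ;;
  rThr <- $rN * $rN ;;
  rD <- $rThr + #1 ;;
  rA <- #0 ;; rP <- #1 ;; racc <- #0 ;; rlen <- #0 ;; rok <- #1 ;;
  rX <- $rT ;; rY <- $rN ;;
  While (#1 < $rY) parse_body ;;
  rok <- $rok * ($racc == #0))%cmd.

(* Dividing by [rQ] strips the first gate, of [rz] tokens, from [rG]. *)
Definition head_cmd : cmd := (
  rc <- $rG mod $rD ;;
  rf1 <- ($rG / $rD) mod $rD ;;
  rf2 <- ($rG / $rD / $rD) mod $rD ;;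
  If ($rc)
    (If ($rc == #1)
       (rQ <- $rD * $rD ;; rz <- #2)
       (rQ <- $rD * $rD * $rD ;; rz <- #3))
    (If ($rf1)
       (* [rInf] is [D ^ K]. If [K] is not [k], then [k] exceeds the number of tokens, so the size
          check fails and the wrong divisor does no harm. *)
       (rQ <- $rD * $rD * $rInf ;; rz <- $rk + #2)
       (rQ <- $rD * $rD ;; rz <- #2)))%cmd.

Definition header_cmd : cmd := (
  rk <- $rA mod $rD ;;
  rn <- ($rA / $rD) mod $rD ;;
  rout <- ($rA / $rD / $rD) mod $rD ;;
  rok <- (#3 <= $rlen) * ((#1 <= $rk) * ($rout < $rn)) ;;
  If ($rk <= $rlen) (rK <- $rk) (rK <- #1) ;;
  rInf <- #1 ;;
  rcnt <- $rK ;;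
  While ($rcnt) (rInf <- $rInf * $rD ;; rcnt <- $rcnt - #1) ;;
  rG0 <- $rA / $rD / $rD / $rD ;;
  rG <- $rG0 ;;
  rrem <- $rlen - #3 ;;
  ri <- #0)%cmd.

Definition validate_body : cmd := (
  head_cmd ;;
  If ($rc)
    (If ($rc == #1)
       (rok <- ($ri < $rf1) * ($rf1 < $rn))
       (rok <- ($rc <= #5) * (($ri < $rf1) * ($rf1 < $rn) * (($ri < $rf2) * ($rf2 < $rn)))))
    (rok <- $rf1 <= #1) ;;
  rok <- $rok * ($rz <= $rrem) ;;
  rG <- $rG / $rQ ;;
  rrem <- $rrem - $rz ;;
  ri <- $ri + #1)%cmd.

Definition point_cmd : cmd := (
  rc <- $rG mod $rD ;;
  If ($rc)
    (rok <- ($rc == #1) * ($rrem == $rk + #1) ;; rpt <- $rG / $rD)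
    (rok <- $rrem == #1 ;; rpt <- $rInf))%cmd.

(** Gates occupy different numbers of tokens, so the wanted one is found by stripping all its
    predecessors from the full list on every access. *)
Definition fetch_cmd : cmd := (
  rG <- $rG0 ;;
  rcnt <- $rgi ;;
  While ($rcnt) (head_cmd ;; rG <- $rG / $rQ ;; rcnt <- $rcnt - #1) ;;
  head_cmd)%cmd.

Definition digits_cmd : cmd := (
  rdu <- $ru ;; rdv <- $rv ;; rda <- $rga ;; rcnt <- $rK ;;
  While ($rcnt) (
    If ($rc == #4)
      (rokm <- $rokm * ($rdu mod $rD + $rdv mod $rD == $rda mod $rD))
      (* [T - (T - x)] with truncated subtraction is [min T x]. *)
      (rokm <- $rokm * ($rdu mod $rD == $rThr - ($rThr - ($rda mod $rD + $rdv mod $rD)))) ;;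
    rdu <- $rdu / $rD ;; rdv <- $rdv / $rD ;; rda <- $rda / $rD ;; rcnt <- $rcnt - #1))%cmd.

Definition rel_cmd : cmd := (
  If ($rc == #0)
    (* Tokens and points are packed in the same base, so the [K] digits after the two tags are the
       code of the point as they stand. *)
    (If ($rf1) (rpt <- ($rG / $rD / $rD) mod $rInf) (rpt <- $rInf) ;;
     rokm <- ($ru == $rInf + #1) * ($rv == $rInf + #1) * ($rga == $rpt))
    (If ($rc == #2)
       (rokm <- #0 < ($ru == $rga) * ($rv == $rInf + #1) + ($ru == $rInf + #1) * ($rv == $rga))
       (If ($rc == #3)
          (rokm <- ($ru == $rga) * ($rv == $rga))
          (If ($rc == #4)
             (rok <- ($ru == $rInf) + ($rv == $rInf) ;;
              rokm <- ($ru <= $rInf) * ($rv <= $rInf))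
             (rok <- $ru == $rInf ;;
              rokm <- ($ru <= $rInf) * ($rv < $rInf)) ;;
           If ($rok)
             (rokm <- $rokm * ($rga == $rInf))
             (rokm <- $rokm * ($rga < $rInf) ;; digits_cmd)))))%cmd.

Definition child_cmd : cmd := (
  fetch_cmd ;;
  If ($rgb == $rW)
    (If ($rc == #1)
       (rokm <- $rgm == #0 ;; rni <- $rf1 ;; rna <- $rga ;; rnb <- $rW)
       (ru <- $rgm / $rW ;; rv <- $rgm mod $rW ;;
        rni <- $rgi ;; rna <- $ru ;; rnb <- $rv ;; rel_cmd))
    (rnb <- $rW ;;
     If (#2 <= $rc)
       (If ($rgm == #0)
          (rokm <- #1 - ($rga == $rInf + #1) ;; rni <- $rf1 ;; rna <- $rga)
          (rokm <- ($rgm == #1) * (#1 - ($rgb == $rInf + #1)) ;; rni <- $rf2 ;; rna <- $rgb))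
       (rokm <- #0)))%cmd.

Definition pop_cmd : cmd := (
  rgm <- $rS mod $rE ;; rS <- $rS / $rE ;;
  rgb <- $rS mod $rE ;; rS <- $rS / $rE ;;
  rga <- $rS mod $rE ;; rS <- $rS / $rE ;;
  rgi <- $rS mod $rE ;; rS <- $rS / $rE ;;
  rh <- $rh - #1)%cmd.

Definition push_cmd : cmd := (
  rS <- $rS * $rE + $rgi ;;
  rS <- $rS * $rE + $rga ;;
  rS <- $rS * $rE + $rgb ;;
  rS <- $rS * $rE + $rgm ;;
  rh <- $rh + #1 ;;
  rgi <- $rni ;; rga <- $rna ;; rgb <- $rnb ;; rgm <- #0)%cmd.

Definition search_body : cmd := (
  If ($rgm < $rM)
    (child_cmd ;;
     If ($rokm) push_cmd (rgm <- $rgm + #1))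
    (If ($rh == #0)
       (rrun <- #0 ;; rres <- #0)
       (pop_cmd ;;
        If ($rh == #0)
          (rrun <- #0 ;; rres <- #1)
          (pop_cmd ;; rgm <- $rgm + #1))))%cmd.

Definition search_cmd : cmd := (
  rW <- $rInf + #2 ;;
  rM <- $rW * $rW ;;
  rE <- $rM + #1 ;;
  rS <- #0 ;; rh <- #0 ;;
  rgi <- $rout ;; rga <- $rpt ;; rgb <- $rW ;; rgm <- #0 ;; rrun <- #1 ;;
  While ($rrun) search_body)%cmd.

Definition decide_cmd : cmd := (
  rres <- #0 ;;
  parse_cmd ;;
  If ($rok)
    (header_cmd ;;
     While ($rok * ($ri < $rn)) validate_body ;;
     If ($rok)
       (point_cmd ;;
        If ($rok) search_cmd (rres <- #0))
       (rres <- #0))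
    (rres <- #0))%cmd.

(** * Correctness of gate access, moves and search *)

Ltac wstep :=
  lazymatch goal with
  | |- wp _ (Seq _ _) _ _ => apply wp_seq
  | |- wp _ (Asgn _ _) _ _ => apply wp_asgn; [ok_split | xeval]
  | |- wp _ (If _ _ _) _ _ => apply wp_if; [ok_split | xeval; intros ?Hif | xeval; intros ?Hif]
  end.

Ltac regs :=
  repeat match goal with H : ?s ?r = _ |- context [?s ?r] => is_var s; rewrite H end.

Ltac wgo :=
  repeat (wstep; lazymatch goal with
                 | |- wp _ _ _ _ => idtac
                 | |- _ => try solve [regs; lia]
                 end).

(** Past the end everything reads as 0, so tokens may be fetched without a length check. Packing
    forgets trailing zeros, which is why the lengths are kept in registers of their own. *)
Lemma pack_nth D l i : 0 < D -> Forall (fun a => a < D) l ->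
  pack D (skipn i l) mod D = nth i l 0 /\ pack D (skipn i l) / D = pack D (skipn (S i) l).
Proof.
  intros HD. revert i. induction l as [|a l IH]; intros i Hl.
  - rewrite !skipn_nil. cbn [pack]. rewrite Nat.Div0.mod_0_l, Nat.Div0.div_0_l. now destruct i.
  - inversion Hl; subst. destruct i as [|i]; [|now apply IH]. now apply pack_cons.
Qed.

Definition strip (D inf c f1 : nat) : nat :=
  if c =? 0 then if f1 =? 0 then D * D else D * D * inf
  else if c =? 1 then D * D else D * D * D.

Definition head_size (k c f1 : nat) : nat :=
  if c =? 0 then if f1 =? 0 then 2 else k + 2 else if c =? 1 then 2 else 3.

Lemma wp_head B D inf k l s :
  s rD = D -> s rInf = inf -> s rk = k -> s rG = pack D l -> Forall (fun a => a < D) l ->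
  0 < D -> 3 <= B -> D * D * D <= B -> D * D * inf <= B -> k + 2 <= B ->
  wp B head_cmd (fun s' => (s' rc = nth 0 l 0 /\ s' rf1 = nth 1 l 0 /\ s' rf2 = nth 2 l 0 /\
     s' rQ = strip D inf (nth 0 l 0) (nth 1 l 0) /\
     s' rz = head_size k (nth 0 l 0) (nth 1 l 0)) /\ same_except head_cmd s s') s.
Proof.
  intros ED Einf Ek EG Hl HD H3 HB1 HB2 HB3. apply wp_frame. unfold head_cmd.
  destruct (pack_nth D l 0 HD Hl) as [A0 B0]. destruct (pack_nth D l 1 HD Hl) as [A1 B1].
  destruct (pack_nth D l 2 HD Hl) as [A2 _]. cbn [skipn] in A0, B0, A1, B1, A2.
  assert (D <= D * D <= D * D * D) by nia.
  unfold strip, head_size.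
  wgo; repeat split; regs; rewrite ?B0, ?B1, ?A0, ?A1, ?A2 in *; auto.
  all: revert Hif; try revert Hif0; regs.
  all: rewrite ?B0, ?B1, ?A0, ?A1, ?A2.
  all: destruct (Nat.eqb_spec (nth 0 l 0) 0), (Nat.eqb_spec (nth 0 l 0) 1),
    (Nat.eqb_spec (nth 1 l 0) 0); cbn [Nat.b2n]; lia.
Qed.

Lemma strip_gate D K g r :
  Forall (fun a => a < D) (gate_code g ++ r) -> input_valid K g ->
  let l := gate_code g ++ r in
  pack D l / strip D (D ^ K) (nth 0 l 0) (nth 1 l 0) = pack D r.
Proof.
  intros Hl Hv. cbn zeta.
  assert (E : strip D (D ^ K) (nth 0 (gate_code g ++ r) 0) (nth 1 (gate_code g ++ r) 0) =
              D ^ length (gate_code g)).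
  { unfold strip. destruct g as [[v|] | j | o j1 j2].
    - cbn in Hv. cbn [gate_code elt_code app nth length Nat.eqb Nat.pow]. subst K. lia.
    - cbn. lia.
    - cbn. lia.
    - destruct o; cbn; lia. }
  apply Forall_app in Hl as [Hl _]. apply pack_bound in Hl.
  rewrite E, pack_app, (Nat.mul_comm (D ^ _)), Nat.div_add by lia.
  now rewrite Nat.div_small.
Qed.

Definition env (T K k : nat) (code : list nat) (s : state) : Prop :=
  s rThr = T /\ s rD = S T /\ s rInf = inf_code T K /\ s rk = k /\ s rK = K /\
  s rG0 = pack (S T) code.

Lemma env_same T K k code c s s' :
  env T K k code s -> same_except c s s' ->
  forallb (fun r => negb (assigned c r)) [rThr; rD; rInf; rk; rK; rG0] = true ->
  env T K k code s'.
Proof.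
  unfold env. intros E F H. cbn [forallb] in H. rewrite !andb_true_iff, !negb_true_iff in H.
  rewrite !F by tauto. exact E.
Qed.

(** A single requirement on the word size from which the overflow conditions of gate access and of
    [rel_cmd] follow. *)
Definition big (T K k B : nat) : Prop :=
  2 <= T /\ k + 2 <= B /\ S T * S T * S T * num_codes T K <= B.

Lemma big_facts T K k B : big T K k B ->
  5 <= B /\ S T <= B /\ 2 * T <= B /\ S T * S T <= B /\ S T * S T * S T <= B /\
  S T * S T * inf_code T K <= B /\ num_codes T K <= B /\ k + 2 <= B.
Proof.
  intros (H1 & H2 & H3). unfold num_codes in *. set (I := inf_code T K) in *.
  assert (3 * (3 * 3) <= S T * (S T * S T)) by (repeat apply Nat.mul_le_mono; lia).
  assert (A : S T * S T * S T * 2 <= S T * S T * S T * (2 + I)) by (apply Nat.mul_le_mono; lia).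
  assert (C : 1 * (2 + I) <= S T * S T * S T * (2 + I)) by (apply Nat.mul_le_mono; lia).
  assert (D : S T * S T * 1 * I <= S T * S T * S T * (2 + I))
    by (repeat apply Nat.mul_le_mono; lia).
  nia.
Qed.

Lemma skipn_nth {A} (d : A) i l : i < length l -> skipn i l = nth i l d :: skipn (S i) l.
Proof.
  revert i. induction l as [|a l IH]; intros [|i] Hi; cbn in *; try lia; [easy|].
  apply IH. lia.
Qed.

Lemma Forall_flat_skip {A} (P : A -> Prop) {C} (f : C -> list A) i l tl :
  Forall P (flat_map f l ++ tl) -> Forall P (flat_map f (skipn i l) ++ tl).
Proof.
  intros H. rewrite <- (firstn_skipn i l), flat_map_app, <- app_assoc in H.
  now apply Forall_app in H.
Qed.

Lemma wp_fetch B T K k gs tl i s :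
  big T K k B -> env T K k (flat_map gate_code gs ++ tl) s ->
  Forall (fun a => a < S T) (flat_map gate_code gs ++ tl) ->
  (forall i, input_valid K (nth i gs (GInput None))) ->
  s rgi = i -> i < length gs ->
  wp B fetch_cmd (fun s' => (exists r,
    let l := gate_code (nth i gs (GInput None)) ++ r in
    Forall (fun a => a < S T) l /\
    s' rG = pack (S T) l /\ s' rc = nth 0 l 0 /\ s' rf1 = nth 1 l 0 /\ s' rf2 = nth 2 l 0) /\
    same_except fetch_cmd s s') s.
Proof.
  intros HB He Hcode Hin Ei Hi. apply wp_frame.
  destruct (big_facts _ _ _ _ HB) as (B1 & B2 & _ & B3 & B4 & B5 & B6 & B7).
  set (suf := fun j => flat_map gate_code (skipn j gs) ++ tl).
  assert (Hsuf : forall j, j < length gs ->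
            suf j = gate_code (nth j gs (GInput None)) ++ suf (S j)).
  { intros j Hj. unfold suf. rewrite (skipn_nth (GInput None)) by easy.
    cbn [flat_map]. now rewrite <- app_assoc. }
  assert (Hall : forall j, Forall (fun a => a < S T) (suf j))
    by (intros j; now apply Forall_flat_skip).
  unfold fetch_cmd. do 5 wstep.
  set (I := fun j s' => j <= i /\ env T K k (flat_map gate_code gs ++ tl) s' /\
              s' rcnt = j /\ s' rG = pack (S T) (suf (i - j))).
  apply (wp_while _ _ _ I (fun j => j)) with (a := i).
  - intros; exact Logic.I.
  - intros j s1 (Hj & He1 & Ec & EG). xeval. intros Hz. pose proof He1 as He1'.
    destruct He1' as (ET & ED & EI & Ek & EK & EG0).
    wstep. eapply wp_conseq; [apply (wp_head B (S T) (inf_code T K) k (suf (i - j))); auto; lia|].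
    cbn beta. intros s2 ((F1 & F2 & F3 & F4 & F5) & F). wgo.
    + rewrite F4. unfold strip, inf_code.
      assert (S T ^ K <> 0) by (apply Nat.pow_nonzero; lia).
      destruct (_ =? 0); [destruct (_ =? 0) | destruct (_ =? 1)];
        repeat (apply Nat.neq_mul_0; split); lia.
    + exists (j - 1). split; [lia|]. unfold I. split; [lia|]. split; [|split].
      * exact (env_same _ _ _ _ head_cmd s1 s2 He1 F eq_refl).
      * xeval. rewrite (F 32 eq_refl). lia.
      * xeval. rewrite (F 23 eq_refl), EG, F4. unfold inf_code.
        replace (i - (j - 1)) with (S (i - j)) by lia.
        rewrite Hsuf by lia. apply strip_gate; [|apply Hin].
        rewrite <- Hsuf by lia. apply Hall.
  - intros j s1 (Hj & He1 & Ec & EG). xeval. intros Hz.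
    destruct He1 as (ET & ED & EI & Ek & EK & EG0).
    replace (i - j) with i in EG by lia. rewrite Hsuf in EG by easy.
    eapply wp_conseq.
    + apply (wp_head B (S T) (inf_code T K) k _ s1 ED EI Ek EG); try lia.
      rewrite <- Hsuf by easy. apply Hall.
    + cbn beta. intros s2 ((F1 & F2 & F3 & F4 & F5) & F).
      exists (suf (S i)). rewrite (F 23 eq_refl). repeat split; auto.
      rewrite <- Hsuf by easy. apply Hall.
  - unfold I. split; [lia|]. destruct He as (ET & ED & EI & Ek & EK & EG0).
    split; [|split].
    + repeat split; easy.
    + exact Ei.
    + rewrite Nat.sub_diag. exact EG0.
Qed.

Lemma wp_digits B T K f a u v ok s :
  2 * T <= B -> 4 <= B ->
  s rThr = T -> s rD = S T -> s rK = K ->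
  s ru = u -> s rv = v -> s rga = a -> s rokm = Nat.b2n ok ->
  f = (if s rc =? 4 then plus_digit else minus_digit T) ->
  wp B digits_cmd (fun s' => s' rokm = Nat.b2n (ok && all_digits f (S T) K u v a)) s.
Proof.
  intros HB HB1 ET ED EK Eu Ev Ea Eok ->. unfold digits_cmd. wgo.
  set (f := if s rc =? 4 then plus_digit else minus_digit T).
  set (I := fun (p : nat * (nat * nat * nat) * bool) (s' : state) =>
    let '(j, (u', v', a'), ok') := p in
    s' rThr = T /\ s' rD = S T /\ s' rc = s rc /\ s' rcnt = j /\
    s' rdu = u' /\ s' rdv = v' /\ s' rda = a' /\ s' rokm = Nat.b2n ok' /\
    ok && all_digits f (S T) K u v a = ok' && all_digits f (S T) j u' v' a').
  apply (wp_while _ _ _ I (fun p => fst (fst p))) with (a := (K, (u, v, a), ok)).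
  - intros; exact Logic.I.
  - intros [[j [[u' v'] a']] ok'] s1 (ET1 & ED1 & Ec1 & Ej & Eu1 & Ev1 & Ea1 & Eok1 & Heq).
    xeval. intros Hz. destruct j as [|j]; [lia|].
    assert (Hmod : forall x, x mod S T < S T) by (intros; apply Nat.mod_upper_bound; lia).
    assert (Hb : forall b, Nat.b2n ok' * Nat.b2n b <= B) by (intros []; destruct ok'; cbn; lia).
    pose proof (Hmod u'). pose proof (Hmod v'). pose proof (Hmod a').
    wgo; try (regs; first [lia | apply Hb]);
      (exists (j, (u' / S T, v' / S T, a' / S T), ok' && f (u' mod S T) (v' mod S T) (a' mod S T));
       cbn [fst]; split; [lia|]; unfold I; xeval; regs; repeat split; try lia;
       try (rewrite Heq; cbn [all_digits]; now rewrite andb_assoc)).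
    + rewrite b2n_and. f_equal. f_equal. unfold f. rewrite <- Ec1.
      apply b2n_neq0 in Hif. now rewrite Hif.
    + rewrite b2n_and. f_equal. f_equal. unfold f. rewrite <- Ec1.
      apply b2n_eq0 in Hif. rewrite Hif. unfold minus_digit. f_equal. lia.
  - intros [[j [[u' v'] a']] ok'] s1 (ET1 & ED1 & Ec1 & Ej & Eu1 & Ev1 & Ea1 & Eok1 & Heq).
    xeval. intros Hz. assert (j = 0) as -> by lia.
    rewrite Eok1, Heq. cbn [all_digits]. now rewrite andb_true_r.
  - unfold I. repeat split; auto.
Qed.

Lemma b2n_le1 b : Nat.b2n b <= 1.
Proof. destruct b; cbn; lia. Qed.

Lemma wp_if_true B e c1 c2 Q s :
  eval_ok B s e -> eval s e <> 0 -> wp B c1 Q s -> wp B (If e c1 c2) Q s.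
Proof. intros. apply wp_if; auto. intros. contradiction. Qed.

Lemma wp_if_false B e c1 c2 Q s :
  eval_ok B s e -> eval s e = 0 -> wp B c2 Q s -> wp B (If e c1 c2) Q s.
Proof. intros. apply wp_if; auto. intros. contradiction. Qed.

Ltac side :=
  regs; repeat rewrite b2n_and;
  first [ assumption | lia
        | match goal with |- Nat.b2n ?x <= _ => pose proof (b2n_le1 x); lia end
        | match goal with |- Nat.b2n ?x + Nat.b2n ?y <= _ =>
            pose proof (b2n_le1 x); pose proof (b2n_le1 y); lia end
        | match goal with |- Nat.b2n ?x * ?y <= _ => pose proof (b2n_le1 x); nia end ].

Ltac wside := repeat (wstep; lazymatch goal with
                 | |- wp _ _ _ _ => idtac
                 | |- _ => try solve [side]
                 end).

Ltac if_true := apply wp_if_true; [ok_split; solve [side] | xeval; regs; try reflexivity; try easy |].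
Ltac if_false := apply wp_if_false; [ok_split; solve [side] | xeval; regs; try reflexivity; try easy |].

Lemma wp_rel B T K k code g r a u v s :
  big T K k B -> env T K k code s ->
  let l := gate_code g ++ r in
  Forall (fun a => a < S T) l -> input_valid K g ->
  s rG = pack (S T) l -> s rc = nth 0 l 0 -> s rf1 = nth 1 l 0 ->
  (forall j, g <> GCompl j) ->
  s ru = u -> s rv = v -> s rga = a ->
  wp B rel_cmd (fun s' => s' rokm = Nat.b2n (rel T K g a u v)) s.
Proof.
  intros HB (ET & ED & EI & Ek & EK & EG0) l Hl Hv EG Ec Ef1 Hng Eu Ev Ea.
  destruct (big_facts _ _ _ _ HB) as (B1 & B2 & B2' & B3 & B4 & B5 & B6 & B7).
  assert (Hinf : inf_code T K + 2 <= B) by (unfold num_codes in B6; lia).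
  assert (HinfS : inf_code T K + 1 = skip_code T K) by (unfold skip_code; lia).
  assert (Hinf0 : inf_code T K <> 0) by (apply Nat.pow_nonzero; lia).
  unfold rel_cmd. destruct g as [e | j | o j1 j2]; [| now destruct (Hng j) |].
  - if_true. wstep. destruct e as [w|]; cbn [gate_code elt_code app nth] in l; subst l.
    + if_true. wside. xeval. regs. rewrite HinfS.
      destruct (pack_nth (S T) _ 0 ltac:(lia) Hl) as [_ E0].
      destruct (pack_nth (S T) _ 1 ltac:(lia) Hl) as [_ E1].
      cbn [skipn] in E0, E1. rewrite E0, E1. cbn in Hv.
      (* The coordinates are the lowest [K] digits, and the tokens after them vanish modulo
         [(T + 1) ^ K]. *)
      rewrite pack_app, Hv. fold (inf_code T K).
      rewrite (Nat.mul_comm (inf_code T K)), Nat.Div0.mod_add.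
      rewrite Nat.mod_small.
      2: { unfold inf_code. rewrite <- Hv. apply pack_bound.
           inversion Hl as [|? ? _ Hl1]. inversion Hl1 as [|? ? _ Hl2].
           now apply Forall_app in Hl2. }
      cbn [rel encode]. now rewrite !b2n_and.
    + if_false. wside. xeval. regs. rewrite HinfS. cbn [rel encode]. now rewrite !b2n_and.
  - cbn [gate_code app nth] in l; subst l. cbn [nth] in *. unfold rel.
    destruct o; cbn [binop_code] in *.
    + if_false. if_true. wside. xeval. regs. rewrite HinfS, !b2n_and.
      set (b1 := (u =? a) && _). set (b2 := (u =? _) && _). now destruct b1, b2.
    + if_false. if_false. if_true. wside.
    + if_false. if_false. if_false. wstep. if_true. wside.
      * xeval. regs. rewrite !b2n_and. f_equal.
        revert Hif. regs. destruct (u =? inf_code T K), (v =? inf_code T K); cbn; easy.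
      * eapply wp_conseq; [eapply (wp_digits B T K plus_digit a u v);
          xeval; regs; rewrite ?b2n_and; try reflexivity; lia|].
        cbn beta. intros s' ->. f_equal.
        revert Hif. regs. destruct (u =? inf_code T K), (v =? inf_code T K); cbn [Nat.b2n orb];
          try easy. intros _. now rewrite !andb_assoc.
    + if_false. if_false. if_false. wstep. if_false. wside.
      * xeval. regs. rewrite !b2n_and. f_equal.
        revert Hif. regs. destruct (u =? inf_code T K); cbn; easy.
      * eapply wp_conseq; [eapply (wp_digits B T K (minus_digit T) a u v);
          xeval; regs; rewrite ?b2n_and; try reflexivity; lia|].
        cbn beta. intros s' ->. f_equal.
        revert Hif. regs. destruct (u =? inf_code T K); cbn [Nat.b2n];
          try easy. intros _. now rewrite !andb_assoc.
Qed.

Lemma wp_child B T K k gs tl i a b m s :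
  big T K k B -> env T K k (flat_map gate_code gs ++ tl) s ->
  Forall (fun a => a < S T) (flat_map gate_code gs ++ tl) ->
  (forall i, input_valid K (nth i gs (GInput None))) ->
  s rW = num_codes T K -> s rgi = i -> s rga = a -> s rgb = b -> s rgm = m ->
  i < length gs ->
  wp B child_cmd (fun s' =>
    match child T K gs (i, a, b) m with
    | Some (i', a', b') => s' rokm = 1 /\ s' rni = i' /\ s' rna = a' /\ s' rnb = b'
    | None => s' rokm = 0
    end /\ same_except child_cmd s s') s.
Proof.
  intros HB He Hcode Hin EW Ei Ea Eb Em Hi. apply wp_frame.
  destruct (big_facts _ _ _ _ HB) as (B1 & B2 & B2' & B3 & B4 & B5 & B6 & B7).
  assert (Hskip : inf_code T K + 1 = skip_code T K) by (unfold skip_code; lia).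
  assert (HW0 : num_codes T K <> 0) by (unfold num_codes; lia).
  assert (Hinf : inf_code T K + 2 <= B) by (unfold num_codes in B6; lia).
  unfold child_cmd. wstep.
  eapply wp_conseq; [apply (wp_fetch B T K k gs tl i s); auto|].
  cbn beta. intros s1 ((r & Hl & EG & Ec & Ef1 & Ef2) & F).
  pose proof (env_same _ _ _ _ _ _ _ He F eq_refl) as He1.
  rewrite <- (F rW eq_refl) in EW. rewrite <- (F rgi eq_refl) in Ei.
  rewrite <- (F rga eq_refl) in Ea. rewrite <- (F rgb eq_refl) in Eb.
  rewrite <- (F rgm eq_refl) in Em. clear F He.
  pose proof He1 as (ET & ED & EI & Ek & EK & EG0).
  unfold child. set (g := nth i gs (GInput None)) in *.
  assert (Hg : input_valid K g) by apply Hin.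
  set (l := gate_code g ++ r) in *.
  wstep; try solve [side].
  - revert Hif. regs. intros Hif. apply b2n_neq0 in Hif. rewrite Hif.
    assert (Hcases : (exists j, g = GCompl j) \/
                     ((forall j, g <> GCompl j) /\ nth 0 l 0 <> 1)).
    { unfold l. destruct g as [e | j | o j1 j2]; [right | left; eauto | right];
        (split; [easy|]); [easy | destruct o; easy]. }
    destruct Hcases as [[j Eg] | [Hng Hc1]].
    + unfold l in Ec, Ef1. rewrite Eg in *. cbn [gate_code app nth] in Ec, Ef1.
      if_true. wside. xeval. regs. destruct (m =? 0); cbn [Nat.b2n]; auto.
    + apply Nat.eqb_neq in Hc1. if_false; [now rewrite Hc1|]. wside.
      eapply wp_conseq.
      { apply wp_frame.
        apply (wp_rel B T K k (flat_map gate_code gs ++ tl) g r a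
          (m / num_codes T K) (m mod num_codes T K)); xeval; regs; auto. }
      cbn beta. intros s2 (E2 & F2).
      assert (Hm : match g return option pos with
        | GCompl j => if m =? 0 then Some (j, a, num_codes T K) else None
        | _ => if rel T K g a (m / num_codes T K) (m mod num_codes T K)
               then Some (i, m / num_codes T K, m mod num_codes T K) else None
        end = if rel T K g a (m / num_codes T K) (m mod num_codes T K)
               then Some (i, m / num_codes T K, m mod num_codes T K) else None).
      { destruct g as [e | j | o j1 j2]; [easy | now destruct (Hng j) | easy]. }
      rewrite Hm, E2. destruct (rel _ _ _ _ _ _); [|easy].
      rewrite (F2 rni eq_refl), (F2 rna eq_refl), (F2 rnb eq_refl). xeval. regs. auto.
  - revert Hif. regs. intros Hif. apply b2n_eq0 in Hif. rewrite Hif.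
    wstep. wstep. wstep; try solve [side]; revert Hif0; regs; unfold l.
    + destruct g as [e | j | o j1 j2]; cbn [gate_code app nth]; try easy.
      intros _. unfold l in Ef1, Ef2. cbn [gate_code app nth] in Ef1, Ef2.
      wside; xeval; revert Hif0; regs; rewrite ?Hskip.
      * intros Hm. apply b2n_neq0 in Hm. rewrite Hm.
        destruct (a =? skip_code T K); cbn [Nat.b2n]; auto.
      * intros Hm. apply b2n_eq0 in Hm. rewrite Hm.
        destruct (m =? 1), (b =? skip_code T K); cbn [Nat.b2n]; auto.
    + destruct g as [e | j | o j1 j2]; cbn [gate_code app nth]; try (destruct o; easy).
      all: intros _; wside; reflexivity.
Qed.

(** Four digits in base [E] per frame, with the top frame lowest, so that push and pop are a
    multiplication and a division. A frame of zeros would be invisible, hence the separate height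
    register. *)
Fixpoint encode_stack (E : nat) (st : list frame) : nat :=
  match st with
  | [] => 0
  | ((i, a, b), m) :: st' => (((encode_stack E st' * E + i) * E + a) * E + b) * E + m
  end.

Definition frame_below (E : nat) (f : frame) : Prop :=
  let '((i, a, b), m) := f in i < E /\ a < E /\ b < E /\ m < E.

Lemma digit_step E x d h : d < E -> x < E ^ h -> x * E + d < E ^ S h.
Proof. intros Hd Hx. rewrite Nat.pow_succ_r'. nia. Qed.

Lemma encode_stack_bound E st :
  Forall (frame_below E) st -> encode_stack E st < E ^ (4 * length st).
Proof.
  induction 1 as [|[[[i a] b] m] st (H1 & H2 & H3 & H4) _ IH]; cbn [encode_stack length].
  - cbn. lia.
  - replace (4 * S (length st)) with (S (S (S (S (4 * length st))))) by lia.
    now repeat apply digit_step.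
Qed.

Definition search_regs (st : list frame) (s : state) (E : nat) : Prop :=
  match st with
  | [] => False
  | ((i, a, b), m) :: st' =>
      s rgi = i /\ s rga = a /\ s rgb = b /\ s rgm = m /\
      s rS = encode_stack E st' /\ s rh = length st' /\ s rE = E
  end.

Lemma wp_pop B E f st s :
  frame_below E f -> s rS = encode_stack E (f :: st) -> s rh = S (length st) -> s rE = E ->
  1 <= B -> wp B pop_cmd (fun s' => search_regs (f :: st) s' E /\ same_except pop_cmd s s') s.
Proof.
  destruct f as [[[i a] b] m]. intros (H1 & H2 & H3 & H4) ES Eh EE HB. apply wp_frame.
  assert (Hdm : forall x d, d < E -> (x * E + d) / E = x /\ (x * E + d) mod E = d)
    by (intros; now apply code_split).
  cbn [encode_stack] in ES. unfold pop_cmd. wside. unfold search_regs. xeval. regs.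
  set (x := encode_stack E st).
  destruct (Hdm (((x * E + i) * E + a) * E + b) m H4) as [-> ->].
  destruct (Hdm ((x * E + i) * E + a) b H3) as [-> ->].
  destruct (Hdm (x * E + i) a H2) as [-> ->].
  destruct (Hdm x i H1) as [-> ->]. repeat split; lia.
Qed.

Lemma wp_push B E z m z' st s :
  frame_below E (z, m) -> Forall (frame_below E) st ->
  search_regs ((z, m) :: st) s E -> E ^ (4 * S (length st)) <= B -> 1 <= E ->
  length st + 1 <= B ->
  (let '(i', a', b') := z' in s rni = i' /\ s rna = a' /\ s rnb = b') ->
  wp B push_cmd (fun s' => search_regs ((z', 0) :: (z, m) :: st) s' E /\
                           same_except push_cmd s s') s.
Proof.
  destruct z as [[i a] b], z' as [[i' a'] b'].
  intros (H1 & H2 & H3 & H4) Hst (Ei & Ea & Eb & Em & ES & Eh & EE) HB HE HB' (Ei' & Ea' & Eb').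
  apply wp_frame. pose proof (encode_stack_bound E st Hst) as Hb.
  set (x := encode_stack E st) in *. set (n := length st) in *.
  assert (Hmono : forall j y, j <= 4 -> y < E ^ (j + 4 * n) -> y <= B).
  { intros j y Hj Hy. apply Nat.le_trans with (E ^ (j + 4 * n)); [lia|].
    apply Nat.le_trans with (2 := HB). apply Nat.pow_le_mono_r; lia. }
  pose proof (digit_step E _ i (4 * n) H1 Hb) as D1.
  pose proof (digit_step E _ a _ H2 D1) as D2.
  pose proof (digit_step E _ b _ H3 D2) as D3.
  pose proof (digit_step E _ m _ H4 D3) as D4.
  apply (Hmono 1) in D1; [|lia]. apply (Hmono 2) in D2; [|lia].
  apply (Hmono 3) in D3; [|lia]. apply (Hmono 4) in D4; [|lia].
  unfold push_cmd. wside. unfold search_regs. xeval. regs. cbn [encode_stack length].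
  fold x n. repeat split; lia.
Qed.

Lemma stack_ok_below T K gs C st E :
  E = num_codes T K * num_codes T K + 1 -> length gs <= E ->
  stack_ok T K gs C st -> Forall (frame_below E) st.
Proof.
  intros -> Hgs. assert (num_codes T K <= num_codes T K * num_codes T K)
    by (unfold num_codes; nia).
  induction st as [|[[[i a] b] m] st IH]; intros Hok; constructor.
  - destruct Hok as ((H1 & H2 & H3 & H4) & Hm & _). unfold frame_below. lia.
  - apply IH, Hok.
Qed.

Lemma wp_search_body B T K k gs tl C st s :
  let M := num_codes T K * num_codes T K in
  let E := M + 1 in
  big T K k B -> env T K k (flat_map gate_code gs ++ tl) s ->
  Forall (fun a => a < S T) (flat_map gate_code gs ++ tl) ->
  (forall i, input_valid K (nth i gs (GInput None))) ->
  (forall i, i < length gs -> wf_gate K (length gs) i (nth i gs (GInput None))) ->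
  length gs <= E -> 1 <= C -> E ^ (4 * C) <= B ->
  s rW = num_codes T K -> s rM = M -> search_regs st s E -> stack_ok T K gs C st ->
  wp B search_body (fun s' =>
    match search_step (child T K gs) M st with
    | inl st' => s' rrun = s rrun /\ search_regs st' s' E
    | inr w => s' rrun = 0 /\ s' rres = Nat.b2n w
    end /\ same_except search_body s s') s.
Proof.
  intros M E HB He Hcode Hin Hwf HgsE HC HBE EW EM Hs Hst. apply wp_frame.
  pose proof (big_facts _ _ _ _ HB) as (B1 & _).
  assert (HWM : num_codes T K <= M) by (unfold M, num_codes; nia).
  assert (HE2 : 1 < E) by (unfold E, num_codes in *; lia).
  assert (HEB : E <= B).
  { apply Nat.le_trans with (2 := HBE). rewrite <- (Nat.pow_1_r E) at 1.
    apply Nat.pow_le_mono_r; lia. }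
  assert (HCB : C + 1 <= B).
  { apply Nat.le_trans with (2 := HBE). pose proof (Nat.pow_gt_lin_r E (4 * C) HE2). lia. }
  pose proof (stack_ok_below T K gs C st E eq_refl HgsE Hst) as Hbelow.
  destruct st as [|[[[i a] b] m] st]; [easy|].
  pose proof Hs as (Ei & Ea & Eb & Em & ES & Eh & EE).
  pose proof Hst as (Hz & Hm & Hr & Hst').
  inversion Hbelow as [|? ? Hf Hbelow']; subst.
  cbn [search_step]. unfold search_body. wstep; [side..| |].
  - revert Hif. regs. intros Hif%b2n_neq0. rewrite Hif. apply Nat.ltb_lt in Hif.
    wstep. eapply wp_conseq.
    { apply (wp_child B T K k gs tl (s rgi) (s rga) (s rgb) (s rgm) s); auto. apply Hz. }
    cbn beta. intros s1 (Hc & F).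
    assert (Hs1 : search_regs ((s rgi, s rga, s rgb, s rgm) :: st) s1 E).
    { unfold search_regs. rewrite !F by reflexivity. auto 8. }
    destruct (child T K gs (s rgi, s rga, s rgb) (s rgm)) as [[[i' a'] b']|] eqn:Ech.
    + destruct Hc as (Eok & Hc). if_true.
      (* A position that has a child has positive rank, so the bound of [stack_ok] leaves room for
         one more frame. *)
      pose proof (child_rank _ _ _ _ _ _ Hwf Hif Ech) as Hrank.
      eapply wp_conseq.
      { apply (wp_push B E (s rgi, s rga, s rgb) (s rgm) (i', a', b') st s1); auto; try lia.
        apply Nat.le_trans with (2 := HBE). apply Nat.pow_le_mono_r; lia. }
      cbn beta. intros s2 (Hs2 & F2). split; [|exact Hs2].
      rewrite (F2 rrun eq_refl). apply (F rrun eq_refl).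
    + if_false. wside.
      { destruct Hs1 as (_ & _ & _ & Em1 & _). rewrite Em1. unfold E in HEB. lia. }
      split; [apply (F rrun eq_refl)|].
      destruct Hs1 as (Ei1 & Ea1 & Eb1 & Em1 & ES1 & Eh1 & EE1).
      unfold search_regs. xeval. regs. repeat split; lia.
  - revert Hif. regs. intros Hif%b2n_eq0. rewrite Hif.
    destruct st as [|f1 st].
    + cbn [length] in Eh. if_true. wside. auto.
    + cbn [length] in Eh. if_false. wstep.
      inversion Hbelow' as [|? ? Hf1 Hbelow2]; subst.
      eapply wp_conseq; [apply (wp_pop B E f1 st s); auto; lia|].
      cbn beta. intros s1 (Hs1 & F1). destruct f1 as [[[i1 a1] b1] m1].
      destruct Hs1 as (_ & _ & _ & _ & ES1 & Eh1 & EE1).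
      destruct st as [|f2 st].
      * cbn [length] in Eh1. if_true. wside. auto.
      * cbn [length] in Eh1. if_false. wstep.
        inversion Hbelow2 as [|? ? Hf2 Hbelow3]; subst.
        eapply wp_conseq; [apply (wp_pop B E f2 st s1); auto; lia|].
        cbn beta. intros s2 (Hs2 & F2). destruct f2 as [[[i2 a2] b2] m2].
        destruct Hs2 as (Ei2 & Ea2 & Eb2 & Em2 & ES2 & Eh2 & EE2).
        destruct Hf2 as (_ & _ & _ & Hm2).
        wside; try (regs; unfold E in *; lia). split.
        -- xeval. rewrite (F2 rrun eq_refl). apply (F1 rrun eq_refl).
        -- unfold search_regs. xeval. regs. repeat split; lia.
Qed.

Lemma wp_while_step B e c Q s :
  eval_ok B s e -> eval s e <> 0 -> wp B c (wp B (While e c) Q) s -> wp B (While e c) Q s.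
Proof.
  intros Hok He (s1 & H1 & s2 & H2 & HQ). exists s2. split; [eapply E_while; eauto | easy].
Qed.

Lemma wp_while_end B e c (Q : state -> Prop) s :
  eval_ok B s e -> eval s e = 0 -> Q s -> wp B (While e c) Q s.
Proof. intros Hok He HQ. exists s. split; [now constructor | easy]. Qed.

(** The loop follows the finite derivation of [search], which already witnesses termination, so
    induction on it replaces a measure. *)
Lemma wp_search_loop B T K k gs tl C st w :
  let M := num_codes T K * num_codes T K in
  let E := M + 1 in
  big T K k B ->
  Forall (fun a => a < S T) (flat_map gate_code gs ++ tl) ->
  (forall i, input_valid K (nth i gs (GInput None))) ->
  (forall i, i < length gs -> wf_gate K (length gs) i (nth i gs (GInput None))) ->
  length gs <= E -> 1 <= C -> E ^ (4 * C) <= B ->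
  search (child T K gs) M st w -> forall s,
  env T K k (flat_map gate_code gs ++ tl) s ->
  s rW = num_codes T K -> s rM = M -> s rrun <> 0 -> search_regs st s E ->
  stack_ok T K gs C st ->
  (forall z m st1, st = (z, m) :: st1 -> forall f, In f st1 -> snd f < M) ->
  wp B (While (Var rrun) search_body) (fun s' => s' rres = Nat.b2n w) s.
Proof.
  intros M E HB Hcode Hin Hwf HgsE HC HBE Hsearch.
  induction Hsearch as [st w Hstep | st st' w Hstep Hsearch IH];
    intros s He EW EM Hrun Hs Hst Hlow; apply wp_while_step; try easy;
    (eapply wp_conseq; [apply (wp_search_body B T K k gs tl C st s); eauto|]);
    cbn beta; fold M E; rewrite Hstep; intros s1 (H1 & F).
  - destruct H1 as (H1 & H2). now apply wp_while_end.
  - destruct H1 as (H1 & H2).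
    destruct (search_step_ok T K gs C st st' Hwf Hlow Hst Hstep) as [Hst' Hlow'].
    apply IH; auto.
    + exact (env_same _ _ _ _ _ _ _ He F eq_refl).
    + now rewrite (F rW eq_refl).
    + now rewrite (F rM eq_refl).
    + now rewrite H1.
Qed.

(** The rank of the root is at most [2 * length gs + 1], so [C] bounds both the depth of the game
    and the height of the stack. *)
Lemma wp_search B T K k gs tl out p s b :
  let M := num_codes T K * num_codes T K in
  let E := M + 1 in
  let C := 2 * length gs + 2 in
  big T K k B ->
  Forall (fun a => a < S T) (flat_map gate_code gs ++ tl) ->
  (forall i, input_valid K (nth i gs (GInput None))) ->
  (forall i, i < length gs -> wf_gate K (length gs) i (nth i gs (GInput None))) ->
  length gs <= E -> E ^ (4 * C) <= B ->
  env T K k (flat_map gate_code gs ++ tl) s ->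
  out < length gs -> s rout = out -> s rpt = p -> p <= inf_code T K ->
  wins (child T K gs) M C (out, p, num_codes T K) = b ->
  wp B search_cmd (fun s' => s' rres = Nat.b2n b) s.
Proof.
  intros M E C HB Hcode Hin Hwf HgsE HBE He Hout Eout Ept Hp Hwins.
  pose proof He as (ET & ED & EI & Ek & EK & EG0).
  assert (HWM : num_codes T K <= M) by (unfold M, num_codes; nia).
  assert (HE2 : 1 < E) by (unfold E, num_codes in *; lia).
  assert (HEB : E <= B).
  { apply Nat.le_trans with (2 := HBE). rewrite <- (Nat.pow_1_r E) at 1.
    apply Nat.pow_le_mono_r; unfold C; lia. }
  assert (HW : inf_code T K + 2 = num_codes T K) by (unfold num_codes; lia).
  unfold search_cmd. wside.
  all: try (regs; rewrite HW; unfold E, M in *; lia).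
  all: try (regs; unfold E, num_codes in *; lia).
  apply (wp_search_loop B T K k gs tl C [((out, p, num_codes T K), 0)]); auto.
  - unfold C. lia.
  - apply (search_wins _ _ (rank T K (length gs))) with (d := C); [| |lia|].
    + intros z m z' Hm Hz. now apply (child_rank T K gs z m z').
    + cbn [rank]. rewrite Nat.eqb_refl. unfold C. cbn [Nat.b2n]. lia.
    + rewrite Nat.sub_0_r. replace C with (S (2 * length gs + 1)) in * by (unfold C; lia).
      cbn [pred]. change (existsb _ _) with
        (wins (child T K gs) M (S (2 * length gs + 1)) (out, p, num_codes T K)).
      rewrite Hwins. now destruct b.
  - xeval. lia.
  - xeval. lia.
  - unfold search_regs. xeval. regs. rewrite HW. cbn [encode_stack length]. repeat split; auto.
  - cbn [stack_ok pos_ok rank length]. rewrite Nat.eqb_refl. cbn [Nat.b2n].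
    unfold C, num_codes. repeat split; auto; lia.
  - intros z m st1 [= <- <- <-] f [].
Qed.

(** * Correctness of parsing and validation *)

Lemma bits_val_cons d x :
  bits_val true (d :: x) mod 2 = Nat.b2n d /\ bits_val true (d :: x) / 2 = bits_val true x.
Proof.
  cbn [bits_val]. rewrite (Nat.mul_comm 2).
  split; [rewrite Nat.Div0.mod_add | rewrite Nat.div_add by lia]; destruct d; cbn; lia.
Qed.

Lemma bits_val_total x : bits_val false x + bits_val true x + 1 = 2 ^ length x.
Proof.
  induction x as [|d x IH]; [easy|]. cbn [bits_val length]. rewrite Nat.pow_succ_r'.
  destruct d; cbn [Bool.eqb Nat.b2n]; lia.
Qed.

Lemma option_map_app {A} (l l' : list A) o :
  option_map (app l) (option_map (app l') o) = option_map (app (l ++ l')) o.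
Proof. destruct o as [r|]; [|easy]. cbn. now rewrite app_assoc. Qed.

(** The bound on [(acc + 1) * 2 ^ length y] keeps every token below [N]: a digit at most doubles
    [acc + 1] but consumes two bits. The result [p] of the whole parse is constant, being expressed
    by the tokens found and the parse of the rest. *)
Lemma wp_parse_body B n N D ok0 y l acc p s :
  2 <= N -> N * N < D -> D ^ (n + 4) <= B -> y <> [] ->
  s rD = D -> s rX = bits_val true y -> s rY = 2 ^ length y -> s racc = acc ->
  s rA = pack D l -> s rP = D ^ length l -> s rlen = length l -> s rok = Nat.b2n ok0 ->
  length l + length y <= n -> (acc + 1) * 2 ^ length y <= N -> Forall (fun a => a < N) l ->
  p = (if ok0 then option_map (app l) (parse y acc) else None) ->
  wp B parse_body (fun s' => (exists ok' y' l' acc', length y' < length y /\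
    s' rX = bits_val true y' /\ s' rY = 2 ^ length y' /\ s' racc = acc' /\
    s' rA = pack D l' /\ s' rP = D ^ length l' /\ s' rlen = length l' /\ s' rok = Nat.b2n ok' /\
    length l' + length y' <= n /\ (acc' + 1) * 2 ^ length y' <= N /\ Forall (fun a => a < N) l' /\
    p = (if ok' then option_map (app l') (parse y' acc') else None)) /\
    same_except parse_body s s') s.
Proof.
  intros HN HD HB Hy ED EX EY Eacc EA EP El Eok Hlen Hacc Hl Hp. apply wp_frame.
  assert (HD1 : 1 < D) by nia.
  assert (Hpow : forall j, j <= n + 4 -> D ^ j <= B).
  { intros j Hj. apply Nat.le_trans with (2 := HB). apply Nat.pow_le_mono_r; lia. }
  assert (HB4 : 2 ^ 4 <= B).
  { apply Nat.le_trans with (D ^ 4); [apply Nat.pow_le_mono_l; lia | apply Hpow; lia]. }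
  change (2 ^ 4) with 16 in HB4.
  assert (HDB : D <= B) by (rewrite <- (Nat.pow_1_r D); apply Hpow; lia).
  assert (HnB : n + 4 < B).
  { apply Nat.lt_le_trans with (2 := HB). apply Nat.pow_gt_lin_r. lia. }
  destruct y as [|d1 y]; [easy|]. destruct (bits_val_cons d1 y) as [X1 X2].
  unfold parse_body. do 8 (wstep; try solve [side]).
  destruct y as [|d2 y].
  { cbn [length] in *. if_true. wside. exists false, [], l, acc. xeval. regs. rewrite X2.
    cbn [length bits_val] in *. repeat apply conj; auto; try lia.
    { cbn [Nat.pow] in *. lia. } rewrite Hp. destruct ok0; [|easy]. now destruct d1. }
  destruct (bits_val_cons d2 y) as [X3 X4].
  assert (EY4 : 2 ^ length (d1 :: d2 :: y) / 4 = 2 ^ length y).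
  { cbn [length]. rewrite !Nat.pow_succ_r', Nat.mul_assoc, Nat.mul_comm.
    now apply Nat.div_mul. }
  assert (EYp : 2 ^ length (d1 :: d2 :: y) = 4 * 2 ^ length y)
    by (cbn [length]; rewrite !Nat.pow_succ_r'; lia).
  pose proof (Nat.pow_nonzero 2 (length y)) as Hnz.
  assert (HaccN : 2 * acc + 2 <= N) by nia.
  assert (HND : N <= N * N) by nia.
  pose proof (b2n_le1 d2) as Hd2.
  assert (Hl' : Forall (fun a => a < D) l)
    by (revert Hl; apply Forall_impl; intros; lia).
  pose proof (pack_bound D l Hl') as Hpk.
  assert (HPD : D ^ length l * D <= B).
  { rewrite Nat.mul_comm, <- Nat.pow_succ_r'. cbn [length] in Hlen. apply Hpow. lia. }
  if_false.
  { apply b2n_eq0, Nat.eqb_neq. lia. }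
  do 2 (wstep; try solve [side]).
  rewrite EX, X1, X2, X3, X4, EY, EY4.
  assert (Hfin : (acc + 1) * 2 ^ length y <= N) by nia.
  cbn [length] in Hlen. cbn [parse] in Hp.
  destruct d1; [if_true | if_false].
  - destruct d2; [if_true | if_false]; wside.
    + regs. rewrite Nat.mul_comm.
      assert (D ^ length l * acc <= D ^ length l * D) by (apply Nat.mul_le_mono_l; lia). lia.
    + regs. assert (acc * D ^ length l + D ^ length l <= D * D ^ length l) by nia. lia.
    + exists ok0, y, (l ++ [acc]), 0. xeval. regs. rewrite length_app, pack_app.
      cbn [length pack]. rewrite Nat.add_1_r, Nat.pow_succ_r'.
      repeat apply conj; auto; try lia.
      * apply Forall_app. split; [easy|]. constructor; [lia | easy].
      * rewrite Hp. destruct ok0; [|easy].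
        rewrite <- (option_map_app l [acc]). now destruct (parse y 0).
    + exists false, y, l, acc. xeval. regs. cbn [length].
      repeat apply conj; auto; try lia. rewrite Hp. now destruct ok0.
  - wside.
    + exists ok0, y, l, (2 * acc + Nat.b2n d2). xeval. regs. cbn [length].
      repeat apply conj; auto; try lia.
      * nia.
      * rewrite Hp. revert Hif. regs. intros Hif. apply Nat.eqb_neq in Hif. now rewrite Hif.
    + exists false, y, l, acc. xeval. regs. cbn [length].
      repeat apply conj; auto; try lia.
      revert Hif. regs. intros Hif. rewrite Hp, Hif. now destruct ok0.
Qed.

Lemma wp_parse B x s :
  let N := 2 ^ length x in
  let T := N * N in
  S T ^ (length x + 4) <= B -> s rF = bits_val false x -> s rT = bits_val true x ->
  wp B parse_cmd (fun s' => s' rThr = T /\ s' rD = S T /\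
    match parse x 0 with
    | Some l => s' rok = 1 /\ s' rA = pack (S T) l /\ s' rlen = length l
    | None => s' rok = 0
    end) s.
Proof.
  intros N T HB EF ET.
  assert (HN0 : N <> 0) by (apply Nat.pow_nonzero; lia).
  assert (HNT : N <= T) by (unfold T; nia).
  pose proof (bits_val_total x) as Hx. fold N in Hx.
  assert (HTB : S T <= B).
  { apply Nat.le_trans with (2 := HB). rewrite <- (Nat.pow_1_r (S T)) at 1.
    apply Nat.pow_le_mono_r; lia. }
  assert (HB4 : 2 ^ 4 <= B).
  { apply Nat.le_trans with (2 := HB). apply Nat.le_trans with (S T ^ 4).
    - apply Nat.pow_le_mono_l. lia.
    - apply Nat.pow_le_mono_r; lia. }
  change (2 ^ 4) with 16 in HB4.
  assert (EN : s rF + s rT + 1 = N) by (rewrite EF, ET; exact Hx).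
  unfold parse_cmd. do 2 (wstep; try solve [side]). rewrite EN.
  do 2 (wstep; try solve [side]). fold T.
  do 17 (wstep; try solve [side]).
  set (I := fun (g : bool * list bool * list nat * nat) (s' : state) =>
    let '(ok, y, l, acc) := g in
    s' rThr = T /\ s' rD = S T /\
    s' rX = bits_val true y /\ s' rY = 2 ^ length y /\ s' racc = acc /\
    s' rA = pack (S T) l /\ s' rP = S T ^ length l /\ s' rlen = length l /\
    s' rok = Nat.b2n ok /\
    length l + length y <= length x /\ (acc + 1) * 2 ^ length y <= N /\
    Forall (fun a => a < N) l /\
    parse x 0 = (if ok then option_map (app l) (parse y acc) else None)).
  apply (wp_while _ _ _ I (fun g => let '(_, y, _, _) := g in length y)) with (a := (true, x, [], 0)).
  - intros. ok_split; lia.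
  - intros [[[ok y] l] acc] s1 (E1 & E2 & E3 & E4 & E5 & E6 & E7 & E8 & E9 & E10 & E11 & E12 & E13).
    xeval. rewrite E4. intros Hc. apply b2n_neq0, Nat.ltb_lt in Hc.
    assert (Hy : y <> []) by (intros ->; cbn in Hc; lia).
    assert (HN2 : 2 <= N).
    { destruct y as [|d y]; [easy|]. cbn [length] in E11. rewrite Nat.pow_succ_r' in E11.
      pose proof (Nat.pow_nonzero 2 (length y)). nia. }
    eapply wp_conseq.
    { apply (wp_parse_body B (length x) N (S T) ok y l acc (parse x 0)); auto. }
    cbn beta. intros s2 ((ok' & y' & l' & acc' & Hlt & F3 & F4 & F5 & F6 & F7 & F8 & F9 & F10
                          & F11 & F12 & F13) & F).
    exists (ok', y', l', acc'). split; [easy|].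
    unfold I. rewrite (F rThr eq_refl), (F rD eq_refl). auto 15.
  - intros [[[ok y] l] acc] s1 (E1 & E2 & E3 & E4 & E5 & E6 & E7 & E8 & E9 & E10 & E11 & E12 & E13).
    xeval. rewrite E4. intros Hc. apply b2n_eq0, Nat.ltb_ge in Hc.
    destruct y as [|d y].
    2: { cbn [length] in Hc. rewrite Nat.pow_succ_r' in Hc.
         pose proof (Nat.pow_nonzero 2 (length y)). lia. }
    wside. rewrite E1, E2. split; [easy|]. split; [easy|]. regs. rewrite E13.
    destruct ok; cbn [parse option_map].
    + destruct (Nat.eqb_spec acc 0); cbn; [|easy]. now rewrite app_nil_r.
    + easy.
  - unfold I. xeval. cbn [length pack Nat.pow Nat.b2n Nat.add]. repeat apply conj; auto.
    + lia.
    + fold N. lia.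
    + now destruct (parse x 0).
Qed.

Lemma wp_header B D l s :
  s rD = D -> s rA = pack D l -> s rlen = length l -> Forall (fun a => a < D) l ->
  1 < D -> 5 <= B -> D ^ (length l + 2) <= B ->
  wp B header_cmd (fun s' =>
    let k := nth 0 l 0 in
    let K := reduced_dim k (length l) in
    (s' rok = Nat.b2n ((3 <=? length l) && ((1 <=? k) && (nth 2 l 0 <? nth 1 l 0))) /\
    s' rk = k /\ s' rn = nth 1 l 0 /\ s' rout = nth 2 l 0 /\ s' rK = K /\ s' rInf = D ^ K /\
    s' rG0 = pack D (skipn 3 l) /\ s' rG = pack D (skipn 3 l) /\
    s' rrem = length l - 3 /\ s' ri = 0) /\ same_except header_cmd s s') s.
Proof.
  intros ED EA El Hl HD HB5 HB. apply wp_frame. cbn zeta.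
  destruct (pack_nth D l 0 ltac:(lia) Hl) as [A0 B0].
  destruct (pack_nth D l 1 ltac:(lia) Hl) as [A1 B1].
  destruct (pack_nth D l 2 ltac:(lia) Hl) as [A2 B2].
  rewrite skipn_O in A0, B0.
  unfold header_cmd. do 8 (wstep; try solve [side]).
  set (k := nth 0 l 0) in *. set (K := reduced_dim k (length l)).
  (* The dimension falls back to 1 even when there are no tokens, hence the added 1. *)
  assert (HK : K <= length l + 1) by (unfold K, reduced_dim; destruct (Nat.leb_spec k (length l)); lia).
  rewrite EA, ED, El, B0, B1, A0, A1, A2, !b2n_and.
  set (ok := _ && _). wstep.
  apply wp_conseq with (fun s' => s' rK = K /\ s' rok = Nat.b2n ok /\ s' rk = k /\
    s' rn = nth 1 l 0 /\ s' rout = nth 2 l 0 /\ s' rD = D /\ s' rA = pack D l /\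
    s' rlen = length l).
  { wside; unfold K, reduced_dim; revert Hif; regs; intros Hif;
      [apply b2n_neq0 in Hif | apply b2n_eq0 in Hif]; rewrite Hif; auto 10. }
  clear s ED EA El. intros s (EK & Eok & Ek & En & Eout & ED & EA & El).
  do 5 (wstep; try solve [side]).
  set (I := fun j s' => j <= K /\ s' rcnt = j /\ s' rInf = D ^ (K - j) /\
    s' rK = K /\ s' rok = Nat.b2n ok /\ s' rk = k /\
    s' rn = nth 1 l 0 /\ s' rout = nth 2 l 0 /\ s' rD = D /\ s' rA = pack D l /\
    s' rlen = length l).
  apply (wp_while _ _ _ I (fun j => j)) with (a := K).
  - intros; exact Logic.I.
  - intros j s1 (Hj & E1 & E2 & E3 & E4 & E5 & E6 & E7 & E8 & E9 & E10). xeval. intros Hz.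
    assert (Hp : D ^ (K - j) * D = D ^ (K - (j - 1))).
    { replace (K - (j - 1)) with (S (K - j)) by lia. rewrite Nat.pow_succ_r'. lia. }
    wside.
    { regs. rewrite Hp. apply Nat.le_trans with (2 := HB). apply Nat.pow_le_mono_r; lia. }
    exists (j - 1). split; [lia|]. unfold I. xeval. regs. repeat apply conj; auto; lia.
  - intros j s1 (Hj & E1 & E2 & E3 & E4 & E5 & E6 & E7 & E8 & E9 & E10). xeval. intros Hz.
    wside. xeval. regs. rewrite B0, B1, B2. repeat apply conj; auto.
    replace (K - j) with K by lia. reflexivity.
  - unfold I. xeval. rewrite Nat.sub_diag. auto 15.
Qed.

(** Links the pattern match to the arithmetic test, which reads three tokens with default 0. If
    tokens are missing, the size comparison fails whatever the defaults suggest. *)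
Lemma take_gate_head k n i r :
  match take_gate k r with Some (g, _) => gate_okb n i g | None => false end =
  (let c := nth 0 r 0 in
   let f1 := nth 1 r 0 in
   let f2 := nth 2 r 0 in
   (if c =? 0 then f1 <=? 1
    else if c =? 1 then (i <? f1) && (f1 <? n)
    else (c <=? 5) && (((i <? f1) && (f1 <? n)) && ((i <? f2) && (f2 <? n)))) &&
   (head_size k c f1 <=? length r)).
Proof.
  cbn zeta.
  destruct r as [|c r]; [reflexivity|].
  destruct c as [|[|c]].
  - destruct r as [|[|[|f]] r]; cbn [take_gate nth Nat.eqb head_size length]; try reflexivity.
    + cbn [gate_okb]. unfold head_size. cbn [Nat.eqb andb Nat.leb].
      destruct (Nat.leb_spec k (length r)), (Nat.leb_spec (k + 2) (S (S (length r)))); try lia;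
        reflexivity.
  - destruct r as [|f r]; cbn [take_gate nth length]; unfold head_size; cbn [Nat.eqb Nat.leb].
    + now rewrite andb_false_r.
    + now rewrite andb_true_r.
  - destruct r as [|f1 [|f2 r]].
    + cbn [nth length]. unfold head_size. cbn [Nat.eqb Nat.leb]. rewrite andb_false_r.
      destruct c as [|[|[|[|c]]]]; reflexivity.
    + cbn [nth length]. unfold head_size. cbn [Nat.eqb Nat.leb]. rewrite andb_false_r.
      destruct c as [|[|[|[|c]]]]; reflexivity.
    + cbn [nth length]. unfold head_size. cbn [Nat.eqb Nat.leb]. rewrite andb_true_r.
      destruct c as [|[|[|[|c]]]]; reflexivity.
Qed.

Lemma head_size_gate k g r : input_valid k g ->
  head_size k (nth 0 (gate_code g ++ r) 0) (nth 1 (gate_code g ++ r) 0) = length (gate_code g).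
Proof.
  destruct g as [[v|] | j | o j1 j2]; cbn; intros Hv; try reflexivity.
  - unfold head_size. cbn [Nat.eqb]. lia.
  - now destruct o.
Qed.

Lemma wp_validate_body B D K k n i len r s :
  s rD = D -> s rInf = D ^ K -> s rk = k -> s rn = n -> s ri = i ->
  s rG = pack D r -> s rrem = length r -> Forall (fun a => a < D) r ->
  K = reduced_dim k len -> length r <= len ->
  1 < D -> 5 <= B -> D * D * D <= B -> D * D * D ^ K <= B -> k + 2 <= B -> i < B ->
  wp B validate_body (fun s' =>
    s' ri = i + 1 /\
    match take_gate k r with
    | Some (g, r') => s' rok = Nat.b2n (gate_okb n i g) /\ s' rG = pack D r' /\ s' rrem = length r'
    | None => s' rok = 0
    end /\ same_except validate_body s s') s.
Proof.
  intros ED EI Ek En Ei EG Erem Hr HK Hlen HD HB5 HB1 HB2 HB3 HB4.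
  apply wp_conseq with (fun s' => (s' ri = i + 1 /\
    match take_gate k r with
    | Some (g, r') => s' rok = Nat.b2n (gate_okb n i g) /\ s' rG = pack D r' /\ s' rrem = length r'
    | None => s' rok = 0
    end) /\ same_except validate_body s s'); [|tauto].
  apply wp_frame. unfold validate_body. wstep.
  eapply wp_conseq; [apply (wp_head B D (D ^ K) k r s); auto; lia|].
  cbn beta. intros s1 ((F1 & F2 & F3 & F4 & F5) & F).
  rewrite <- (F rD eq_refl) in ED. rewrite <- (F rInf eq_refl) in EI.
  rewrite <- (F rk eq_refl) in Ek. rewrite <- (F rn eq_refl) in En.
  rewrite <- (F ri eq_refl) in Ei. rewrite <- (F rG eq_refl) in EG.
  rewrite <- (F rrem eq_refl) in Erem. clear F.
  pose proof (take_gate_head k n i r) as Hhead. cbn zeta in Hhead.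
  set (c := nth 0 r 0) in *. set (f1 := nth 1 r 0) in *. set (f2 := nth 2 r 0) in *.
  wstep.
  apply wp_conseq with (fun s' => s' rok = Nat.b2n (if c =? 0 then f1 <=? 1
    else if c =? 1 then (i <? f1) && (f1 <? n)
    else (c <=? 5) && (((i <? f1) && (f1 <? n)) && ((i <? f2) && (f2 <? n)))) /\
    s' rz = s1 rz /\ s' rrem = s1 rrem /\ s' rG = s1 rG /\ s' rQ = s1 rQ /\ s' ri = s1 ri).
  { wside; xeval; revert Hif; try revert Hif0; regs; rewrite ?b2n_and; intros.
    - apply Nat.eqb_neq in Hif. apply b2n_neq0 in Hif0. rewrite Hif, Hif0. auto 10.
    - apply Nat.eqb_neq in Hif. apply b2n_eq0 in Hif0. rewrite Hif, Hif0. auto 10.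
    - apply Nat.eqb_eq in Hif. rewrite Hif. auto 10. }
  intros s2 (G1 & G2 & G3 & G4 & G5 & G6).
  rewrite F5 in G2. rewrite Erem in G3. rewrite EG in G4. rewrite F4 in G5. rewrite Ei in G6.
  assert (HQ : s2 rQ <> 0).
  { rewrite G5. unfold strip. assert (D ^ K <> 0) by (apply Nat.pow_nonzero; lia).
    destruct (_ =? 0); [destruct (_ =? 0) | destruct (_ =? 1)];
      repeat (apply Nat.neq_mul_0; split); lia. }
  wside; try lia.
  xeval. rewrite G1, G2, G3, G4, G5, G6, b2n_and. split; [easy|].
  rewrite <- Hhead. destruct (take_gate k r) as [[g r']|] eqn:Et; [|easy].
  apply take_gate_sound in Et as [-> Hv]. split; [easy|]. unfold c, f1.
  rewrite head_size_gate, length_app by easy. split; [|lia].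
  apply strip_gate; [easy|]. destruct g as [[v|] | |]; try easy. cbn in *.
  (* A finite point that fits into the remaining tokens has [k <= len], so the dimension was not
     reduced and [strip] removes exactly its coordinates. *)
  rewrite HK. unfold reduced_dim. rewrite length_app in Hlen.
  replace (k <=? len) with true; [easy|]. symmetry. apply Nat.leb_le. lia.
Qed.

Lemma wp_validate B D K k n len r s :
  s rD = D -> s rInf = D ^ K -> s rk = k -> s rn = n -> s ri = 0 -> s rok = 1 ->
  s rG = pack D r -> s rrem = length r -> Forall (fun a => a < D) r ->
  K = reduced_dim k len -> length r <= len ->
  1 < D -> 5 <= B -> D * D * D <= B -> D * D * D ^ K <= B -> k + 2 <= B -> n < B ->
  wp B (While ($rok * ($ri < $rn))%cmd validate_body) (fun s' =>
    match parse_gates k n n r with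
    | Some (_, r') => s' rok = 1 /\ s' rG = pack D r' /\ s' rrem = length r'
    | None => s' rok = 0
    end /\ same_except validate_body s s') s.
Proof.
  intros ED EI Ek En Ei Eok EG Erem Hr HK Hlen HD HB5 HB1 HB2 HB3 HB4.
  apply wp_frame with (c := While ($rok * ($ri < $rn))%cmd validate_body).
  set (I := fun m s' =>
    s' rD = D /\ s' rInf = D ^ K /\ s' rk = k /\ s' rn = n /\ m <= n /\
    ((s' rok = 0 /\ parse_gates k n n r = None) \/
     (s' rok = 1 /\ s' ri = n - m /\ exists gs0 r1,
      s' rG = pack D r1 /\ s' rrem = length r1 /\ Forall (fun a => a < D) r1 /\
      length r1 <= len /\ parse_gates k n n r =
      option_map (fun p => (gs0 ++ fst p, snd p)) (parse_gates k n m r1)))).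
  apply (wp_while _ _ _ I (fun j => j)) with (a := n).
  - intros m s1 (_ & _ & _ & _ & _ & [(Hok & _) | (Hok & _)]); ok_split; rewrite ?Hok;
      pose proof (b2n_le1 (s1 ri <? s1 rn)); lia.
  - intros m s1 (E1 & E2 & E3 & E4 & Hm & [(Hok & _) | (Hok & E5 & gs0 & r1 & E6 & E7 & E8 & E9 & E10)]);
      xeval; rewrite Hok; [lia|]. intros Hc.
    assert (Hlt : s1 ri < s1 rn).
    { apply Nat.ltb_lt, b2n_neq0. lia. }
    destruct m as [|m]; [lia|].
    eapply wp_conseq.
    { apply (wp_validate_body B D K k n (n - S m) len r1 s1); auto; lia. }
    cbn beta. intros s2 (Ei2 & H2 & F).
    exists m. split; [lia|]. unfold I.
    rewrite (F rD eq_refl), (F rInf eq_refl), (F rk eq_refl), (F rn eq_refl).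
    do 4 (split; [easy|]). split; [lia|].
    cbn [parse_gates] in E10.
    destruct (take_gate k r1) as [[g r2]|] eqn:Et.
    + destruct H2 as (Hok2 & HG2 & Hrem2). apply take_gate_sound in Et as [-> _].
      destruct (gate_okb n (n - S m) g).
      * right. split; [easy|]. split; [lia|]. exists (gs0 ++ [g]), r2.
        rewrite length_app in E9. apply Forall_app in E8.
        do 2 (split; [easy|]). split; [easy|]. split; [lia|].
        rewrite E10. destruct (parse_gates k n m r2) as [[gs' r']|]; [|easy].
        cbn. now rewrite <- app_assoc.
      * left. auto.
    + left. auto.
  - intros m s1 (E1 & E2 & E3 & E4 & Hm & [(Hok & Hp) | (Hok & E5 & gs0 & r1 & E6 & E7 & E8 & E9 & E10)]);
      xeval; rewrite Hok; intros Hc.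
    + now rewrite Hp.
    + rewrite Nat.mul_1_l in Hc. apply b2n_eq0, Nat.ltb_ge in Hc.
      assert (m = 0) as -> by lia. rewrite E10. cbn. auto.
  - unfold I. repeat split; auto. right. repeat split; auto; [lia|]. exists [], r.
    repeat split; auto. destruct (parse_gates k n n r) as [[? ?]|]; reflexivity.
Qed.

(** After the tag, the rest of the packed token list is itself the code of the queried point. *)
Lemma wp_point B T K k len r s :
  s rD = S T -> s rInf = inf_code T K -> s rk = k -> s rG = pack (S T) r -> s rrem = length r ->
  Forall (fun a => a < S T) r -> K = reduced_dim k len -> 5 <= B -> k + 2 <= B ->
  wp B point_cmd (fun s' =>
    match parse_point k r with
    | Some b => s' rok = 1 /\ s' rpt = encode T K b
    | None => s' rok = 0
    end /\ same_except point_cmd s s') s.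
Proof.
  intros ED EI Ek EG Erem Hr HK HB1 HB2. apply wp_frame.
  destruct (pack_nth (S T) r 0 ltac:(lia) Hr) as [A0 B0]. rewrite skipn_O in A0, B0.
  unfold point_cmd. wside; xeval; revert Hif; regs; intros Hif; rewrite ?A0, ?B0 in *.
  - destruct r as [|c r]; [easy|]. cbn [nth skipn] in *. rewrite b2n_and.
    destruct c as [|[|c]]; [easy | |reflexivity]. cbn [parse_point Nat.eqb length].
    rewrite Nat.add_1_r. cbn [Nat.eqb andb].
    destruct (length r =? k); cbn; auto.
  - destruct r as [|c [|d r]]; cbn [nth length Nat.eqb] in *; try subst c; cbn; auto.
Qed.

(** The base [T + 1] is at most [2 ^ (2 * n + 1)]. The largest number is the stack: at most
    [8 * n + 8] digits in a base [E] of at most [(T + 1) ^ (2 * n + 3)]; the 6 is slack for the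
    smaller quantities. The final 1 absorbs the subtraction in [2 ^ h - 1]. *)
Definition bit_bound (n : nat) : nat := (2 * n + 1) * ((2 * n + 6) * (8 * n + 8)) + 1.

Lemma bit_bound_spec n :
  S (2 ^ n * 2 ^ n) ^ ((2 * n + 6) * (8 * n + 8)) <= 2 ^ bit_bound n - 1.
Proof.
  set (e := (2 * n + 6) * (8 * n + 8)).
  assert (H1 : S (2 ^ n * 2 ^ n) <= 2 ^ (2 * n + 1)).
  { replace (2 * n + 1) with (S (n + n)) by lia. rewrite Nat.pow_succ_r', Nat.pow_add_r.
    pose proof (Nat.pow_nonzero 2 n). nia. }
  apply (Nat.pow_le_mono_l _ _ e) in H1. rewrite <- Nat.pow_mul_r in H1.
  unfold bit_bound. fold e. rewrite Nat.add_1_r, Nat.pow_succ_r'.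
  pose proof (Nat.pow_nonzero 2 ((2 * n + 1) * e)). lia.
Qed.

Lemma wins_circuit T0 T K C b d :
  wf_circuit K C -> valid K b -> inputs_ok K T0 (c_gates C) ->
  (forall v, b = Some v -> Forall (fun x => x < T0) v) ->
  T0 * 2 ^ length (c_gates C) <= T -> 2 * length (c_gates C) <= d ->
  wins (child T K (c_gates C)) (num_codes T K * num_codes T K) d
    (c_out C, encode T K b, num_codes T K) = true <-> circ_sem K C b.
Proof.
  intros (HK & Hout & Hwf) Hb Hin HbT HT Hd.
  assert (HT0 : T0 <= T).
  { pose proof (Nat.pow_nonzero 2 (length (c_gates C))). nia. }
  destruct (decode_encode T K b Hb) as [Hdec Hle].
  { intros v E. specialize (HbT v E). revert HbT. apply Forall_impl. intros; lia. }
  unfold circ_sem. rewrite <- Hdec at 2.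
  apply (wins_gate T0); auto; lia.
Qed.

Lemma wp_decide x :
  wp (2 ^ bit_bound (length x) - 1) decide_cmd (fun s' => s' rres <> 0 <-> MC_star x)
    (init_state x).
Proof.
  set (B := 2 ^ bit_bound (length x) - 1). set (n := length x).
  set (N := 2 ^ n). set (T := N * N).
  pose proof (bit_bound_spec n : S T ^ ((2 * n + 6) * (8 * n + 8)) <= B) as HB.
  assert (HN0 : N <> 0) by (apply Nat.pow_nonzero; lia).
  assert (HT1 : 2 <= S T) by (unfold T; nia).
  assert (Hpow : forall e, e <= (2 * n + 6) * (8 * n + 8) -> S T ^ e <= B).
  { intros e He. apply Nat.le_trans with (2 := HB). apply Nat.pow_le_mono_r; lia. }
  assert (HB5 : 2 ^ 4 <= B).
  { apply Nat.le_trans with (S T ^ 4); [apply Nat.pow_le_mono_l; lia | apply Hpow; lia]. }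
  change (2 ^ 4) with 16 in HB5.
  apply wp_conseq with (fun s' => s' rres <> 0 <-> exists l k C b,
    parse x 0 = Some l /\ decode_instance l = Some (k, C, b) /\ circ_sem k C b);
    [|intros s' Hs'; now rewrite MC_star_spec].
  unfold decide_cmd. do 3 (wstep; try solve [side]).
  eapply wp_conseq.
  { apply (wp_parse B x); auto. apply Hpow. fold n. lia. }
  cbn beta. fold n N T. intros s1 (ET1 & ED1 & H1).
  destruct (parse x 0) as [l|] eqn:Hparse.
  2: { if_false. wside. xeval. split; [easy|]. now intros (l & k & C & b & ? & _). }
  destruct H1 as (Eok1 & EA1 & Elen1).
  assert (Hlbound : length l <= n /\ Forall (fun a => a < N) l).
  { pose proof (parse_sound x 0 l Hparse) as Ex. cbn in Ex. unfold N, n. rewrite Ex.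
    apply enc_nats_bound. }
  destruct Hlbound as [Hln HlN].
  assert (HNT : N <= T) by (unfold T; nia).
  assert (HlT : Forall (fun a => a < S T) l).
  { revert HlN. apply Forall_impl. intros. lia. }
  assert (Hgoal : forall w, (w = true <-> exists k C b, decode_instance l = Some (k, C, b) /\
                                                        circ_sem k C b) ->
    forall v, v = Nat.b2n w -> v <> 0 <-> exists l0 k C b, Some l = Some l0 /\
      decode_instance l0 = Some (k, C, b) /\ circ_sem k C b).
  { intros w Hw v ->. rewrite b2n_neq0, Hw. split.
    - intros (k & C & b & H). exists l, k, C, b. auto.
    - intros (l0 & k & C & b & [= <-] & H). eauto. }
  assert (Hreject : decode_instance l = None -> 0 <> 0 <-> exists l0 k C b, Some l = Some l0 /\
      decode_instance l0 = Some (k, C, b) /\ circ_sem k C b).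
  { intros Hn. apply (Hgoal false); [|easy]. rewrite Hn. split; [easy|].
    now intros (k & C & b & ? & _). }
  if_true. wstep. eapply wp_conseq.
  { apply (wp_header B (S T) l); auto; [lia | apply Hpow; lia]. }
  cbn beta zeta. intros s2 ((Eok & Ek & En & Eout & EK & EI & EG0 & EG & Erem & Ei) & F2).
  rewrite <- (F2 rThr eq_refl) in ET1. rewrite <- (F2 rD eq_refl) in ED1.
  clear F2 EA1 Elen1 Eok1 s1.
  set (k := nth 0 l 0) in *. set (K := reduced_dim k (length l)) in *.
  destruct ((3 <=? length l) && ((1 <=? k) && (nth 2 l 0 <? nth 1 l 0))) eqn:Hhead.
  2: { wstep. apply wp_while_end; [ok_split; regs; cbn [Nat.b2n]; lia | xeval; regs; reflexivity |].
       if_false. wside. apply Hreject.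
       destruct l as [|k0 [|n0 [|out0 r]]]; try easy. cbn [length nth Nat.leb andb] in Hhead.
       cbn [decode_instance]. unfold k in Hhead. cbn [nth] in Hhead. cbn [Nat.leb] in *.
       now rewrite Hhead. }
  destruct l as [|k0 [|n0 [|out0 r]]]; try easy.
  cbn [length nth Nat.leb andb Nat.b2n] in *. subst k. set (k := k0) in *.
  assert (Hh : (1 <=? k) && (out0 <? n0) = true) by exact Hhead.
  cbn [skipn] in *.
  pose proof (Forall_inv HlT) as Hk0.
  pose proof (Forall_inv (Forall_inv_tail HlT)) as Hn0.
  pose proof (Forall_inv_tail (Forall_inv_tail (Forall_inv_tail HlT))) as HlT3.
  cbn beta in Hk0, Hn0.
  assert (HK1 : K <= n /\ (K = k \/ K = 1)).
  { unfold K, reduced_dim. destruct (Nat.leb_spec k (S (S (S (length r))))); lia. }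
  assert (HT3 : 3 <= S T).
  { unfold T, N. destruct n; [lia|]. rewrite Nat.pow_succ_r'.
    pose proof (Nat.pow_nonzero 2 n). nia. }
  assert (HKB : S T * S T * S T * (2 + inf_code T K) <= B).
  { apply Nat.le_trans with (S T ^ (K + 4)); [|apply Hpow; lia].
    replace (K + 4) with (S (S (S (S K)))) by lia. rewrite !Nat.pow_succ_r'.
    fold (inf_code T K). assert (inf_code T K <> 0) by (apply Nat.pow_nonzero; lia).
    assert (2 + inf_code T K <= S T * inf_code T K) by nia.
    rewrite <- !Nat.mul_assoc. repeat apply Nat.mul_le_mono_l. lia. }
  assert (HTB : S T * S T <= B).
  { replace (S T * S T) with (S T ^ 2) by (cbn; lia). apply Hpow. lia. }
  assert (Hbig : big T K k B).
  { assert (S T * 3 <= S T * S T) by (apply Nat.mul_le_mono_l; lia).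
    unfold big. split; [lia|]. split; [lia | exact HKB]. }
  destruct (big_facts _ _ _ _ Hbig) as (_ & B2 & _ & _ & B4 & B5 & _ & B7).
  wstep. eapply wp_conseq.
  { apply (wp_validate B (S T) K k n0 (S (S (S (length r)))) r s2); auto; lia || nia. }
  cbn beta. intros s3 (Hval & F).
  rewrite <- (F rThr eq_refl) in ET1. rewrite <- (F rD eq_refl) in ED1.
  rewrite <- (F rk eq_refl) in Ek. rewrite <- (F rn eq_refl) in En.
  rewrite <- (F rout eq_refl) in Eout. rewrite <- (F rK eq_refl) in EK.
  rewrite <- (F rInf eq_refl) in EI. rewrite <- (F rG0 eq_refl) in EG0. clear F EG Erem Ei Eok s2.
  destruct (parse_gates k n0 n0 r) as [[gs r']|] eqn:Hgates.
  2: { if_false. wside. apply Hreject. cbn [decode_instance].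
       now rewrite Hh, Hgates. }
  destruct Hval as (Eok & EG & Erem). if_true. wstep.
  pose proof (parse_gates_sound k n0 n0 r gs r' (le_n _) Hgates) as (Er & Hgs & Hwf).
  assert (Hr' : Forall (fun a => a < S T) r') by (rewrite Er in HlT3; now apply Forall_app in HlT3).
  eapply wp_conseq.
  { apply (wp_point B T K k (S (S (S (length r)))) r' s3); auto; lia. }
  cbn beta. intros s4 (Hpt & F).
  rewrite <- (F rThr eq_refl) in ET1. rewrite <- (F rD eq_refl) in ED1.
  rewrite <- (F rk eq_refl) in Ek. rewrite <- (F rn eq_refl) in En.
  rewrite <- (F rout eq_refl) in Eout. rewrite <- (F rK eq_refl) in EK.
  rewrite <- (F rInf eq_refl) in EI. rewrite <- (F rG0 eq_refl) in EG0. clear F EG Erem Eok s3.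
  destruct (parse_point k r') as [b|] eqn:Hpoint.
  2: { if_false. wside. apply Hreject. cbn [decode_instance].
       now rewrite Hh, Hgates, Hpoint. }
  destruct Hpt as (Eok & Ept). if_true.
  assert (Hdec : decode_instance (k :: n0 :: out0 :: r) = Some (k, mkCircuit gs out0, b)).
  { cbn [decode_instance]. now rewrite Hh, Hgates, Hpoint. }
  destruct (reduced_dim_spec _ _ _ _ K Hdec eq_refl) as (HKge & HwfK & HbK & Hsem & _).
  pose proof HwfK as (_ & HoutK & HwfG). cbn [c_gates c_out] in *.
  assert (HrN : Forall (fun a => a < N) r).
  { do 3 apply Forall_inv_tail in HlN. exact HlN. }
  assert (Hin : inputs_ok K N gs).
  { intros i e Ee. destruct (le_lt_dec (length gs) i) as [Hi | Hi].
    { rewrite nth_overflow in Ee by easy. now injection Ee as <-. }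
    pose proof (HwfG i Hi) as Hv. rewrite Ee in Hv. split; [exact Hv|].
    intros v ->. rewrite Er in HrN. apply Forall_app in HrN as [HrN _].
    rewrite Forall_forall in HrN |- *. intros a Ha. apply HrN. apply in_flat_map.
    exists (GInput (Some v)). split; [rewrite <- Ee; now apply nth_In|]. cbn. auto. }
  assert (HbN : forall v, b = Some v -> Forall (fun a => a < N) v).
  { intros v ->. apply parse_point_spec in Hpoint as [-> _]. rewrite Er in HrN.
    apply Forall_app in HrN as [_ HrN]. now apply Forall_inv_tail in HrN. }
  assert (Hgsn : length gs <= n).
  { assert (Hle : length gs <= length (flat_map gate_code gs)).
    { clear. induction gs as [|g gs IH]; [easy|]. cbn [flat_map length]. rewrite length_app.
      destruct g; cbn [gate_code length]; lia. }
    rewrite Er in Hln. rewrite length_app in Hln. lia. }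
  (* [N] exceeds every input entry and there are at most [n] gates, hence the threshold [N * N]. *)
  assert (HTN : N * 2 ^ length gs <= T).
  { unfold T. apply Nat.mul_le_mono_l. apply Nat.pow_le_mono_r; lia. }
  set (C := mkCircuit gs out0) in *.
  pose proof (wins_circuit N T K C b (2 * length gs + 2) HwfK HbK Hin HbN HTN ltac:(cbn; lia))
    as Hwins.
  eapply wp_conseq.
  { apply (wp_search B T K k gs (elt_code b) out0 (encode T K b) s4) with (1 := Hbig); auto.
    - apply parse_point_spec in Hpoint as [<- _]. now rewrite <- Er.
    - intros i. destruct (nth i gs (GInput None)) as [e | |] eqn:Ee; try easy.
      now apply (Hin i e).
    - apply Nat.le_trans with (num_codes T K * num_codes T K); [|lia].
      unfold num_codes. assert (S T ^ 1 <= inf_code T K) by (apply Nat.pow_le_mono_r; lia).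
      rewrite Nat.pow_1_r in *. pose proof (Nat.pow_gt_lin_r 2 n ltac:(lia)) as Hn. fold N in Hn. nia.
    (* Since [K <= n], the number of codes is at most [(T + 1) ^ (n + 1)]; its square and one more
       factor [T + 1] cover [E]. *)
    - assert (HE : num_codes T K * num_codes T K + 1 <= S T ^ (2 * n + 3)).
      { replace (2 * n + 3) with (S (S n + S n)) by lia.
        rewrite Nat.pow_succ_r', Nat.pow_add_r.
        assert (HW : num_codes T K <= S T ^ S n).
        { rewrite Nat.pow_succ_r'. unfold num_codes.
          assert (HI : inf_code T K <= S T ^ n) by (apply Nat.pow_le_mono_r; lia).
          pose proof (Nat.pow_nonzero (S T) n). nia. }
        pose proof (Nat.mul_le_mono _ _ _ _ HW HW). pose proof (Nat.pow_nonzero (S T) (S n)). nia. }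
      apply (Nat.pow_le_mono_l _ _ (4 * (2 * length gs + 2))) in HE.
      apply Nat.le_trans with (1 := HE). rewrite <- Nat.pow_mul_r. apply Hpow.
      apply Nat.mul_le_mono; lia.
    - unfold env. apply parse_point_spec in Hpoint as [<- _]. rewrite <- Er.
      repeat split; auto.
    - destruct (decode_encode T K b HbK) as [_ H]; [|exact H].
      intros v Ev. specialize (HbN v Ev). revert HbN. apply Forall_impl. intros; lia. }
  cbn beta. intros s'. apply Hgoal.
  change (wins (child T K gs) (num_codes T K * num_codes T K) (2 * length gs + 2)
    (out0, encode T K b, num_codes T K) = true) with
    (wins (child T K (c_gates C)) (num_codes T K * num_codes T K) (2 * length gs + 2)
    (c_out C, encode T K b, num_codes T K) = true).
  rewrite Hwins, <- Hsem. split.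
  - intros H. exists k, C, b. auto.
  - intros (k' & C' & b' & Hd & H). rewrite Hdec in Hd. now injection Hd as <- <- <-.
Qed.

(** For [m = S n] the three factors are at most [3 * m], [8 * m] and [16 * m], which gives
    [384 * m ^ 3]. Length 0 is separate because the power vanishes there and only the additive [c]
    remains. *)
Lemma bit_bound_poly c n : 400 <= c -> 2 + bit_bound n <= c * n ^ c + c.
Proof.
  intros Hc. destruct n as [|n].
  - change (bit_bound 0) with 49. lia.
  - assert (Hp : S n ^ 3 <= S n ^ c) by (apply Nat.pow_le_mono_r; lia).
    assert (Hm : 400 * S n ^ 3 <= c * S n ^ c) by (apply Nat.mul_le_mono; lia).
    assert (Hb : bit_bound (S n) <= 3 * S n * ((8 * S n) * (16 * S n)) + 1).
    { unfold bit_bound. apply Nat.add_le_mono_r. repeat apply Nat.mul_le_mono; lia. }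
    replace (3 * S n * ((8 * S n) * (16 * S n))) with (384 * S n ^ 3) in Hb by (cbn [Nat.pow]; lia).
    lia.
Qed.

Theorem theorem6 : PSPACE MC_star.
Proof.
  (* Registers 0 to 49 are the variables of the program; temporaries start at counter 50. *)
  destruct (compile_decides 50 decide_cmd rres MC_star bit_bound) as [Hwf Hdec].
  - lia.
  - reflexivity.
  - intros x. split.
    + unfold bit_bound. nia.
    + apply wp_decide.
  - exists (cm_TM (compile 50 decide_cmd rres)), 400. split; [exact Hwf|].
    intros x. destruct (Hdec x) as [H1 H2]. split; [exact H1|].
    intros t. eapply Nat.lt_le_trans; [apply H2|]. now apply bit_bound_poly.
Qed.
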